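(* Let $\alpha\in\mathbb{Q}\cap(0,1/2)$ with $\alpha\neq1/3$. If $\mathfrak{z}\in\mathcal{H}(M_\alpha^\circ)$, then $$\Gamma_{\mathfrak z}=\left\langle\begin{bmatrix}1&-1\\0&1\end{bmatrix},\begin{bmatrix}1&0\\-1/\mathfrak{z}&1\end{bmatrix}\right\rangle<\mathrm{PSL}_2(\mathbb{C})$$ is the holonomy group for the developing map associated to $\Omega(\alpha)_{\mathfrak z}$.
   Context: Farey notation. $\mathbb{Q}_0=\mathbb{Q}\cap[0,1]$, $\widehat{\mathbb{Q}}_0=\mathbb{Q}_0\cup\{\infty\}$; fractions are in lowest terms with positive denominator, $0=0/1$, $1=1/1$, $\infty=1/0$. A pair $\{p/q,r/s\}\subset\widehat{\mathbb{Q}}_0$ is a Farey pair if $ps-rq=\pm1$; $p/q\oplus r/s=(p+r)/(q+s)$; $\gamma\oplus^0\beta=\gamma$, $\gamma\oplus^j\beta=(\gamma\oplus^{j-1}\beta)\oplus\beta$. Edges. An edge is a Farey pair $e\subset\mathbb{Q}_0$, with endpoints $e^L<e^R$. For $e\neq\{0,1\}$, $e^-$ and $e^+$ are the endpoints with smaller and larger denominator, $\hat e\in\mathbb{Q}_0$ is determined by $\hat e\oplus e^-=e^+$, and $\nu(e)=-1$ if $e^-=e^L$, $\nu(e)=1$ if $e^-=e^R$. Polynomials. $d_{\mathcal Q}(p/q)=(-1)^px^q$. $\mathcal{Q},\mathcal{N}:\widehat{\mathbb{Q}}_0\to\mathbb{Z}[x]$ are the unique functions with $\mathcal{Q}(0)=1,\mathcal{Q}(\infty)=0,\mathcal{Q}(1)=1$,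 $\mathcal{N}(0)=\mathcal{N}(\infty)=\mathcal{N}(1)=1$, and $\mathcal{F}(\gamma\oplus^2\beta)=-d_{\mathcal Q}(\beta)\mathcal{F}(\gamma)+\mathcal{Q}(\beta)\mathcal{F}(\gamma\oplus\beta)$ for $\mathcal F\in\{\mathcal Q,\mathcal N\}$ and every Farey pair $\{\beta,\gamma\}$ with $\gamma\oplus^2\beta\in\mathbb{Q}_0$. Put $\mathcal{V}=\mathcal{N}/\mathcal{Q}$ and $\mathcal{Z}(e)=-d_{\mathcal Q}(\hat e)^{-\nu(e)}(\mathcal{Q}(e^L)/\mathcal{Q}(e^R))^2$. A subscript $\mathfrak z$ denotes evaluation at $x=\mathfrak{z}$. Funnel. $F_\alpha$ has edges $e_0,\dots,e_{n+1}$: $e_0=\{0,1\}$; given $e_j$, let $c=e_j^L\oplus e_j^R$; if $c=\alpha$ stop and set $j=n+1$; if $\alpha<c$ then $e_{j+1}=\{e_j^L,c\}$; if $\alpha>c$ then $e_{j+1}=\{c,e_j^R\}$. Interior edges: $e_1,\dots,e_n$, $n\ge1$. Let $s_j$ be the triple $\{e_j^L,e_j^R,e_j^L\oplus e_j^R\}$, $0\le j\le n$. Sakuma--Weeks triangulation. Let $X=\mathbb{C}-\mathbb{Z}[i]$ and $\Theta$ the group generated by the order-2 rotations about points of $\mathbb{Z}[i]$. For $0\le j\le n$ let $X_j$ be a copy of $X$ ideally triangulated by all lines through points of $\mathbb{Z}[i]$ with slope in $s_j$; edges are labeled by slope. For $1\le j\le n$, $X_{j-1}$ and $X_j$ share the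 edges with slopes $e_j^\pm$; each parallelogram cut out by these has a diagonal of slope $\hat e_j$ in $X_{j-1}$ and a diagonal of slope $e_j^L\oplus e_j^R$ in $X_j$, and is filled by an ideal tetrahedron having the two diagonals as opposite edges. Stacking the $X_j$ and these tetrahedra from top to bottom, identifying common edges, and taking the quotient by $\Theta$ gives a labeled complex $K$ with two tetrahedra $\Delta_j$ for each $1\le j\le n$. Edges of $\Delta_j$ labeled $\hat e_j$ are top edges, those labeled $e_j^L\oplus e_j^R$ bottom edges. $M_\alpha^\circ$ is obtained from $K$ by folding the top surface $X_0/\Theta$ across its edges labeled $1/2$ (identifying the two triangles adjacent to each such edge). Hyperbolic structures. $\mathcal{H}(M_\alpha^\circ)=\{\mathfrak{z}\in\mathbb{C}:\operatorname{Im}\mathfrak{z}>0,\ \operatorname{Im}\mathcal{Z}(e_j)_{\mathfrak z}>0\text{ for }1\le j\le n\}$. A point $\mathfrak z$ of it determines a hyperbolic structure on $M_\alpha^\circ$: each tetrahedron of $\Delta_j$ is an ideal hyperbolic tetrahedron whose top and bottom edges have edge parameter $t=\mathcal{Z}(e_j)_{\mathfrak z}$, whose edges labeled $e_j^L$ have parameter $\zeta(t)$ and whose edges labeled $e_j^R$ have parameter $\zeta(\zeta(t))$, $\zeta(t)=1/(1-t)$. Developing map associated to $\Omega(\alpha)_{\mathfrak z}$. For an edge $e\ne\{0,1\}$ put $\varepsilon=-1$ if $\nu(e)=1$ and $\varepsilon=0$ otherwise; $\delta(e)_{\mathfrak z}$ and $\delta'(e)_{\mathfrak z}$ are the ideal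 tetrahedra in $\mathbb{H}^3$ spanned by $\infty$ and, respectively, the values at $\mathfrak z$ of $\varepsilon+\mathcal{V}(\hat e),-1+\mathcal{V}(e^L),\mathcal{V}(e^R)$ and of $\mathcal{V}(e^-\oplus e^+),\mathcal{V}(e^-),\mathcal{V}(e^+)$. $\Omega(\alpha)_{\mathfrak z}$ consists of the tetrahedra $\delta(e_j)_{\mathfrak z},\delta'(e_j)_{\mathfrak z}$, $1\le j\le n$. The developing map $\widetilde{M}_\alpha^\circ\to\mathbb{H}^3$ is the one sending a lift of a tetrahedron of $\Delta_1$ to $\delta(e_1)_{\mathfrak z}=[0,1,1-\mathfrak{z},\infty]$ by an orientation- and label-preserving isometry, where $[0,1]$, $[1-\mathfrak z,\infty]$ are labeled $1/2$, $[0,\infty]$, $[1,1-\mathfrak z]$ are labeled $0$, $[1,\infty]$ is labeled $1$ and $[0,1-\mathfrak z]$ is labeled $1/3$. Its holonomy group is the image of the associated holonomy homomorphism of $\pi_1M_\alpha^\circ$.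
   Formalization: The developing map is also required to have parabolic holonomy around the cusps; this is automatic unless 0 is an endpoint of e_n (e.g. α=1/4), where the complex is pinched along the edge labeled 0 and the tetrahedra alone do not determine the developing map. *)

(* Defs.v *)
From mathcomp Require Import all_boot all_order all_algebra.
From mathcomp Require Import reals complex.

Set Implicit Arguments.
Unset Strict Implicit.
Unset Printing Implicit Defensive.

Import Order.TTheory GRing.Theory Num.Theory.
Local Open Scope ring_scope.

(** * Farey fractions, edges, funnels *)

(* p/q is the pair (p, q); no normalisation is built in, see [inQ0]. *)
Notation fareyfrac := (nat * nat)%type.

Definition fr0 : fareyfrac := (0, 1)%N.
Definition fr1 : fareyfrac := (1, 1)%N.
Definition fr12 : fareyfrac := (1, 2)%N.
Definition frinf : fareyfrac := (1, 0)%N.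

Definition inQ0 (x : fareyfrac) : bool :=
  [&& coprime x.1 x.2, (0 < x.2)%N & (x.1 <= x.2)%N].
Definition inQ0hat (x : fareyfrac) : bool := inQ0 x || (x == frinf).

Definition fval (x : fareyfrac) : rat := x.1%:R / x.2%:R.

Definition farey_pair (x y : fareyfrac) : bool :=
  (x.1 * y.2 == (y.1 * x.2).+1)%N || (y.1 * x.2 == (x.1 * y.2).+1)%N.

Definition oplus (x y : fareyfrac) : fareyfrac := (x.1 + y.1, x.2 + y.2)%N.
Definition oplusn (g : fareyfrac) (j : nat) (b : fareyfrac) : fareyfrac :=
  iter j (fun x => oplus x b) g.

(* An edge is the ordered pair (e^L, e^R). *)
Notation edge := (fareyfrac * fareyfrac)%type.

Definition eminus (e : edge) : fareyfrac := if (e.1.2 < e.2.2)%N then e.1 else e.2.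
Definition eplus (e : edge) : fareyfrac := if (e.1.2 < e.2.2)%N then e.2 else e.1.
(* On an edge other than {0, 1} neither subtraction truncates. *)
Definition ehat (e : edge) : fareyfrac :=
  ((eplus e).1 - (eminus e).1, (eplus e).2 - (eminus e).2)%N.
Definition enu (e : edge) : int := if eminus e == e.1 then -1 else 1.
Definition apex (e : edge) : fareyfrac := oplus e.1 e.2.

Definition funnel_next (alpha : rat) (e : edge) : edge :=
  if alpha < fval (apex e) then (e.1, apex e) else (apex e, e.2).
(* The terms after the stopping index are never used. *)
Definition funnel (alpha : rat) (j : nat) : edge :=
  iter j (funnel_next alpha) (fr0, fr1).
(* The funnel of alpha has edges e_0, ..., e_{n+1}. *)
Definition funnel_stops (alpha : rat) (n : nat) : Prop :=
  fval (apex (funnel alpha n.+1)) = alpha /\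
  forall j, (j <= n)%N -> fval (apex (funnel alpha j)) <> alpha.

(** * The polynomials Q and N *)

Definition dQ (x : fareyfrac) : {poly int} := (-1) ^+ x.1 * 'X^(x.2).

Definition farey_recursive (Q F : fareyfrac -> {poly int}) : Prop :=
  forall b g : fareyfrac, inQ0hat b -> inQ0hat g -> farey_pair b g ->
    inQ0 (oplusn g 2 b) ->
    F (oplusn g 2 b) = - dQ b * F g + Q b * F (oplusn g 1 b).

Definition is_calQ (Q : fareyfrac -> {poly int}) : Prop :=
  [/\ Q fr0 = 1, Q frinf = 0, Q fr1 = 1 & farey_recursive Q Q].
Definition is_calN (Q N : fareyfrac -> {poly int}) : Prop :=
  [/\ N fr0 = 1, N frinf = 1, N fr1 = 1 & farey_recursive Q N].

(** * Complex numbers, the Riemann sphere, Moebius maps *)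

Section Sphere.
Variable R : realType.
Local Notation C := (R[i]).

Definition Im_pos (w : C) : Prop := 0 < complex.Im w.

(* The Riemann sphere; None is the point at infinity. *)
Definition CP1 : Type := option C.

Definition hom (p : CP1) : C * C := if p is Some w then (w, 1) else (1, 0).

Definition of_hom (x y : C) : CP1 := if y == 0 then None else Some (x / y).

Definition shift (c : C) (p : CP1) : CP1 := omap (fun w => c + w) p.

Definition mx2 (a b c d : C) : 'M[C]_2 :=
  \matrix_(i < 2, j < 2)
    if i == 0 then (if j == 0 then a else b) else (if j == 0 then c else d).

Definition mobius (A : 'M[C]_2) (p : CP1) : CP1 :=
  of_hom (A 0 0 * (hom p).1 + A 0 1 * (hom p).2)
         (A 1 0 * (hom p).1 + A 1 1 * (hom p).2).

Definition bracket (p q : CP1) : C := (hom p).1 * (hom q).2 - (hom q).1 * (hom p).2.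

(* The image of s under the Moebius map p, q, r |-> 0, oo, 1.  When p, q, r, s
   are the positively ordered vertices of an ideal tetrahedron, this is the
   edge parameter of the edge [p, q]. *)
Definition edge_param (p q r s : CP1) : C :=
  (bracket s p * bracket r q) / (bracket s q * bracket r p).

Definition zeta (t : C) : C := 1 / (1 - t).

(** A subset of PSL_2(C) is represented by its preimage in SL_2(C). *)

Inductive SL_generated (S : 'M[C]_2 -> Prop) : 'M[C]_2 -> Prop :=
| SLgen_in A : S A -> SL_generated S A
| SLgen_1 : SL_generated S 1%:M
| SLgen_mul A B : SL_generated S A -> SL_generated S B -> SL_generated S (A *m B)
| SLgen_inv A : SL_generated S A -> SL_generated S (invmx A).

Definition PSL_generated (S : 'M[C]_2 -> Prop) (A : 'M[C]_2) : Prop :=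
  SL_generated S A \/ SL_generated S (- A).

Definition Gamma (z : C) : 'M[C]_2 -> Prop :=
  PSL_generated (fun A => A = mx2 1 (-1) 0 1 \/ A = mx2 1 0 (- z^-1) 1).

(** * Evaluation at z *)

Definition evalz (z : C) (p : {poly int}) : C := (map_poly intr p).[z].

Definition calV (Q N : fareyfrac -> {poly int}) (z : C) (x : fareyfrac) : CP1 :=
  of_hom (evalz z (N x)) (evalz z (Q x)).

(* A pole of the rational function gives the value 0, which is not in the upper
   half-plane either. *)
Definition calZ (Q : fareyfrac -> {poly int}) (z : C) (e : edge) : C :=
  - (evalz z (dQ (ehat e))) ^ (- enu e) *
    (evalz z (Q e.1) / evalz z (Q e.2)) ^+ 2.

Definition in_H (alpha : rat) (n : nat) (Q : fareyfrac -> {poly int}) (z : C) : Prop :=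
  Im_pos z /\
  forall j, (1 <= j <= n)%N -> Im_pos (calZ Q z (funnel alpha j)).

End Sphere.

(** * The Sakuma--Weeks complex *)

(* The pair (x, y) is the lattice point x + iy of Z[i]. *)
Notation lattice := (int * int)%type.

Definition svec (x : fareyfrac) : lattice := (x.2%:Z, x.1%:Z).
(* The label of the edge joining two lattice points: its slope. *)
Definition slope (x y : lattice) : fareyfrac :=
  (absz (y - x).2, absz (y - x).1).

(* Before dividing by Theta, the tetrahedra between X_(j-1) and X_j are in
   bijection with the parallelograms cut out of the plane by the lines of slopes
   e_j^L and e_j^R through lattice points: (j, v) is the one over the
   parallelogram v, v + u^L, v + u^R, v + u^L + u^R, where u^L and u^R are the
   primitive vectors of these slopes.  Its top edge is
   [v + u^L, v + u^R] and its bottom edge is [v, v + u^L + u^R]. *)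
Notation tet := (nat * lattice)%type.

Section Complex.
Variables (alpha : rat) (n : nat).

Definition valid (T : tet) : bool := (1 <= T.1 <= n)%N.

Definition cA (T : tet) : lattice := T.2.
Definition cB (T : tet) : lattice := T.2 + svec (funnel alpha T.1).1.
Definition cC (T : tet) : lattice := T.2 + svec (funnel alpha T.1).2.
Definition cD (T : tet) : lattice :=
  T.2 + svec (funnel alpha T.1).1 + svec (funnel alpha T.1).2.
Definition corners (T : tet) : seq lattice := [:: cA T; cB T; cC T; cD T].

(* The identifications that produce M_alpha from the stacked tetrahedra.
   [Trans c] and [Rot c] run over the group Theta: translation by 2c and
   rotation of angle pi about c ([Trans 0] is the identity, which accounts for
   the cells that two stacked tetrahedra have in common).
   [Fold P] is the folding of the top surface across the edge of slope 1/2 from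
   P to P + (2, 1): the affine reflection exchanging P + (1, 0) and P + (1, 1),
   used on the two triangles of X_0 adjacent to this edge only. *)
Inductive gluing := Trans of lattice | Rot of lattice | Fold of lattice.

Definition gmap (g : gluing) (w : lattice) : lattice :=
  match g with
  | Trans c => w + c *+ 2
  | Rot c => c *+ 2 - w
  | Fold P => P + ((w - P).1, (w - P).1 - (w - P).2)
  end.

Definition gdom (g : gluing) (w : lattice) : bool :=
  if g is Fold P
  then w \in [:: P; P + svec fr0; P + svec fr1; P + svec fr12] else true.

(* In a stacked complex a simplex is determined by its vertices, so w and w' are
   an identified pair of vertices of T and T' in the following situation. *)
Definition glued (T : tet) (g : gluing) (T' : tet) (w w' : lattice) : bool :=
  [&& w \in corners T, w' \in corners T', gdom g w & w' == gmap g w].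

(* T and T' have a common edge, hence a common face when three vertices are
   identified, and a common tetrahedron when four are.  Passing through edges
   and not only through faces is needed: when e_n still has 0 as an endpoint,
   M_alpha is not a manifold along its edges labeled 0, and some elements of its
   fundamental group are not represented by paths through faces. *)
Definition step (T : tet) (g : gluing) (T' : tet) : Prop :=
  [/\ valid T, valid T' &
   exists x y x' y', [/\ x != y, glued T g T' x x' & glued T g T' y y']].

(* A path in M_alpha is listed by its successive gluings and tetrahedra. *)
Notation dpath := (seq (gluing * tet)).

Fixpoint is_path (T : tet) (p : dpath) (T' : tet) : Prop :=
  if p is (g, T1) :: p1 then step T g T1 /\ is_path T1 p1 T' else T = T'.

(* The path stays around the vertex x, which is carried to x'. *)
Fixpoint tracks (T : tet) (x : lattice) (p : dpath) (x' : lattice) : Prop :=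
  if p is (g, T1) :: p1
  then glued T g T1 x (gmap g x) /\ tracks T1 (gmap g x) p1 x'
  else x = x'.

(* The loops at T in the star of an edge.  Stars of edges are simply connected,
   and these loops include all backtrackings. *)
Definition edge_loop (T : tet) (q : dpath) : Prop :=
  is_path T q T /\
  exists x y, [/\ x \in corners T, y \in corners T, x != y,
                  tracks T x q x & tracks T y q y].

(* The loops at T in the link of an ideal vertex. *)
Definition cusp_loop (T : tet) (q : dpath) : Prop :=
  is_path T q T /\ exists2 x, x \in corners T & tracks T x q x.

(* Homotopy of paths from T0 with fixed endpoints.  The classes are the
   tetrahedra (with a name in the stacked complex) of the universal cover;
   those of the loops at T0 form the fundamental group. *)
Inductive homotopic (T0 : tet) : dpath -> dpath -> Prop :=
| htp_refl p : homotopic T0 p p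
| htp_sym p q : homotopic T0 p q -> homotopic T0 q p
| htp_trans p q r : homotopic T0 p q -> homotopic T0 q r -> homotopic T0 p r
| htp_edge p q r T T' : is_path T0 p T -> edge_loop T q -> is_path T r T' ->
    homotopic T0 (p ++ r) (p ++ q ++ r).

(** * Developing maps and holonomy *)

Variables (R : realType) (Q N : fareyfrac -> {poly int}) (z : R[i]).
Local Notation C := (R[i]).
Local Notation CP1 := (CP1 R).

(* The finite vertices of delta(e). *)
Definition delta_hat (e : edge) : CP1 :=
  shift (if enu e == 1 then -1 else 0) (calV Q N z (ehat e)).
Definition delta_L (e : edge) : CP1 := shift (-1) (calV Q N z e.1).
Definition delta_R (e : edge) : CP1 := calV Q N z e.2.

(* For e = e_1 this is the labeling of [0, 1, 1 - z, oo] in which [0, 1] and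
   [1 - z, oo] are labeled 1/2, [0, oo] and [1, 1 - z] are labeled 0, [1, oo] is
   labeled 1 and [0, 1 - z] is labeled 1/3. *)
Definition delta_edges (e : edge) : seq (CP1 * CP1 * fareyfrac) :=
  [:: (delta_hat e, delta_R e, e.1); (delta_L e, None, e.1);
      (delta_hat e, delta_L e, e.2); (delta_R e, None, e.2);
      (delta_hat e, None, ehat e); (delta_L e, delta_R e, apex e)].

(* An isometry of an ideal tetrahedron into hyperbolic space is given by the
   images of the ideal vertices; only the values of f at the corners of T
   matter. *)
Definition label_preserving (e : edge) (T : tet) (f : lattice -> CP1) : Prop :=
  forall x y, x \in corners T -> y \in corners T -> x != y ->
    (f x, f y, slope x y) \in delta_edges e \/
    (f y, f x, slope x y) \in delta_edges e.

(* The stacking orders (cB, cC, cD, cA) positively, and so also its even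
   rearrangements below.  As t is not real, the equations force f to be
   injective on the corners. *)
Definition shaped (T : tet) (f : lattice -> CP1) : Prop :=
  let t := calZ Q z (funnel alpha T.1) in
  let a := f (cA T) in let b := f (cB T) in
  let c := f (cC T) in let d := f (cD T) in
  [/\ edge_param b c d a = t /\ edge_param d a b c = t,
      edge_param a b d c = zeta t /\ edge_param c d b a = zeta t &
      edge_param a c b d = zeta (zeta t) /\ edge_param b d a c = zeta (zeta t)].

Definition eq_on (T : tet) (f f' : lattice -> CP1) : Prop :=
  forall w, w \in corners T -> f w = f' w.

Definition moves (A : 'M[C]_2) (T : tet) (f f' : lattice -> CP1) : Prop :=
  \det A = 1 /\ eq_on T f' (fun w => mobius A (f w)).

(* A is a lift to SL_2(C) of the holonomy of the class of the loop l. *)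
Definition holonomy_of (T0 : tet) (D : dpath -> lattice -> CP1)
    (l : dpath) (A : 'M[C]_2) : Prop :=
  \det A = 1 /\
  forall p T, is_path T0 p T -> moves A T (D p) (D (l ++ p)).

(* D p gives the image of the lift reached by p.  The last two conditions follow
   from the others when M_alpha is a manifold.  When M_alpha is pinched along an
   edge, the position of the tetrahedra on one side of this edge relative to the
   other side is determined only by the parabolicity of the cusps. *)
Record developing (T0 : tet) (D : dpath -> lattice -> CP1) : Prop := {
  dev_base : label_preserving (funnel alpha 1) T0 (D [::]);
  dev_shape : forall p T, is_path T0 p T -> shaped T (D p);
  dev_glue : forall p T g T', is_path T0 p T -> step T g T' ->
    forall w w', glued T g T' w w' -> D (rcons p (g, T')) w' = D p w;
  dev_homotopy : forall p q T, is_path T0 p T -> homotopic T0 p q ->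
    eq_on T (D p) (D q);
  dev_equivariant : forall l, is_path T0 l T0 -> exists A, holonomy_of T0 D l A;
  dev_parabolic : forall p T q A, is_path T0 p T -> cusp_loop T q ->
    moves A T (D p) (D (p ++ q)) -> (\tr A) ^+ 2 = 4%:R
}.

(* The image of the holonomy homomorphism, as the preimage in SL_2(C). *)
Definition holonomy_group (T0 : tet) (D : dpath -> lattice -> CP1)
    (A : 'M[C]_2) : Prop :=
  exists2 l, is_path T0 l T0 & holonomy_of T0 D l A.

End Complex.

(* Main.v *)
Require Import Defs.
From mathcomp Require Import all_boot all_order all_algebra.
From mathcomp Require Import reals complex.
From mathcomp Require Import boolp.
From mathcomp Require Import ring zify.

Set Implicit Arguments.
Unset Strict Implicit.
Unset Printing Implicit Defensive.

Import Order.TTheory GRing.Theory Num.Theory.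
Local Open Scope ring_scope.

(** The vertices of the tetrahedra are lattice points, and everything rests on a
    formula for the link of such a vertex x. Send x to infinity. The edge of
    slope s from x then ends at the point V(s) = N(s)/Q(s) of the plane, up to
    an integer: turning by half a turn around x translates the plane by 1. This
    gives the position [link x y w] of w seen from x with y at the origin, and
    [frame x y] places a tetrahedron with x at infinity and y at 0. A sign that
    depends on the parity of the ordinate of x makes these positions invariant
    under folding.

    Frames form a coherent system. Replacing y by another corner w translates
    the frame, and exchanging x and y is the map t |-> k/t, where
    k = -z^b/Q(s)^2 depends only on the slope s = a/b of [x, y]
    ([link_cocycle], [link_swap]). Both facts reduce to relations between the
    values of Q and N at the vertices of a Farey triangle; they resemble the
    Markoff equation, and the recursion that defines Q and N carries them down
    the funnel ([farey_relations_funnel], [link_formulas]). The same relations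
    show that the frame of a tetrahedron over the edge e has the parameter Z(e)
    at its top and bottom edges ([shaped_frame]). The gluings preserve link
    positions and k ([link_glue], [swap_coef_glue]); for the foldings this rests on
    V(0) = V(1) and on the sign.

    Suppose now that T and T' have the edge [x, y] in common, with names x', y'
    in T'. A placement M o frame x y of T determines the placement
    M o frame x' y' of T', and by the two coherence rules the same one is
    obtained from every other common edge ([carry_glued]). Transport along
    paths built from such steps is the identity around an edge and a
    translation around a vertex; hence it is a developing map
    ([rigid_developing]).

    Conversely every developing map follows the transport
    ([developing_rigid]). Across a face this is clear, since three vertices
    determine a placement. Two tetrahedra that share only an edge are compared
    by moving around this edge through faces: from each of them one climbs to a
    topmost tetrahedron of the stack that contains the edge ([climb]). The
    edges of slope 0 at the top are an exception: the two tetrahedra of the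
    first level on the two sides of such an edge have no other vertex in
    common. There a ratio remains undetermined, and it is 1 because a loop
    around an end of the edge has parabolic holonomy ([linked_slope0]).

    It remains to compute the holonomy of the transport. The frame
    [cusp_frame x y] has x at infinity and y at V of the slope, without the
    sign; at the ends of the top edge it is the tetrahedron delta(e). Two cusp frames
    of a tetrahedron differ by integral translations, which lie in Gamma, and
    by the rotations [flip s] of order two that reverse the edge from infinity
    to V(s). The translations of the lattice commute with all gluings up to
    renaming, so they induce a Klein four-group of symmetries, and this group
    normalises Gamma ([normalizes_parity]). The flip of slope s lies in the
    coset of Gamma that belongs to the parity of the lattice vector of slope s:
    this holds for the slopes 0 and 1/2, and the flip of a diagonal is reached
    through the sides of the parallelogram ([flip_in_coset_apex]). Therefore
    each developed tetrahedron is a cusp frame moved by an element of the coset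
    given by the parity of its corner ([Gamma_placed]), and the loops have
    holonomy in Gamma ([holonomy_group_sub]). In the other direction, the
    generators of Gamma or their inverses are the holonomies of loops around
    the vertices at infinity and at 0: half a turn through a rotation, closed
    up by a folding ([generator_T], [generator_U]). *)

Local Notation hom := Defs.hom.
Local Arguments funnel : simpl never.

(** * Moebius maps of the Riemann sphere *)

Section ProjectiveLine.
Variable R : realType.
Local Notation C := (R[i]).
Local Notation CP1 := (CP1 R).
Implicit Types (A B M : 'M[C]_2) (p q r s : CP1) (a b c d x y k t : C).

Lemma ord2P (i : 'I_2) : i = 0 \/ i = 1.
Proof. by case: i => [[|[|//]] hi]; [left | right]; apply: val_inj. Qed.

Lemma mx2E a b c d :
  ((mx2 a b c d 0 0 = a) * (mx2 a b c d 0 1 = b) *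
   (mx2 a b c d 1 0 = c) * (mx2 a b c d 1 1 = d))%type.
Proof. by rewrite /mx2 !mxE. Qed.

Lemma mx2_eta A : A = mx2 (A 0 0) (A 0 1) (A 1 0) (A 1 1).
Proof.
apply/matrixP => i j; rewrite !mxE.
by case: (ord2P i) => ->; case: (ord2P j) => ->.
Qed.

Lemma mx2_ext A B : A 0 0 = B 0 0 -> A 0 1 = B 0 1 -> A 1 0 = B 1 0 ->
  A 1 1 = B 1 1 -> A = B.
Proof. by move=> h1 h2 h3 h4; rewrite (mx2_eta A) (mx2_eta B) h1 h2 h3 h4. Qed.

Lemma det2 A : \det A = A 0 0 * A 1 1 - A 0 1 * A 1 0.
Proof.
rewrite (expand_det_row _ 0) !big_ord_recl big_ord0 /cofactor !det_mx11 !mxE.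
have l0 : lift 0 0 = 1 :> 'I_2 by apply: val_inj.
have l1 : lift 1 0 = 0 :> 'I_2 by apply: val_inj.
by rewrite !l0 !l1 /= ?addn0 ?add0n expr0 expr1; ring.
Qed.

Lemma det_mx2 a b c d : \det (mx2 a b c d) = a * d - b * c.
Proof. by rewrite det2 !mx2E. Qed.

Lemma mulmx2E A B i j : (A *m B) i j = A i 0 * B 0 j + A i 1 * B 1 j.
Proof.
rewrite !mxE !big_ord_recl big_ord0 addr0.
by have -> : lift 0 0 = 1 :> 'I_2 by apply: val_inj.
Qed.

Lemma mul_mx2 a b c d a' b' c' d' : mx2 a b c d *m mx2 a' b' c' d' =
  mx2 (a * a' + b * c') (a * b' + b * d') (c * a' + d * c') (c * b' + d * d').
Proof. by apply: mx2_ext; rewrite !mulmx2E !mx2E. Qed.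

Lemma scale_mx2 k a b c d : k *: mx2 a b c d = mx2 (k * a) (k * b) (k * c) (k * d).
Proof. by apply: mx2_ext; rewrite mxE !mx2E. Qed.

Lemma scalar_mx2 k : k%:M = mx2 k 0 0 k.
Proof. by apply: mx2_ext; rewrite !mxE. Qed.

Lemma tr2 A : \tr A = A 0 0 + A 1 1.
Proof.
rewrite /mxtrace !big_ord_recl big_ord0 addr0.
by have -> : lift 0 0 = 1 :> 'I_2 by apply: val_inj.
Qed.

Lemma detZ2 k A : \det (k *: A) = k ^+ 2 * \det A.
Proof. by rewrite detZ. Qed.

Lemma unit2 A : \det A != 0 -> A \in unitmx.
Proof. by rewrite unitmxE unitfE. Qed.

Lemma det_inv2 A : \det A != 0 -> \det (invmx A) != 0.
Proof. by move=> h; rewrite det_inv invr_eq0. Qed.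

Lemma det_mul2 A B : \det A != 0 -> \det B != 0 -> \det (A *m B) != 0.
Proof. by move=> hA hB; rewrite det_mulmx mulf_neq0. Qed.

Lemma hom_of_hom x y : (x != 0) || (y != 0) ->
  exists2 k, k != 0 & hom (of_hom x y) = (k * x, k * y).
Proof.
rewrite /of_hom; case: (eqVneq y 0) => [-> | hy].
  rewrite orbF => hx; exists x^-1; first by rewrite invr_eq0.
  by rewrite mulVf // mulr0.
move=> _; by exists y^-1; rewrite ?invr_eq0 // mulVf // mulrC.
Qed.

Lemma of_hom_hom p : of_hom (hom p).1 (hom p).2 = p.
Proof. by case: p => [w|]; rewrite /of_hom /= ?eqxx ?oner_eq0 ?divr1. Qed.

Lemma hom_neq0 p : ((hom p).1 != 0) || ((hom p).2 != 0).
Proof. by case: p => [w|] /=; rewrite oner_eq0 ?orbT. Qed.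

Lemma of_homZ k x y : k != 0 -> of_hom (k * x) (k * y) = of_hom x y.
Proof.
move=> hk; rewrite /of_hom mulf_eq0 (negbTE hk) /=; case: eqP => // /eqP hy.
by congr Some; field; rewrite hy hk.
Qed.

Lemma mx2_ker A x y : \det A != 0 -> (x != 0) || (y != 0) ->
  (A 0 0 * x + A 0 1 * y != 0) || (A 1 0 * x + A 1 1 * y != 0).
Proof.
rewrite det2 => hA hxy; apply: contraT; rewrite negb_or !negbK => /andP[/eqP h1 /eqP h2].
have e1 : (A 0 0 * A 1 1 - A 0 1 * A 1 0) * x = 0.
  transitivity (A 1 1 * (A 0 0 * x + A 0 1 * y) - A 0 1 * (A 1 0 * x + A 1 1 * y)).
    by ring.
  by rewrite h1 h2 !mulr0 subr0.
have e2 : (A 0 0 * A 1 1 - A 0 1 * A 1 0) * y = 0.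
  transitivity (A 0 0 * (A 1 0 * x + A 1 1 * y) - A 1 0 * (A 0 0 * x + A 0 1 * y)).
    by ring.
  by rewrite h1 h2 !mulr0 subr0.
move/eqP: e1; move/eqP: e2; rewrite !mulf_eq0 (negbTE hA) /= => /eqP ey /eqP ex.
by rewrite ex ey eqxx in hxy.
Qed.

Lemma mobius_of_hom A x y : (x != 0) || (y != 0) ->
  mobius A (of_hom x y) = of_hom (A 0 0 * x + A 0 1 * y) (A 1 0 * x + A 1 1 * y).
Proof.
move=> hxy; rewrite /mobius; have [k hk -> /=] := hom_of_hom hxy.
by rewrite -[RHS](of_homZ _ _ hk); congr of_hom; ring.
Qed.

Lemma mobiusM A B p : \det B != 0 -> mobius (A *m B) p = mobius A (mobius B p).
Proof.
move=> hB; rewrite {3}/mobius mobius_of_hom; last exact/mx2_ker/hom_neq0.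
by rewrite /mobius !mulmx2E; congr of_hom; ring.
Qed.

Lemma mobiusZ k A p : k != 0 -> mobius (k *: A) p = mobius A p.
Proof.
by move=> hk; rewrite /mobius !mxE -[RHS](of_homZ _ _ hk); congr of_hom; ring.
Qed.

Lemma mobiusN A p : mobius (- A) p = mobius A p.
Proof. by rewrite -scaleN1r mobiusZ // oppr_eq0 oner_eq0. Qed.

Lemma mobius1 p : mobius 1%:M p = p.
Proof.
by rewrite scalar_mx2 /mobius !mx2E !mul1r !mul0r addr0 add0r of_hom_hom.
Qed.

Lemma mobiusK A p : \det A != 0 -> mobius (invmx A) (mobius A p) = p.
Proof. by move=> hA; rewrite -mobiusM // mulVmx ?unit2 // mobius1. Qed.

Lemma mobiusVK A p : \det A != 0 -> mobius A (mobius (invmx A) p) = p.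
Proof. by move=> hA; rewrite -mobiusM ?det_inv2 // mulmxV ?unit2 // mobius1. Qed.

Lemma hom_mobius A p : \det A != 0 -> exists2 k, k != 0 &
  hom (mobius A p) = (k * (A 0 0 * (hom p).1 + A 0 1 * (hom p).2),
                      k * (A 1 0 * (hom p).1 + A 1 1 * (hom p).2)).
Proof. by move=> hA; apply: hom_of_hom; apply/mx2_ker/hom_neq0. Qed.

Lemma mobius_Some a b c d w : c * w + d != 0 ->
  mobius (mx2 a b c d) (Some w) = Some ((a * w + b) / (c * w + d)).
Proof. by move=> h; rewrite /mobius /of_hom !mx2E /= !mulr1 (negbTE h). Qed.

Lemma mobius_upper a b d w : d != 0 ->
  mobius (mx2 a b 0 d) (Some w) = Some ((a * w + b) / d).
Proof. by move=> h; rewrite mobius_Some mul0r add0r. Qed.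

Lemma mobius_upper_oo a b d : mobius (mx2 a b 0 d) None = None.
Proof. by rewrite /mobius /of_hom !mx2E /= mul0r mulr0 addr0 eqxx. Qed.

Definition transl t : 'M[C]_2 := mx2 1 t 0 1.
Definition invol k : 'M[C]_2 := mx2 0 k 1 0.

Lemma det_transl t : \det (transl t) = 1.
Proof. by rewrite det_mx2; ring. Qed.

Lemma det_invol k : \det (invol k) = - k.
Proof. by rewrite det_mx2; ring. Qed.

Lemma mobius_transl t w : mobius (transl t) (Some w) = Some (w + t).
Proof. by rewrite mobius_upper ?oner_eq0 // mul1r divr1. Qed.

Lemma mobius_transl_oo t : mobius (transl t) None = None.
Proof. exact: mobius_upper_oo. Qed.

Lemma transl_mul t u : transl t *m transl u = transl (t + u).
Proof. by rewrite mul_mx2; congr mx2; ring. Qed.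

Lemma mobius_invol k w : w != 0 -> mobius (invol k) (Some w) = Some (k / w).
Proof. by move=> h; rewrite mobius_Some ?mul1r ?mul0r ?addr0 ?add0r. Qed.

Lemma mobius_invol_oo k : mobius (invol k) None = Some 0.
Proof.
by rewrite /mobius /of_hom !mx2E /= !mulr0 !mulr1 !addr0 oner_eq0 mul0r.
Qed.

Lemma mobius_invol0 k : mobius (invol k) (Some 0) = None.
Proof.
by rewrite /mobius /of_hom !mx2E /= !mulr0 mul0r !addr0 eqxx.
Qed.

Lemma mobius_fix_oo M : mobius M None = None -> M 1 0 = 0.
Proof.
rewrite /mobius /of_hom /= !mulr1 !mulr0 !addr0.
by case: eqP.
Qed.

Lemma mobius_fix0 M : mobius M (Some 0) = Some 0 -> M 0 1 = 0.
Proof.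
rewrite /mobius /of_hom /= !mulr1 !mulr0 !add0r.
case: eqP => // /eqP h [] /eqP.
by rewrite mulf_eq0 invr_eq0 (negbTE h) orbF => /eqP.
Qed.

(** The stabiliser of the pair of points 0, infinity consists of the diagonal
    matrices; two points leave this much freedom. *)
Lemma mobius_eq_diag A B : \det A != 0 -> \det B != 0 ->
  mobius A None = mobius B None -> mobius A (Some 0) = mobius B (Some 0) ->
  exists a d, A = B *m mx2 a 0 0 d.
Proof.
move=> hA hB e1 e2; pose M := invmx B *m A.
exists (M 0 0), (M 1 1).
have -> : mx2 (M 0 0) 0 0 (M 1 1) = M.
  rewrite [RHS](mx2_eta M); congr mx2; apply/esym.
    by apply: mobius_fix0; rewrite mobiusM // e2 mobiusK.
  by apply: mobius_fix_oo; rewrite mobiusM // e1 mobiusK.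
by rewrite mulmxA mulmxV ?unit2 // mul1mx.
Qed.

Lemma mobius_eq3 A B c : c != 0 -> \det A != 0 -> \det B != 0 ->
  mobius A None = mobius B None -> mobius A (Some 0) = mobius B (Some 0) ->
  mobius A (Some c) = mobius B (Some c) -> exists2 k, k != 0 & A = k *: B.
Proof.
move=> hc hA hB e1 e2 e3.
have [a [d eA]] := mobius_eq_diag hA hB e1 e2.
have hD : \det (mx2 a 0 0 d) != 0.
  by move: hA; rewrite eA det_mulmx mulf_eq0 negb_or => /andP[].
have e4 : mobius (mx2 a 0 0 d) (Some c) = Some c.
  by rewrite -[RHS](mobiusK _ hB) -e3 eA mobiusM // mobiusK.
move: hD; rewrite det_mx2 mulr0 subr0 mulf_eq0 negb_or => /andP[ha hd].
move: e4; rewrite mobius_upper // addr0 => -[] e4.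
have ead : a = d.
  apply: (mulIf hc); apply: (divIf hd); rewrite e4; field; exact: hd.
exists a => //; rewrite eA -ead.
by apply: mx2_ext; rewrite !mulmx2E !mx2E mxE; ring.
Qed.

(** ** Brackets and cross ratios *)

Lemma bracket_eq0 p q : (bracket p q == 0) = (p == q).
Proof.
case: p => [x|]; case: q => [y|]; rewrite /bracket /=; last 3 first.
- by rewrite mulr0 mul1r sub0r oppr_eq0 oner_eq0.
- by rewrite mulr0 mul1r subr0 oner_eq0.
- by rewrite mulr0 subrr !eqxx.
by rewrite !mulr1 subr_eq0.
Qed.

Lemma bracketC p q : bracket q p = - bracket p q.
Proof. by rewrite /bracket; ring. Qed.

Lemma bracket_mobius A : \det A != 0 -> exists l : CP1 -> C,
  (forall p, l p != 0) /\
  forall p q, bracket (mobius A p) (mobius A q) = l p * l q * (\det A * bracket p q).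
Proof.
move=> hA; have H p : exists k, k != 0 /\ hom (mobius A p) =
    (k * (A 0 0 * (hom p).1 + A 0 1 * (hom p).2),
     k * (A 1 0 * (hom p).1 + A 1 1 * (hom p).2)).
  by have [k h1 h2] := hom_mobius p hA; exists k.
have [l hl] := choice H; exists l; split=> [p|p q]; first by case: (hl p).
rewrite {1}/bracket; case: (hl p) => _ ->; case: (hl q) => _ -> /=.
by rewrite det2 /bracket; ring.
Qed.

Lemma edge_param_mobius A p q r s : \det A != 0 ->
  edge_param (mobius A p) (mobius A q) (mobius A r) (mobius A s) = edge_param p q r s.
Proof.
move=> hA; have [l [hl H]] := bracket_mobius hA.
rewrite /edge_param !H.
pose k := l p * l q * l r * l s * \det A ^+ 2.
have hk : k != 0 by rewrite !mulf_neq0 ?hl // expf_neq0.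
rewrite (_ : _ * _ * (\det A * bracket s p) * _ = k * (bracket s p * bracket r q)); last by rewrite /k; ring.
rewrite (_ : _ * _ * (\det A * bracket s q) * _ = k * (bracket s q * bracket r p)); last by rewrite /k; ring.
by rewrite invfM mulrACA divff // mul1r.
Qed.

Definition distinct3 p q r := [/\ bracket p q != 0, bracket q r != 0 & bracket p r != 0].

(** The Moebius map 0, oo, 1 |-> p, q, r, which inverts the normalisation in the
    definition of the edge parameter. *)
Definition basemx p q r : 'M[C]_2 :=
  mx2 ((hom q).1 * bracket p r) ((hom p).1 * bracket r q)
      ((hom q).2 * bracket p r) ((hom p).2 * bracket r q).

Lemma det_basemx p q r : distinct3 p q r -> \det (basemx p q r) != 0.
Proof.
case=> h1 h2 h3; rewrite det_mx2.
rewrite (_ : _ - _ = bracket p r * (bracket q r * bracket p q)) ?mulf_neq0 //.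
by rewrite (bracketC q r) /bracket; ring.
Qed.

Lemma basemx0 p q r : distinct3 p q r -> mobius (basemx p q r) (Some 0) = p.
Proof.
case=> h1 h2 h3; rewrite /mobius !mx2E /= !mulr0 !mulr1 !add0r.
rewrite -[RHS]of_hom_hom -[RHS](of_homZ _ (hom p).2 (k := bracket r q)) ?(bracketC q r) ?oppr_eq0 //.
by congr of_hom; ring.
Qed.

Lemma basemx_oo p q r : distinct3 p q r -> mobius (basemx p q r) None = q.
Proof.
case=> h1 h2 h3; rewrite /mobius !mx2E /= !mulr0 !mulr1 !addr0.
rewrite -[RHS]of_hom_hom -[RHS](of_homZ _ (hom q).2 (k := bracket p r)) //.
by congr of_hom; ring.
Qed.

Lemma basemx1 p q r : distinct3 p q r -> mobius (basemx p q r) (Some 1) = r.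
Proof.
case=> h1 h2 h3; rewrite /mobius !mx2E /= !mulr1.
rewrite -[RHS]of_hom_hom -[RHS](of_homZ _ (hom r).2 (k := bracket p q)) //.
by congr of_hom; rewrite /bracket; ring.
Qed.

Lemma basemx_param p q r s t : distinct3 p q r -> bracket s q != 0 ->
  edge_param p q r s = t -> mobius (basemx p q r) (Some t) = s.
Proof.
case=> h1 h2 h3 h4; rewrite /edge_param => <-.
have h3' : bracket r p != 0 by rewrite bracketC oppr_eq0.
rewrite (_ : Some _ = of_hom (bracket s p * bracket r q) (bracket s q * bracket r p)); last first.
  by rewrite /of_hom (negbTE (mulf_neq0 h4 h3')).
rewrite mobius_of_hom; last by rewrite orbC mulf_neq0.
rewrite -[RHS]of_hom_hom -[RHS](of_homZ _ (hom s).2 (k := bracket p r * (bracket q r * bracket p q))); last first.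
  by rewrite !mulf_neq0.
by rewrite !mx2E; congr of_hom; rewrite /bracket; ring.
Qed.

End ProjectiveLine.

(** * Shapes of ideal tetrahedra *)

Section Shapes.
Variable R : realType.
Local Notation C := (R[i]).
Local Notation CP1 := (CP1 R).
Implicit Types (M : 'M[C]_2) (a b c d : CP1) (t : C).

Definition shape4 t a b c d :=
  [/\ edge_param b c d a = t /\ edge_param d a b c = t,
      edge_param a b d c = zeta t /\ edge_param c d b a = zeta t &
      edge_param a c b d = zeta (zeta t) /\ edge_param b d a c = zeta (zeta t)].

Lemma shapedE alpha Q (z : C) T f : shaped alpha Q z T f =
  shape4 (calZ Q z (funnel alpha T.1)) (f (cA T)) (f (cB alpha T))
    (f (cC alpha T)) (f (cD alpha T)).
Proof. by []. Qed.

Definition distinct4 a b c d :=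
  [/\ bracket a b != 0, bracket a c != 0 & bracket a d != 0] /\
  [/\ bracket b c != 0, bracket b d != 0 & bracket c d != 0].

Lemma edge_param_neq0 a b c d : edge_param a b c d != 0 ->
  [/\ bracket d a != 0, bracket c b != 0, bracket d b != 0 & bracket c a != 0].
Proof.
by rewrite /edge_param mulf_eq0 invr_eq0 !mulf_eq0 !negb_or
  => /andP[/andP[-> ->] /andP[-> ->]].
Qed.

Lemma shape4_distinct t a b c d : t != 0 -> t != 1 ->
  shape4 t a b c d -> distinct4 a b c d.
Proof.
move=> h0 h1 [[e1 _] [e2 _] _].
have hz : zeta t != 0 by rewrite /zeta mul1r invr_eq0 subr_eq0 eq_sym.
rewrite -e1 in h0; rewrite -e2 in hz.
have [k1 k2 k3 k4] := edge_param_neq0 h0.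
have [l1 l2 l3 l4] := edge_param_neq0 hz.
have sw p q : bracket p q != 0 -> bracket q p != 0.
  by move=> h; rewrite bracketC oppr_eq0.
by split; split=> //; apply: sw.
Qed.

Lemma plucker a b c d :
  bracket a b * bracket c d - bracket a c * bracket b d + bracket a d * bracket b c = 0.
Proof. by rewrite /bracket; ring. Qed.

(** One edge parameter determines the others by the Pluecker relation, which computes
    1 - t. *)
Lemma shape4_intro t a b c d : distinct4 a b c d ->
  edge_param b c d a = t -> shape4 t a b c d.
Proof.
case=> [[ab ac ad] [bc bd cd]] <-.
have P := plucker a b c d.
have e0 : edge_param b c d a = bracket a b * bracket c d / (bracket a c * bracket b d).
  rewrite /edge_param (bracketC c d) (bracketC b d); field; by rewrite ?ac ?bd ?oppr_eq0.
have e1 : 1 - edge_param b c d a = bracket a d * bracket b c / (bracket a c * bracket b d).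
  rewrite e0; have -> : bracket a d * bracket b c =
    bracket a c * bracket b d - bracket a b * bracket c d.
    by apply/eqP; rewrite -subr_eq0 -P; apply/eqP; ring.
  by field; rewrite ac bd.
have z1 : zeta (edge_param b c d a) =
    bracket a c * bracket b d / (bracket a d * bracket b c).
  by rewrite /zeta e1 mul1r invfM invrK mulrC.
have z2 : zeta (zeta (edge_param b c d a)) =
    - (bracket a d * bracket b c) / (bracket a b * bracket c d).
  rewrite {1}/zeta z1.
  have -> : 1 - bracket a c * bracket b d / (bracket a d * bracket b c) =
     - (bracket a b * bracket c d) / (bracket a d * bracket b c).
    have -> : bracket a b * bracket c d =
      bracket a c * bracket b d - bracket a d * bracket b c.
      by apply/eqP; rewrite -subr_eq0 -P; apply/eqP; ring.
    by field; rewrite ad bc.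
  by field; rewrite ad bc ab cd.
split; split=> //; rewrite ?z2 ?z1 ?e0 /edge_param
  ?(bracketC a b) ?(bracketC a c) ?(bracketC a d) ?(bracketC b c) ?(bracketC b d)
  ?(bracketC c d); field; by rewrite ?ab ?ac ?ad ?bc ?bd ?cd.
Qed.

Lemma shape4_mobius t M a b c d : \det M != 0 -> shape4 t a b c d ->
  shape4 t (mobius M a) (mobius M b) (mobius M c) (mobius M d).
Proof. by move=> hM; rewrite /shape4 !edge_param_mobius. Qed.

(** A vertex of an ideal tetrahedron is determined by the three others and one
    edge parameter. *)
Lemma shape4_equiv t a b c d a' b' c' d' : t != 0 -> t != 1 ->
  shape4 t a b c d -> shape4 t a' b' c' d' ->
  exists2 M, \det M != 0 &
    [/\ a' = mobius M a, b' = mobius M b, c' = mobius M c & d' = mobius M d].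
Proof.
move=> h0 h1 s s'.
have [[ab ac ad] [bc bd cd]] := shape4_distinct h0 h1 s.
have [[ab' ac' ad'] [bc' bd' cd']] := shape4_distinct h0 h1 s'.
have D : distinct3 b c d by [].
have D' : distinct3 b' c' d' by [].
case: s => [[e _] _ _]; case: s' => [[e' _] _ _].
have hi := det_inv2 (det_basemx D).
exists (basemx b' c' d' *m invmx (basemx b c d)).
  by apply: det_mul2; rewrite ?det_basemx.
have K p q : mobius (basemx b c d) q = p ->
  mobius (basemx b' c' d' *m invmx (basemx b c d)) p = mobius (basemx b' c' d') q.
  by move=> <-; rewrite mobiusM // mobiusK // det_basemx.
split.
- by rewrite (K _ _ (basemx_param D ac e)) (basemx_param D' ac' e').
- by rewrite (K _ _ (basemx0 D)) basemx0.
- by rewrite (K _ _ (basemx_oo D)) basemx_oo.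
- by rewrite (K _ _ (basemx1 D)) basemx1.
Qed.

End Shapes.

(** * The group Gamma and its normaliser *)

Lemma odd_abszD (a b : int) : odd `|(a + b)%R|%N = odd `|a|%N (+) odd `|b|%N.
Proof. lia. Qed.

Lemma odd_abszB (a b : int) : odd `|(a - b)%R|%N = odd `|a|%N (+) odd `|b|%N.
Proof. lia. Qed.

Section GammaGroup.
Variable R : realType.
Local Notation C := (R[i]).
Variable z : C.
Hypothesis z0 : z != 0.
Implicit Types (A B M : 'M[C]_2) (u w : lattice).

Local Notation parT := (mx2 1 (-1) 0 1 : 'M[C]_2).
Local Notation parU := (mx2 1 0 (- z^-1) 1 : 'M[C]_2).
Local Notation gens := (fun A => A = parT \/ A = parU).

Lemma SL_generated_det A : SL_generated gens A -> \det A = 1.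
Proof.
elim=> {A} [A [->|->]||A B _ hA _ hB|A _ hA]; rewrite ?det_mx2 ?det1 ?det_mulmx ?det_inv.
- by ring.
- by ring.
- by [].
- by rewrite hA hB mulr1.
by rewrite hA invr1.
Qed.

Lemma SL_generated_N A : SL_generated gens (- A) -> \det A = 1.
Proof. by move/SL_generated_det; rewrite -scaleN1r detZ2 sqrrN expr1n mul1r. Qed.

Lemma Gamma_det A : Gamma z A -> \det A = 1.
Proof. by case=> [/SL_generated_det|/SL_generated_N]. Qed.

Lemma Gamma_N A : Gamma z A -> Gamma z (- A).
Proof. by case=> h; [right; rewrite opprK | left]. Qed.

Lemma Gamma_mul A B : Gamma z A -> Gamma z B -> Gamma z (A *m B).
Proof.
case=> hA [] hB; have h := SLgen_mul hA hB.
- by left.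
- by right; rewrite -mulmxN.
- by right; rewrite -mulNmx.
- by left; rewrite mulNmx mulmxN opprK in h.
Qed.

Lemma Gamma_inv A : Gamma z A -> Gamma z (invmx A).
Proof.
case=> h; have h' := SLgen_inv h; [by left | right].
have uA : -1 *: A \in unitmx by rewrite scaleN1r unit2 // (SL_generated_det h) oner_neq0.
by move: h'; rewrite -(scaleN1r A) invmxZ // invrN1 scaleN1r.
Qed.

(** Membership in Gamma up to a scalar, so that determinants need not be
    normalised. *)
Definition PGamma A := exists2 c : C, c != 0 & Gamma z (c *: A).

Lemma PGamma_det A : PGamma A -> \det A != 0.
Proof.
case=> c hc /Gamma_det; rewrite detZ2 => h; apply: contra_eq_neq h => ->.
by rewrite mulr0 eq_sym oner_neq0.
Qed.

Lemma PGamma_scale c A : c != 0 -> PGamma (c *: A) <-> PGamma A.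
Proof.
move=> hc; split=> -[d hd h].
  by exists (d * c); rewrite ?mulf_neq0 // -scalerA.
by exists (d / c); rewrite ?mulf_neq0 ?invr_eq0 // scalerA mulfVK.
Qed.

Lemma PGamma_of_Gamma A : Gamma z A -> PGamma A.
Proof. by move=> h; exists 1; rewrite ?oner_neq0 // scale1r. Qed.

Lemma Gamma_of_PGamma A : PGamma A -> \det A = 1 -> Gamma z A.
Proof.
case=> c hc h hA; have := Gamma_det h; rewrite detZ2 hA mulr1 => /eqP.
rewrite sqrf_eq1 => /orP[] /eqP ec; move: h; rewrite ec ?scale1r // scaleN1r.
by move/Gamma_N; rewrite opprK.
Qed.

Lemma PGamma_1 : PGamma 1%:M.
Proof. by apply: PGamma_of_Gamma; left; apply: SLgen_1. Qed.

Lemma PGamma_mul A B : PGamma A -> PGamma B -> PGamma (A *m B).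
Proof.
case=> c hc hA [d hd hB]; exists (c * d); first exact: mulf_neq0.
by rewrite -scalerA scalemxAr scalemxAl; apply: Gamma_mul.
Qed.

Lemma PGamma_inv A : PGamma A -> PGamma (invmx A).
Proof.
move=> h; have hA := PGamma_det h; case: h => c hc /Gamma_inv.
rewrite invmxZ ?unitmxZ ?unitfE ?unit2 // => h.
by exists c^-1; rewrite ?invr_eq0.
Qed.

Lemma PGamma_T : PGamma parT.
Proof. by apply: PGamma_of_Gamma; left; apply: SLgen_in; left. Qed.

Lemma PGamma_U : PGamma parU.
Proof. by apply: PGamma_of_Gamma; left; apply: SLgen_in; right. Qed.

Lemma invmx_left (A B : 'M[C]_2) : A *m B = 1%:M -> invmx B = A.
Proof. by move=> h; rewrite -[RHS](mulmxK (mulmx1_unit h).2) h mul1mx. Qed.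

Lemma inv_parT : invmx parT = mx2 1 1 0 1.
Proof. by apply: invmx_left; rewrite scalar_mx2 mul_mx2; congr mx2; ring. Qed.

Lemma inv_parU : invmx parU = mx2 1 0 z^-1 1.
Proof. by apply: invmx_left; rewrite scalar_mx2 mul_mx2; congr mx2; ring. Qed.

Lemma PGamma_T' : PGamma (mx2 1 1 0 1).
Proof. by rewrite -inv_parT; apply: PGamma_inv PGamma_T. Qed.

Lemma PGamma_U' : PGamma (mx2 1 0 z^-1 1).
Proof. by rewrite -inv_parU; apply: PGamma_inv PGamma_U. Qed.

Lemma PGamma_transl (k : int) : PGamma (transl k%:~R).
Proof.
have P (m : nat) : PGamma (transl m%:R).
  elim: m => [|m IH].
    by have := PGamma_1; rewrite scalar_mx2.
  by rewrite -addn1 natrD -transl_mul; apply: PGamma_mul IH PGamma_T'.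
case: k => m; first by rewrite -pmulrn.
have <- : invmx (transl m.+1%:R) = transl (Negz m)%:~R :> 'M[C]_2.
  by apply: invmx_left; rewrite transl_mul NegzE mulrNz -pmulrn addNr scalar_mx2.
exact/PGamma_inv/P.
Qed.

Definition normalizes M := \det M != 0 /\
  forall A, PGamma A -> exists2 A', PGamma A' & M *m A = A' *m M.

(** It suffices to conjugate the two generators, provided that the conjugates
    are again in Gamma; the relation passes to inverses and products. *)
Lemma normalizes_gen M X Y : \det M != 0 -> PGamma X -> PGamma Y ->
  M *m parT = X *m M -> M *m parU = Y *m M -> normalizes M.
Proof.
move=> hM hX hY eT eU; split=> //.
have S A : SL_generated gens A -> exists2 A', PGamma A' & M *m A = A' *m M.
  elim=> {A} [A [->|->]||A B _ [A' pA eA] _ [B' pB eB]|A gA [A' pA eA]].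
  - by exists X.
  - by exists Y.
  - by exists 1%:M; [apply: PGamma_1 | rewrite mul1mx mulmx1].
  - exists (A' *m B'); first exact: PGamma_mul.
    by rewrite mulmxA eA -mulmxA eB mulmxA.
  exists (invmx A'); first exact: PGamma_inv.
  have uA : A \in unitmx by rewrite unit2 // (SL_generated_det gA) oner_neq0.
  have uA' := unit2 (PGamma_det pA).
  by rewrite -[RHS](mulmxK uA) -[_ *m M *m A]mulmxA eA mulKmx.
have G A : Gamma z A -> exists2 A', PGamma A' & M *m A = A' *m M.
  case=> [/S // | /S[A' pA eA]]; exists (- A').
    by rewrite -scaleN1r; apply/PGamma_scale; rewrite ?oppr_eq0 ?oner_eq0.
  by rewrite mulNmx -eA mulmxN opprK.
move=> A [c hc /G[A' pA eA]]; exists (c^-1 *: A').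
  by apply/PGamma_scale; rewrite ?invr_eq0.
by rewrite -scalemxAl -eA -scalemxAr scalerA mulVf // scale1r.
Qed.

Lemma normalizes_mul M M' : normalizes M -> normalizes M' -> normalizes (M *m M').
Proof.
move=> [hM nM] [hM' nM']; split; first exact: det_mul2.
move=> A /nM'[A1 p1 e1]; have [A2 p2 e2] := nM _ p1; exists A2 => //.
by rewrite -mulmxA e1 mulmxA e2 mulmxA.
Qed.

Definition klein01 : 'M[C]_2 := mx2 (-1) 2%:R 0 1.
Definition klein10 : 'M[C]_2 := mx2 1 (- 1 - z) 1 (-1).
Definition klein11 : 'M[C]_2 := mx2 1 (z - 1) 1 (-1).

(** The translation of the lattice by u induces a symmetry of the quotient
    complex, which depends only on the parities of u. On the sphere it becomes
    an involution of PSL_2, determined up to Gamma; for (0, 1) it is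
    w |-> 2 - w and for (1, 0) it exchanges the ends 1 and infinity of an edge
    of slope 0. *)
Definition parity_mx (u : lattice) : 'M[C]_2 :=
  if odd `|u.1|%N then (if odd `|u.2|%N then klein11 else klein10)
  else (if odd `|u.2|%N then klein01 else 1%:M).

Lemma parity_mx_eq u w : odd `|u.1|%N = odd `|w.1|%N -> odd `|u.2|%N = odd `|w.2|%N ->
  parity_mx u = parity_mx w.
Proof. by rewrite /parity_mx => -> ->. Qed.

Lemma det_klein10 : \det klein10 = z. Proof. by rewrite det_mx2; ring. Qed.
Lemma det_klein11 : \det klein11 = - z. Proof. by rewrite det_mx2; ring. Qed.
Lemma det_klein01 : \det klein01 = -1. Proof. by rewrite det_mx2; ring. Qed.

Lemma det_parity_mx u : \det (parity_mx u) != 0.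
Proof.
by rewrite /parity_mx; do 2!case: ifP => _;
  rewrite ?det_klein10 ?det_klein11 ?det_klein01 ?det1 ?oppr_eq0 ?oner_eq0.
Qed.

Lemma parity_mx_mul u w : exists2 c, c != 0 &
  parity_mx u *m parity_mx w = c *: parity_mx (u + w).
Proof.
have n1 : - 1 != 0 :> C by rewrite oppr_eq0 oner_eq0.
have nz : - z != 0 by rewrite oppr_eq0.
have o1 := oner_neq0 C.
have e1 : odd `|((u + w).1)%R|%N = odd `|u.1|%N (+) odd `|w.1|%N by exact: odd_abszD.
have e2 : odd `|((u + w).2)%R|%N = odd `|u.2|%N (+) odd `|w.2|%N by exact: odd_abszD.
rewrite /parity_mx e1 e2 /klein10 /klein11 /klein01 scalar_mx2.
have H (c : C) A B : c != 0 -> A = c *: B -> exists2 c, c != 0 & A = c *: B by exists c.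
case: (odd `|u.1|%N); case: (odd `|u.2|%N); case: (odd `|w.1|%N); case: (odd `|w.2|%N) => /=;
  rewrite mul_mx2.
all: [> apply: (H z) | apply: (H (- z)) | apply: (H (-1)) | apply: (H 1)
      | apply: (H z) | apply: (H (- z)) | apply: (H (-1)) | apply: (H 1)
      | apply: (H 1) ..]; rewrite // scale_mx2; congr mx2; ring.
Qed.

Lemma normalizes_1 : normalizes 1%:M.
Proof.
by split; rewrite ?det1 ?oner_neq0 // => A h; exists A; rewrite ?mul1mx ?mulmx1.
Qed.

Lemma normalizes_klein01 : normalizes klein01.
Proof.
apply: (@normalizes_gen _ (mx2 1 1 0 1)
  (mx2 1 1 0 1 *m (mx2 1 1 0 1 *m (mx2 1 0 z^-1 1 *m (parT *m parT))))).
- by rewrite det_klein01 oppr_eq0 oner_eq0.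
- exact: PGamma_T'.
- by do 2!apply: (PGamma_mul PGamma_T'); apply: (PGamma_mul PGamma_U'); apply: (PGamma_mul PGamma_T PGamma_T).
- by rewrite /klein01 !mul_mx2; congr mx2; ring.
by rewrite /klein01 !mul_mx2; congr mx2; field.
Qed.

Lemma normalizes_klein10 : normalizes klein10.
Proof.
apply: (@normalizes_gen _ (mx2 1 1 0 1 *m (mx2 1 0 z^-1 1 *m parT))
  (mx2 1 1 0 1 *m (mx2 1 0 z^-1 1 *m (mx2 1 1 0 1 *m (parU *m parT))))).
- by rewrite det_klein10.
- by apply: (PGamma_mul PGamma_T'); apply: (PGamma_mul PGamma_U' PGamma_T).
- by apply: (PGamma_mul PGamma_T'); apply: (PGamma_mul PGamma_U'); apply: (PGamma_mul PGamma_T'); apply: (PGamma_mul PGamma_U PGamma_T).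
- by rewrite /klein10 !mul_mx2; congr mx2; field.
by rewrite /klein10 !mul_mx2; congr mx2; field.
Qed.

Lemma normalizes_parity u : normalizes (parity_mx u).
Proof.
have h1 : klein01 *m klein10 = klein11 by rewrite mul_mx2; congr mx2; ring.
rewrite /parity_mx; case: ifP => _; case: ifP => _.
- rewrite -h1; exact: normalizes_mul normalizes_klein01 normalizes_klein10.
- exact: normalizes_klein10.
- exact: normalizes_klein01.
exact: normalizes_1.
Qed.

End GammaGroup.

(** * Farey arithmetic along the funnel *)

Definition farey_edge (e : edge) : Prop :=
  [/\ (e.2.1 * e.1.2 = (e.1.1 * e.2.2).+1)%N, (0 < e.1.2)%N, (0 < e.2.2)%N,
      (e.1.1 <= e.1.2)%N & (e.2.1 <= e.2.2)%N].

Lemma coprime_bezout (a b c d : nat) : (a * b = (c * d).+1)%N ->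
  coprime a d /\ coprime c b.
Proof.
move=> h.
have H g : (g %| a * b)%N -> (g %| c * d)%N -> (g %| 1)%N.
  by move=> h1 h2; rewrite -(dvdn_addr _ h2) addn1 -h.
split; rewrite /coprime -dvdn1; apply: H;
  by rewrite ?(dvdn_mulr _ (dvdn_gcdl _ _)) ?(dvdn_mull _ (dvdn_gcdr _ _)).
Qed.

Lemma farey_edge_inQ0 e : farey_edge e -> inQ0 e.1 /\ inQ0 e.2.
Proof.
case=> h h1 h2 h3 h4; have [c1 c2] := coprime_bezout h.
by rewrite /inQ0 h1 h2 h3 h4 c1 c2.
Qed.

Lemma farey_edgeL L R : farey_edge (L, R) -> farey_edge (L, oplus L R).
Proof. case: L R => [a b] [c d]; rewrite /farey_edge /oplus /= => -[]; split; lia. Qed.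

Lemma farey_edgeR L R : farey_edge (L, R) -> farey_edge (oplus L R, R).
Proof. case: L R => [a b] [c d]; rewrite /farey_edge /oplus /= => -[]; split; lia. Qed.

Lemma farey_edge_pair L R : farey_edge (L, R) -> farey_pair L R && farey_pair R L.
Proof. by case=> /= h _ _ _ _; rewrite /farey_pair h eqxx orbT. Qed.

Lemma funnelS alpha j : funnel alpha j.+1 = funnel_next alpha (funnel alpha j).
Proof. by []. Qed.

Lemma funnel_cases alpha j : let e := funnel alpha j in
  funnel alpha j.+1 = (e.1, apex e) \/ funnel alpha j.+1 = (apex e, e.2).
Proof. by rewrite funnelS /funnel_next; case: ifP => _; [left | right]. Qed.

Lemma farey_edge_funnel alpha j : farey_edge (funnel alpha j).
Proof.
elim: j => [|j IH]; first by [].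
case: (funnel alpha j) (funnel_cases alpha j) IH => L R /= [] -> IH.
  exact: farey_edgeL.
exact: farey_edgeR.
Qed.

(** The third vertex of the Farey triangle above e_j, j > 0, is ehat; sums are
    used because ehat subtracts natural numbers. *)
Definition hat_position (e : edge) : Prop :=
  (e.1.2 < e.2.2)%N /\ e.2 = oplus e.1 (ehat e) \/
  (e.2.2 < e.1.2)%N /\ e.1 = oplus (ehat e) e.2.

Lemma ehat_left l1 l2 s1 s2 : (0 < s2)%N ->
  ehat ((l1, l2), oplus (l1, l2) (s1, s2)) = (s1, s2).
Proof.
move=> s0; rewrite /ehat /eplus /eminus /oplus /=.
by rewrite (_ : (l2 < l2 + s2)%N) /= ?addKn //; lia.
Qed.

Lemma ehat_right l1 l2 s1 s2 : ehat (oplus (l1, l2) (s1, s2), (s1, s2)) = (l1, l2).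
Proof.
rewrite /ehat /eplus /eminus /oplus /=.
by rewrite (_ : (l2 + s2 < s2)%N = false) /= ?addnK //; lia.
Qed.

Lemma hat_position_funnel alpha j : hat_position (funnel alpha j.+1).
Proof.
move: (funnel_cases alpha j) (farey_edge_funnel alpha j).
case: (funnel alpha j) => [[l1 l2] [s1 s2]] /=; rewrite /apex /=.
case=> -> [_ /= l0 s0 _ _].
  by left; rewrite ehat_left //; split=> //=; lia.
by right; rewrite ehat_right; split=> //=; lia.
Qed.

Lemma hat_position_neq e : hat_position e -> (e.1.2 != e.2.2)%N.
Proof. by case=> [] [lt _]; rewrite ?(ltn_eqF lt) // eq_sym (ltn_eqF lt). Qed.

Lemma funnel1 alpha : alpha < 1 / 2%:R -> funnel alpha 1 = (fr0, fr12).
Proof. by move=> h; rewrite /funnel /= /funnel_next /fval /= h. Qed.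

Section Evaluation.
Variable R : realType.
Local Notation C := (R[i]).
Variables (Q N : fareyfrac -> {poly int}) (z : C).
Hypotheses (hQ : is_calQ Q) (hN : is_calN Q N).

Lemma evalzD p p' : evalz z (p + p') = evalz z p + evalz z p'.
Proof. by rewrite /evalz rmorphD hornerD. Qed.
Lemma evalzM p p' : evalz z (p * p') = evalz z p * evalz z p'.
Proof. by rewrite /evalz rmorphM hornerM. Qed.
Lemma evalzN p : evalz z (- p) = - evalz z p.
Proof. by rewrite /evalz rmorphN hornerN. Qed.
Lemma evalz1 : evalz z 1 = 1.
Proof. by rewrite /evalz rmorph1 hornerE. Qed.
Lemma evalz0 : evalz z 0 = 0.
Proof. by rewrite /evalz rmorph0 hornerE. Qed.

Lemma evalz_dQ s : evalz z (dQ s) = (-1) ^+ s.1 * z ^+ s.2.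
Proof.
rewrite /dQ evalzM; congr (_ * _).
  by rewrite /evalz rmorphXn rmorphN rmorph1 horner_exp hornerN hornerC.
by rewrite /evalz map_polyXn hornerXn.
Qed.

Local Notation q s := (evalz z (Q s)).
Local Notation nn s := (evalz z (N s)).
Local Notation d s := (evalz z (dQ s)).

Lemma d_oplus s t : d (oplus s t) = d s * d t.
Proof. by rewrite !evalz_dQ /oplus /= !exprD; ring. Qed.

Lemma d_neq0 s : z != 0 -> d s != 0.
Proof. by move=> hz; rewrite evalz_dQ mulf_neq0 ?expf_neq0 // oppr_eq0 oner_eq0. Qed.

Lemma eval_rec F b g : farey_recursive Q F -> inQ0hat b -> inQ0hat g ->
    farey_pair b g -> inQ0 (oplus (oplus g b) b) ->
  evalz z (F (oplus (oplus g b) b)) =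
    - d b * evalz z (F g) + q b * evalz z (F (oplus g b)).
Proof.
move=> hF hb hg hbg hgb; rewrite (hF b g hb hg hbg hgb : F (oplus (oplus g b) b) = _).
by rewrite evalzD (evalzM (- dQ b)) evalzN (evalzM (Q b)).
Qed.

Definition wronsk s t : C := nn t * q s - nn s * q t.

(** For a Farey triangle L, S, L + S the first two equations give the
    differences of V along two sides, and the last one says that V(S) and
    V(L) - 1 differ by Q(L + S)/(Q(L) Q(S)). The recursion carries the three
    equations to the two triangles below ([farey_relationsL],
    [farey_relationsR]). *)
Definition farey_relations L S :=
  [/\ wronsk L (oplus L S) = - d L * q S,
      wronsk (oplus L S) S = - d S * q L &
      q (oplus L S) = q L * q S + wronsk L S].

Lemma oplusC s t : oplus s t = oplus t s.
Proof. by rewrite /oplus addnC [(s.2 + _)%N]addnC. Qed.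

Lemma farey_relationsL L S : farey_edge (L, S) -> farey_relations L S ->
  farey_relations L (oplus L S).
Proof.
move=> hLR [h1 h2 h3].
have [iL iR] := farey_edge_inQ0 hLR.
have [/= _ ia] := farey_edge_inQ0 (farey_edgeL (farey_edgeL hLR)).
have /andP[pLR pRL] := farey_edge_pair hLR.
have [_ _ _ rQ] := hQ; have [_ _ _ rN] := hN.
have E F : farey_recursive Q F -> evalz z (F (oplus L (oplus L S))) =
    - d L * evalz z (F S) + q L * evalz z (F (oplus L S)).
  move=> hF; rewrite [oplus L (oplus L S)]oplusC [oplus L S]oplusC.
  apply: eval_rec; rewrite // /inQ0hat ?iL ?iR //.
  by rewrite [oplus S L]oplusC oplusC.
rewrite /farey_relations; move: h1 h2 h3; rewrite /wronsk !(E Q) // !(E N) // !d_oplus.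
set qa := evalz z (Q (oplus L S)); set na := evalz z (N (oplus L S)).
move=> h1 h2 h3; split.
- transitivity (- d L * (nn S * q L - nn L * q S) + q L * (na * q L - nn L * qa)).
    by ring.
  by rewrite h1 h3; ring.
- transitivity (d L * (nn S * qa - na * q S)); first by ring.
  by rewrite h2; ring.
- by rewrite h1; ring.
Qed.

Lemma farey_relationsR L S : farey_edge (L, S) -> farey_relations L S ->
  farey_relations (oplus L S) S.
Proof.
move=> hLR [h1 h2 h3].
have [iL iR] := farey_edge_inQ0 hLR.
have [/= ia _] := farey_edge_inQ0 (farey_edgeR (farey_edgeR hLR)).
have /andP[pLR pRL] := farey_edge_pair hLR.
have [_ _ _ rQ] := hQ; have [_ _ _ rN] := hN.
have E F : farey_recursive Q F -> evalz z (F (oplus (oplus L S) S)) =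
    - d S * evalz z (F L) + q S * evalz z (F (oplus L S)).
  by move=> hF; apply: eval_rec; rewrite // /inQ0hat ?iL ?iR.
rewrite /farey_relations; move: h1 h2 h3; rewrite /wronsk !(E Q) // !(E N) // !d_oplus.
set qa := evalz z (Q (oplus L S)); set na := evalz z (N (oplus L S)).
move=> h1 h2 h3; split.
- transitivity (- d S * (nn L * qa - na * q L)); first by ring.
  have -> : nn L * qa - na * q L = - (na * q L - nn L * qa) by ring.
  by rewrite h1; ring.
- transitivity (q S * (nn S * qa - na * q S) - d S * (nn S * q L - nn L * q S)).
    by ring.
  by rewrite h2 h3; ring.
- by rewrite h2; ring.
Qed.

Lemma q_fr0 : q fr0 = 1. Proof. by case: hQ => -> *; rewrite evalz1. Qed.
Lemma q_fr1 : q fr1 = 1. Proof. by case: hQ => _ _ -> *; rewrite evalz1. Qed.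
Lemma q_inf : q frinf = 0. Proof. by case: hQ => _ -> *; rewrite evalz0. Qed.
Lemma n_fr0 : nn fr0 = 1. Proof. by case: hN => -> *; rewrite evalz1. Qed.
Lemma n_fr1 : nn fr1 = 1. Proof. by case: hN => _ _ -> *; rewrite evalz1. Qed.
Lemma n_inf : nn frinf = 1. Proof. by case: hN => _ -> *; rewrite evalz1. Qed.

Lemma d_fr0 : d fr0 = z. Proof. by rewrite evalz_dQ expr0 mul1r expr1. Qed.
Lemma d_fr1 : d fr1 = - z. Proof. by rewrite evalz_dQ !expr1 mulN1r. Qed.

(** The mediant of 0 and 1 is also obtained from infinity by adding 0 twice,
    which makes the recursion apply. *)
Lemma q_fr12 : q fr12 = 1.
Proof.
have [_ _ _ rQ] := hQ.
have := @eval_rec Q fr0 frinf rQ isT isT isT isT.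
by rewrite /= -[oplus frinf fr0]/fr1 q_fr1 q_inf q_fr0 mulr0 add0r mulr1.
Qed.

Lemma n_fr12 : nn fr12 = 1 - z.
Proof.
have [_ _ _ rN] := hN.
have := @eval_rec N fr0 frinf rN isT isT isT isT.
rewrite /= -[oplus frinf fr0]/fr1 n_fr1 n_inf q_fr0 d_fr0 => ->; ring.
Qed.

Lemma farey_relations_funnel alpha j :
  farey_relations (funnel alpha j).1 (funnel alpha j).2.
Proof.
elim: j => [|j IH].
  rewrite /farey_relations /wronsk -[funnel alpha 0]/(fr0, fr1) /fst /snd -[oplus fr0 fr1]/fr12.
  by rewrite q_fr0 q_fr1 q_fr12 n_fr0 n_fr1 n_fr12 d_fr0 d_fr1; split; ring.
have := farey_edge_funnel alpha j.
case: (funnel alpha j) (funnel_cases alpha j) IH => L S /= [] -> IH hLS.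
  exact: farey_relationsL.
exact: farey_relationsR.
Qed.

(** The sum of the two differences of V along the sides L, L + S and L + S, S is
    the difference along L, S. *)
Lemma farey_markoff L S : farey_relations L S ->
  q (oplus L S) * wronsk L S = - (d L * q S ^+ 2) - d S * q L ^+ 2.
Proof.
case=> h1 h2 _; transitivity (q S * wronsk L (oplus L S) + q L * wronsk (oplus L S) S).
  by rewrite /wronsk; ring.
by rewrite h1 h2; ring.
Qed.

(** The relations of the triangle below e together with those of the triangle
    above e. The two cases tell which endpoint of e is the mediant of the other
    one and ehat e. *)
Definition farey_local (e : edge) : Prop :=
  let L := e.1 in let S := e.2 in let h := ehat e in
  [/\ farey_edge e, farey_relations L S & wronsk L S = - d (eminus e) * q h] /\
  ([/\ (L.2 < S.2)%N, S = oplus L h, wronsk L h + q L * q h = q S,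
       wronsk h S = d h * q L & (0 < h.2)%N] \/
   [/\ (S.2 < L.2)%N, L = oplus h S, wronsk h L = - d h * q S,
       wronsk h S + q h * q S = q L & (0 < h.2)%N]).

Lemma farey_local_funnel alpha j : farey_local (funnel alpha j.+1).
Proof.
have fe := farey_edge_funnel alpha j.+1.
have fr := farey_relations_funnel alpha j.+1.
have fe' := farey_edge_funnel alpha j.
have fr' := farey_relations_funnel alpha j.
move: (funnel_cases alpha j) fe fr fe' fr'.
case: (funnel alpha j.+1) => L S; case: (funnel alpha j) => [[l1 l2] [s1 s2]] /=.
rewrite /apex /=.
case=> [] [-> ->] fe fr fe' [h1 h2 h3].
- have [f1 /= f2 f3 _ _] := fe'.
  have lt : (l2 < l2 + s2)%N by rewrite -addn1 leq_add2l.
  have eh : ehat ((l1, l2), oplus (l1, l2) (s1, s2)) = (s1, s2).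
    by rewrite /ehat /eplus /eminus /oplus /= lt /=; congr pair; rewrite addKn.
  rewrite /farey_local eh {1}/eminus /= lt; split; first by [].
  left; split=> //; first by rewrite h3 addrC.
  have -> : wronsk (s1, s2) (oplus (l1, l2) (s1, s2)) =
     - wronsk (oplus (l1, l2) (s1, s2)) (s1, s2) by rewrite /wronsk; ring.
  by rewrite h2; ring.
have [f1 /= f2 f3 _ _] := fe'.
have lt : (s2 < l2 + s2)%N by rewrite -add1n leq_add2r.
have lt' : (l2 + s2 < s2)%N = false by lia.
have eh : ehat (oplus (l1, l2) (s1, s2), (s1, s2)) = (l1, l2).
  by rewrite /ehat /eplus /eminus /oplus /= lt' /=; congr pair; rewrite addnK.
rewrite /farey_local eh {1}/eminus /= lt'; split; first by [].
by right; split=> //; rewrite h3 addrC.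
Qed.

Lemma farey_local_hat e : farey_local e -> hat_position e.
Proof. by case=> _ [] [? ? _ _ _]; [left | right]. Qed.

(** Both cases of the exponent -nu(e) give the same expression in the endpoints,
    because d is multiplicative for the mediant. *)
Lemma calZE e : z != 0 -> farey_local e ->
  calZ Q z e = - (d e.2 / d e.1) * (q e.1 / q e.2) ^+ 2.
Proof.
move=> hz [_ H]; rewrite /calZ; congr (- _ * _).
rewrite /enu /eminus; case: H => [] [lt e2 _ _ _].
  rewrite lt eqxx /= opprK expr1z [in RHS]e2 d_oplus.
  by rewrite mulrC mulKf // d_neq0.
rewrite ltnNge (ltnW lt) /=.
have -> : (e.2 == e.1) = false by apply: contraTF lt => /eqP ->; rewrite ltnn.
rewrite [in RHS]e2 d_oplus invfM mulrCA divff ?d_neq0 // mulr1.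
by [].
Qed.

Definition farey_nondeg (e : edge) : Prop :=
  [/\ q e.1 != 0, q e.2 != 0, q (apex e) != 0, q (ehat e) != 0 &
      calZ Q z e != 0 /\ calZ Q z e != 1].

Lemma Im_pos_neq (w : C) : Im_pos w -> w != 0 /\ w != 1.
Proof.
by move=> h; split; apply: contraTneq h => -> /=; rewrite /Im_pos /= ltxx.
Qed.

(** Z(e) != 0 says that Q(L) and Q(S) do not vanish. By [farey_markoff],
    Z(e) != 1 says that Q(L + S) times the determinant of V along L, S does not
    vanish, and this determinant is a multiple of Q(ehat e). *)
Lemma farey_nondeg_Im e : z != 0 -> farey_local e -> Im_pos (calZ Q z e) ->
  farey_nondeg e.
Proof.
move=> hz he hI; have [t0 t1] := Im_pos_neq hI.
have E := calZE hz he.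
have [[_ fr fw] _] := he.
have [hL hR] : q e.1 != 0 /\ q e.2 != 0.
  move: t0; rewrite E mulf_eq0 sqrf_eq0 mulf_eq0 invr_eq0 !negb_or.
  by case/and3P.
have dL := d_neq0 e.1 hz; have dR := d_neq0 e.2 hz.
have P : q (apex e) * wronsk e.1 e.2 != 0.
  rewrite (farey_markoff fr); apply: contra t1 => /eqP P; apply/eqP.
  rewrite E.
  have -> : d e.2 = - (d e.1 * q e.2 ^+ 2) / q e.1 ^+ 2.
    apply: (mulIf (expf_neq0 2 hL)); rewrite mulfVK ?expf_neq0 //.
    by apply/eqP; rewrite -subr_eq0 -oppr_eq0 -P; apply/eqP; ring.
  by field; rewrite dL hL hR.
move: P; rewrite mulf_eq0 negb_or fw mulf_eq0 negb_or => /and3P[ha _ hh].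
by split.
Qed.

(** V(s) as a complex number, meaningful only where Q(s) != 0. *)
Definition cusp_value (s : fareyfrac) : C := nn s / q s.

Lemma cusp_value_sub s t : q s != 0 -> q t != 0 -> cusp_value t - cusp_value s = wronsk s t / (q s * q t).
Proof. by move=> hs ht; rewrite /cusp_value /wronsk; field; rewrite hs ht. Qed.

(** All differences of positions that occur in the two tetrahedra delta'(e),
    with finite vertices V(L), V(S), V(L + S), and delta(e), with finite
    vertices V(L) - 1, V(S) and V(ehat e) or V(ehat e) - 1. *)
Lemma link_formulas e : z != 0 -> farey_local e -> farey_nondeg e ->
  let L := e.1 in let S := e.2 in let h := ehat e in let a := apex e in
  let m := d (eminus e) in
  [/\ cusp_value S - cusp_value L = - (m * q h) / (q L * q S),
      cusp_value a - cusp_value L = - (d L * q S) / (q a * q L) &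
      cusp_value a - cusp_value S = d S * q L / (q a * q S)] /\
  [/\ cusp_value h - (S.2 < L.2)%N%:R - (cusp_value L - 1) = d L / m * q S / (q L * q h),
      cusp_value S - (cusp_value h - (S.2 < L.2)%N%:R) = d S / m * q L / (q h * q S) &
      cusp_value S - (cusp_value L - 1) = q a / (q L * q S)] /\
  d h * m ^+ 2 = d L * d S.
Proof.
move=> hz he hd L S h a m.
have [hL hS ha hh _] := hd; rewrite -/L -/S -/a -/h in hL hS ha hh.
have [[_ [f1 f2 f3] fw] H] := he; rewrite -/L -/S -/h -/(apex e) -/a -/m in f1 f2 f3 fw H.
have hm : m != 0 by exact: d_neq0.
have dL := d_neq0 L hz; have dS := d_neq0 S hz.
split; first split.
- by rewrite cusp_value_sub // fw; congr (_ / _); rewrite mulNr.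
- by rewrite cusp_value_sub // f1; congr (_ / _); ring.
- have -> : cusp_value a - cusp_value S = - (cusp_value S - cusp_value a) by ring.
  by rewrite cusp_value_sub // f2; field; rewrite ha hS.
split; last first.
  rewrite /m /eminus -/L -/S; case: H => [] [lt e2 _ _ _].
    by rewrite lt [in RHS]e2 d_oplus; ring.
  by rewrite ltnNge (ltnW lt) /= [in RHS]e2 d_oplus; ring.
have E3 : cusp_value S - (cusp_value L - 1) = q a / (q L * q S).
  have -> : cusp_value S - (cusp_value L - 1) = (cusp_value S - cusp_value L) + 1 by ring.
  by rewrite cusp_value_sub // f3; field; rewrite hL hS.
split=> //.
- case: H => [] [lt e2 g1 g2 _]; rewrite /m /eminus -/L -/S.
    rewrite lt ltnNge (ltnW lt) /= divff // mul1r -g1 mulr0n.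
    have -> : cusp_value h - 0 - (cusp_value L - 1) = (cusp_value h - cusp_value L) + 1 by ring.
    by rewrite cusp_value_sub //; field; rewrite hL hh.
  rewrite lt [(_ < _)%N]ltnNge (ltnW lt) /=.
  have -> : cusp_value h - 1 - (cusp_value L - 1) = - (cusp_value L - cusp_value h) by ring.
  rewrite cusp_value_sub // g1 [d L in RHS](congr1 (fun s => d s) e2) d_oplus.
  by field; rewrite hL hh dS.
- case: H => [] [lt e2 g1 g2 _]; rewrite /m /eminus -/L -/S.
    rewrite lt ltnNge (ltnW lt) /= subr0 cusp_value_sub // g2 [d S in RHS](congr1 (fun s => d s) e2) d_oplus.
    by field; rewrite hS hh dL.
  rewrite lt [(_ < _)%N]ltnNge (ltnW lt) /= divff // mul1r -g2.
  have -> : cusp_value S - (cusp_value h - 1) = (cusp_value S - cusp_value h) + 1 by ring.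
  by rewrite cusp_value_sub //; field; rewrite hS hh.
Qed.

End Evaluation.

(** * The stacked complex *)

(** The integer picked up in the link of a vertex when passing from the
    direction u to the direction w: directions in the same half plane are
    compared without a turn, and for opposite half planes the determinant is
    1 or -1, the sense of the turn, when u and w lead to corners of one
    tetrahedron. *)
Definition turn (u w : lattice) : int :=
  if (0 < u.1) == (0 < w.1) then 0 else u.1 * w.2 - u.2 * w.1.

Definition corner (e : edge) (v : lattice) (a b : bool) : lattice :=
  (v.1 + a%:Z * e.1.2%:Z + b%:Z * e.2.2%:Z, v.2 + a%:Z * e.1.1%:Z + b%:Z * e.2.1%:Z).

(** Within one tetrahedron the integers [turn] are differences of an integer
    attached to each corner seen from (a, b) ([turn_corner]). *)
Definition turn_potential (a b : bool) (u : lattice) : int :=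
  if a && ~~ b then ((u.1 < 0)%R : nat)%:Z else
  if ~~ a && b then ((0 < u.1)%R : nat)%:Z else 0.

Lemma turn_corner e v a b a1 b1 a2 b2 : farey_edge e -> (e.1.2 != e.2.2)%N ->
  (a1, b1) != (a, b) -> (a2, b2) != (a, b) ->
  turn (corner e v a1 b1 - corner e v a b) (corner e v a2 b2 - corner e v a b) =
  turn_potential a b (corner e v a2 b2 - corner e v a b) - turn_potential a b (corner e v a1 b1 - corner e v a b).
Proof.
case: e v => [[l1 l2] [s1 s2]] [v1 v2] [/= h h1 h2 h3 h4] hne.
have {}h : s1%:Z * l2%:Z = l1%:Z * s2%:Z + 1 by lia.
rewrite /turn /turn_potential /corner /=.
case: a; case: b; case: a1; case: b1 => // _; case: a2; case: b2 => // _.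
all: rewrite /= ?mul0r ?mul1r ?addr0.
all: try (case: ifP; lia).
all: repeat (case: ifP); lia.
Qed.

Lemma latticeP (x y : lattice) : x.1 = y.1 -> x.2 = y.2 -> x = y.
Proof. by case: x y => [a b] [c d] /= -> ->. Qed.

Local Ltac lattice_eq := apply: latticeP; rewrite /gmap ?mulr2n /=; clear; lia.
Local Ltac lattice_neq := apply/eqP => /(congr1 (fun u : lattice => u.1)) /=; clear; lia.

Lemma cornersE alpha T : corners alpha T =
  [:: corner (funnel alpha T.1) T.2 false false; corner (funnel alpha T.1) T.2 true false;
      corner (funnel alpha T.1) T.2 false true; corner (funnel alpha T.1) T.2 true true].
Proof.
rewrite /corners /cA /cB /cC /cD /svec.
by congr [:: _; _; _; _]; apply: latticeP => /=; rewrite ?mul0r ?mul1r ?addr0.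
Qed.

Lemma cA_corner alpha T : cA T = corner (funnel alpha T.1) T.2 false false.
Proof. by apply: latticeP; rewrite /cA /= !mul0r !addr0. Qed.
Lemma cB_corner alpha T : cB alpha T = corner (funnel alpha T.1) T.2 true false.
Proof. by apply: latticeP; rewrite /cB /= mul0r mul1r addr0. Qed.
Lemma cC_corner alpha T : cC alpha T = corner (funnel alpha T.1) T.2 false true.
Proof. by apply: latticeP; rewrite /cC /= mul0r mul1r addr0. Qed.
Lemma cD_corner alpha T : cD alpha T = corner (funnel alpha T.1) T.2 true true.
Proof. by apply: latticeP; rewrite /cD /= !mul1r. Qed.

Lemma cornersP alpha T x : reflect (exists a b, x = corner (funnel alpha T.1) T.2 a b)
  (x \in corners alpha T).
Proof.
rewrite cornersE !inE; apply: (iffP idP).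
  by case/or4P => /eqP ->; do 2!eexists.
by case=> [] [] [] [] ->; rewrite eqxx ?orbT.
Qed.

Lemma corner_inj e v a b a' b' : farey_edge e -> (e.1.2 != e.2.2)%N ->
  (corner e v a b == corner e v a' b') = ((a, b) == (a', b')).
Proof.
case: e v => [[l1 l2] [s1 s2]] [v1 v2] [/= h h1 h2 h3 h4] hne.
rewrite /corner /=; case: a; case: b; case: a'; case: b'; rewrite /= ?eqxx //.
all: by apply/negP => /eqP[]; lia.
Qed.

Lemma corner_diff e v a b a' b' : farey_edge e -> (e.1.2 != e.2.2)%N ->
  (a, b) != (a', b') -> (corner e v a b - corner e v a' b').1 != 0.
Proof.
case: e v => [[l1 l2] [s1 s2]] [v1 v2] [/= h h1 h2 h3 h4] hne.
rewrite /corner /=; case: a; case: b; case: a'; case: b' => //= _.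
all: by lia.
Qed.

Lemma slope_corner e v a b a' b' : farey_edge e -> hat_position e ->
  slope (corner e v a b) (corner e v a' b') =
  if a == a' then (if b == b' then (0, 0)%N else e.2)
  else if b == b' then e.1 else if a == b then apex e else ehat e.
Proof.
move=> fe; rewrite /hat_position; case: (ehat e) => [k1 k2].
case: e v fe => [[l1 l2] [s1 s2]] [v1 v2] [/= h h1 h2 h3 h4] H.
have {}H : (s1 = l1 + k1 /\ s2 = l2 + k2)%N \/ (l1 = k1 + s1 /\ l2 = k2 + s2)%N.
  by case: H => [] [_ [-> ->]]; [left | right].
rewrite /slope /corner /apex /oplus.
case: a; case: b; case: a'; case: b'; rewrite /=; congr pair.
all: by lia.
Qed.

Lemma slopeC x y : slope y x = slope x y.
Proof. by rewrite /slope; congr pair => /=; lia. Qed.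

Lemma slopeP (a b : lattice) s : absz (b.2 - a.2) = s.1 -> absz (b.1 - a.1) = s.2 ->
  slope a b = s.
Proof. by case: s => [? ?] /= <- <-. Qed.

Section Corners.
Variables (alpha : rat) (n : nat).
Local Notation corners := (corners alpha).
Local Notation valid := (valid n).

Lemma valid_edge T : valid T -> farey_edge (funnel alpha T.1).
Proof. by move=> hT; apply: farey_edge_funnel. Qed.

Lemma valid_hat T : valid T -> hat_position (funnel alpha T.1).
Proof. by case: T => [[//|j] v] _; apply: hat_position_funnel. Qed.

Lemma corners_mem T : [/\ cA T \in corners T, cB alpha T \in corners T,
  cC alpha T \in corners T & cD alpha T \in corners T].
Proof. by rewrite /Defs.corners !inE !eqxx ?orbT. Qed.

Lemma corner_mem T x a b : x = corner (funnel alpha T.1) T.2 a b ->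
  x \in corners T.
Proof. by move=> ->; apply/cornersP; exists a, b. Qed.

Section OneTet.
Variable T : tet.
Hypothesis hT : valid T.
Local Notation e := (funnel alpha T.1).

Lemma corner_eq v a b a' b' : (corner e v a b == corner e v a' b') = ((a, b) == (a', b')).
Proof.
by apply: corner_inj; [apply: valid_edge hT | apply: hat_position_neq (valid_hat hT)].
Qed.

Lemma corner_fst_neq x y : x \in corners T -> y \in corners T -> x != y -> (y - x).1 != 0.
Proof.
move=> /cornersP[a [b ->]] /cornersP[a' [b' ->]]; rewrite corner_eq eq_sym => h.
by apply: corner_diff h; [apply: valid_edge hT | apply: hat_position_neq (valid_hat hT)].
Qed.

Lemma third_corner x y : x \in corners T -> y \in corners T ->
  exists w, [/\ w \in corners T, w != x & w != y].
Proof.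
move=> /cornersP[a [b ->]] /cornersP[a' [b' ->]].
have [a2 [b2 [h1 h2]]] : exists a2 b2, (a2, b2) != (a, b) /\ (a2, b2) != (a', b').
  case: (eqVneq (~~ a, b) (a', b')) => [<-|h].
    by exists a, (~~ b); case: a; case: b.
  by exists (~~ a), b; split=> //; case: a {h}.
exists (corner e T.2 a2 b2); rewrite !corner_eq; split=> //.
by apply/cornersP; exists a2, b2.
Qed.

End OneTet.

(** The six edges from their left ends. Each side slope occurs twice and each
    diagonal once, and the direction of the upper diagonal depends on which side
    is longer. *)
Lemma positive_edges j v x s : valid (j, v) -> x \in corners (j, v) ->
    x + svec s \in corners (j, v) -> (0 < s.2)%N ->
  let e := funnel alpha j in let c := corner e v in
  [\/ s = e.1 /\ (x = c false false \/ x = c false true),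
      s = e.2 /\ (x = c false false \/ x = c true false),
      s = apex e /\ x = c false false |
      s = ehat e /\ (e.1.2 < e.2.2)%N /\ x = c true false \/
      s = ehat e /\ (e.2.2 < e.1.2)%N /\ x = c false true].
Proof.
move=> hT /cornersP[a [b ex]] /cornersP[a' [b' ey]] hs /=.
have fe := valid_edge hT; have hp := valid_hat hT.
have S : slope x (x + svec s) = s.
  by apply: slopeP; rewrite /svec /=; clear; lia.
move: S; rewrite {1}ex ey (slope_corner _ _ _ _ _ fe hp) /= => S.
have E1 : (corner (funnel alpha j) v a b).1 + s.2%:Z = (corner (funnel alpha j) v a' b').1.
  by rewrite -ey -ex.
have {fe hp} [h1 h2 H] : [/\ (0 < (funnel alpha j).1.2)%N, (0 < (funnel alpha j).2.2)%N &
    ((funnel alpha j).1.2 < (funnel alpha j).2.2)%N \/ ((funnel alpha j).2.2 < (funnel alpha j).1.2)%N].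
  case: fe => [_ h1 h2 _ _]; split=> //.
  by case: hp => [] [? _]; [left | right].
move: S ex E1; move: h1 h2 H hs; clear.
case: a; case: b; case: a'; case: b' => /= h1 h2 H hs S ex.
all: rewrite ?mul0r ?mul1r ?addr0 -?S => E1; try by [rewrite -S in hs]; try by exfalso; lia.
- by constructor 2; split; [|right].
- by constructor 4; left; split=> //; split=> //; lia.
- by constructor 1; split; [|right].
- by constructor 4; right; split=> //; split=> //; lia.
- by constructor 3.
- by constructor 1; split; [|left].
- by constructor 2; split; [|left].
Qed.

Lemma corner_positive T x y : valid T -> x \in corners T -> y \in corners T ->
  0 < (y - x).1 -> y = x + svec (slope x y) /\ (0 < (slope x y).2)%N.
Proof.
move=> hT /cornersP[a [b ->]] /cornersP[a' [b' ->]].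
have := valid_hat hT; have := valid_edge hT; rewrite /hat_position.
case: (funnel alpha T.1) => [[l1 l2] [s1 s2]] [_ /= l20 s20 _ _].
case: (ehat _) => [h1 h2] /= H {hT}.
have {}H : (s1 = l1 + h1 /\ s2 = l2 + h2)%N \/ (l1 = h1 + s1 /\ l2 = h2 + s2)%N.
  by case: H => [] [_ [-> ->]]; [left | right].
move: l20 s20 H; rewrite /slope /corner; move: T.2 => v; clear.
case: a; case: b; case: a'; case: b' => /= l20 s20 H gt0; split.
all: try by [lia].
all: by apply: latticeP => /=; lia.
Qed.

End Corners.
Arguments corner_eq {alpha n T}.


(** * Gluings and paths *)

Definition ginv (g : gluing) : gluing :=
  match g with Trans c => Trans (- c) | Rot c => Rot c | Fold P => Fold P end.

Lemma gmapK g w : gmap (ginv g) (gmap g w) = w.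
Proof.
case: g => [c|c|P]; apply: latticeP; rewrite /gmap /ginv ?mulr2n /=; lia.
Qed.

Lemma gmap_inj g : injective (gmap g).
Proof. exact: can_inj (gmapK g). Qed.

Lemma gdom_inv g w : gdom g w -> gdom (ginv g) (gmap g w).
Proof.
case: g => [c|c|P] //=; rewrite !inE.
have E (x y : lattice) : (x == y) = (x.1 == y.1) && (x.2 == y.2) by [].
rewrite !E /=; lia.
Qed.

Lemma Fold_0 (P : lattice) : gmap (Fold P) P = P.
Proof. by apply: latticeP => /=; lia. Qed.
Lemma Fold_1 (P : lattice) : gmap (Fold P) (P + svec fr0) = P + svec fr1.
Proof. by apply: latticeP => /=; lia. Qed.
Lemma Fold_1' (P : lattice) : gmap (Fold P) (P + svec fr1) = P + svec fr0.
Proof. by apply: latticeP => /=; lia. Qed.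
Lemma Fold_2 (P : lattice) : gmap (Fold P) (P + svec fr12) = P + svec fr12.
Proof. by apply: latticeP => /=; lia. Qed.

Lemma slope_Fold (P : lattice) :
  [/\ slope P (P + svec fr0) = fr0, slope P (P + svec fr1) = fr1 &
      slope P (P + svec fr12) = fr12] /\
  slope (P + svec fr0) (P + svec fr12) = fr1 /\
  slope (P + svec fr1) (P + svec fr12) = fr0.
Proof. by split; split; apply: slopeP => /=; lia. Qed.

Section Paths.
Variables (alpha : rat) (n : nat).
Local Notation corners := (corners alpha).
Local Notation valid := (valid n).
Local Notation glued := (glued alpha).
Local Notation step := (step alpha n).
Local Notation is_path := (is_path alpha n).
Local Notation tracks := (tracks alpha).
Local Notation dpath := (seq (gluing * tet)).

Lemma gluedE T g T' w w' : glued T g T' w w' ->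
  [/\ w \in corners T, gmap g w \in corners T', gdom g w & w' = gmap g w].
Proof. by case/and4P => h1 h2 h3 /eqP h4; rewrite -h4. Qed.

Lemma glued_sym T g T' w w' : glued T g T' w w' -> glued T' (ginv g) T w' w.
Proof.
case/gluedE => h1 h2 h3 ->; apply/and4P; split=> //; first exact: gdom_inv.
by rewrite gmapK.
Qed.

Lemma is_path_cat T p q T' : is_path T (p ++ q) T' <->
  exists2 T1, is_path T p T1 & is_path T1 q T'.
Proof.
elim: p T => [|[g T1] p IH] T /=.
  by split=> [h|[T1 -> //]]; exists T.
split=> [[hs /IH[T2 h1 h2]]|[T2 [hs h1] h2]]; first by exists T2.
by split=> //; apply/IH; exists T2.
Qed.

Lemma is_path_rcons T p g T1 T' : is_path T (rcons p (g, T1)) T' <->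
  exists2 T2, is_path T p T2 & step T2 g T1 /\ T1 = T'.
Proof. by rewrite -cats1; apply: is_path_cat. Qed.

Lemma is_path_end T p T1 T2 : is_path T p T1 -> is_path T p T2 -> T1 = T2.
Proof.
elim: p T => [|[g T3] p IH] T /=; first by move=> <- <-.
by case=> _ h [_ h']; apply: IH h h'.
Qed.

Lemma is_path_valid T p T' : is_path T p T' -> valid T -> valid T'.
Proof.
elim: p T => [|[g T3] p IH] T /=; first by move=> <-.
by case=> [[_ h _] h'] _; apply: IH h' h.
Qed.

Lemma tracks_cat T x p T' x' q x'' : is_path T p T' -> tracks T x p x' ->
  tracks T' x' q x'' -> tracks T x (p ++ q) x''.
Proof.
elim: p T x => [|[g T3] p IH] T x /=; first by move=> <- ->.
by case=> _ h [hg h'] h''; split=> //; apply: IH h h' h''.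
Qed.

Lemma tracks_corner T x p T' x' : is_path T p T' -> x \in corners T ->
  tracks T x p x' -> x' \in corners T'.
Proof.
elim: p T x => [|[g T3] p IH] T x /=; first by move=> <- hx <-.
by case=> _ h hx [/gluedE[_ hg _ _] h']; apply: IH h hg h'.
Qed.

Lemma tracks_inj T x y p x' y' : tracks T x p x' -> tracks T y p y' ->
  x != y -> x' != y'.
Proof.
elim: p T x y => [|[g T3] p IH] T x y /=; first by move=> <- <-.
case=> _ h [_ h'] nxy; apply: IH h h' _.
by rewrite (inj_eq (@gmap_inj g)).
Qed.

Lemma step_sym T g T' : step T g T' -> step T' (ginv g) T.
Proof.
case=> hT hT' [x [y [x' [y' [nxy hx hy]]]]]; split=> //.
exists x', y', x, y; split; rewrite ?glued_sym //.
have [_ _ _ ->] := gluedE hx; have [_ _ _ ->] := gluedE hy.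
by rewrite (inj_eq (@gmap_inj g)).
Qed.

Fixpoint revp (T : tet) (p : dpath) : dpath :=
  if p is (g, T1) :: p1 then rcons (revp T1 p1) (ginv g, T) else [::].

Lemma is_path_rev T p T' : is_path T p T' -> is_path T' (revp T p) T.
Proof.
elim: p T => [|[g T1] p IH] T /=; first by move=> <-.
case=> hs h; apply/is_path_rcons; exists T1; first exact: IH.
by split=> //; apply: step_sym.
Qed.

Lemma tracks_rev T x p T' x' : is_path T p T' -> tracks T x p x' ->
  tracks T' x' (revp T p) x.
Proof.
elim: p T x => [|[g T1] p IH] T x /=; first by move=> _ <-.
case=> hs h [hg h']; rewrite -cats1; apply: (tracks_cat (is_path_rev h)) (IH _ _ h h') _.
rewrite /= gmapK; split=> //.
exact: glued_sym.
Qed.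

Lemma step_pair T g T' : step T g T' ->
  exists x y, [/\ x != y, glued T g T' x (gmap g x) & glued T g T' y (gmap g y)].
Proof.
case=> hT hT' [x [y [x' [y' [nxy hx hy]]]]]; exists x, y.
have [_ _ _ ex] := gluedE hx; have [_ _ _ ey] := gluedE hy.
by rewrite -ex -ey.
Qed.

Lemma step_pair_at T g T' x : step T g T' -> glued T g T' x (gmap g x) ->
  exists2 y, y != x & glued T g T' y (gmap g y).
Proof.
move=> /step_pair[u [v [nuv hu hv]]] hx.
case: (eqVneq u x) => [eu|nu]; last by exists u.
by exists v; rewrite // -eu eq_sym.
Qed.

Lemma gmap_Trans0 w : gmap (Trans 0) w = w.
Proof. by rewrite /gmap mul0rn addr0. Qed.

Lemma glued_Trans0 T T' w : w \in corners T -> w \in corners T' ->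
  glued T (Trans 0) T' w (gmap (Trans 0) w).
Proof. by move=> h h'; rewrite gmap_Trans0; apply/and4P; split; rewrite ?gmap_Trans0. Qed.

(** The points that the folding map moves are never two corners of the same
    tetrahedron, so a folding acts on a triangle. *)
Lemma Fold_corners T (P : lattice) : valid T -> exists w : lattice,
  [/\ w = P + svec fr0 \/ w = P + svec fr1 &
   forall x : lattice, x \in corners T -> gdom (Fold P) x -> x \in [:: P; w; P + svec fr12]].
Proof.
move=> hT; case: (boolP (P + svec fr0 \in corners T)) => h0.
  exists (P + svec fr0); split; first by left.
  move=> x hx; rewrite /gdom !inE => /or4P[] /eqP ex; rewrite {}ex ?eqxx ?orbT // in hx *.
  have ne : P + svec fr0 != P + svec fr1.
    by apply/eqP => /(congr1 (fun u : lattice => u.2)) /=; lia.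
  by have := corner_fst_neq hT h0 hx ne; rewrite /svec /=; lia.
exists (P + svec fr1); split; first by right.
move=> x hx; rewrite /gdom !inE => /or4P[] /eqP ex; rewrite {}ex ?eqxx ?orbT // in hx *.
by rewrite hx in h0.
Qed.

End Paths.

Lemma gmap_FoldK P w : gmap (Fold P) (gmap (Fold P) w) = w.
Proof. exact: (gmapK (Fold P)). Qed.

Lemma gmap_diff c (x y : lattice) : (gmap (Trans c) y - gmap (Trans c) x = y - x) /\
  (gmap (Rot c) y - gmap (Rot c) x = - (y - x)).
Proof. split; apply: latticeP; rewrite /gmap ?mulr2n /=; lia. Qed.

Lemma turnN u w : u.1 != 0 -> w.1 != 0 -> turn (- u) (- w) = turn u w.
Proof.
case: u w => [u1 u2] [w1 w2] /= hu hw; rewrite /turn /=.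
by case: ifP => h1; case: ifP => h2; [lia|lia|lia|rewrite !mulrNN].
Qed.

Lemma rot_target (X : lattice) : X + X - (X - (3, 1)) - (3, 1) = X.
Proof. by apply: latticeP => /=; lia. Qed.

(** ** The top of the stack *)

Section Level1Steps.
Variables (alpha : rat) (n : nat).
Hypotheses (ha : alpha < 1 / 2%:R) (hn : (0 < n)%N).
Local Notation corners := (corners alpha).
Local Notation glued := (glued alpha).
Local Notation step := (step alpha n).

Lemma valid1 v : valid n (1%N, v).
Proof. by rewrite /Defs.valid /= hn. Qed.

Lemma corner_mem1 v x a b : x = corner (fr0, fr12) v a b -> x \in corners (1%N, v).
Proof. by move=> e; apply: (@corner_mem alpha (1%N, v) x a b); rewrite /= funnel1. Qed.

Lemma glued1 v v' g x a b a' b' : x = corner (fr0, fr12) v a b ->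
  gmap g x = corner (fr0, fr12) v' a' b' -> gdom g x ->
  glued (1%N, v) g (1%N, v') x (gmap g x).
Proof.
move=> h h' hd; apply/and4P; split=> //; first exact: corner_mem1 h.
exact: corner_mem1 h'.
Qed.

(** The first of three gluings that go once around the vertex X at the top of
    the stack: cross the edge of slope 0 that ends at X, rotate about X
    ([cross_rot]), and fold across the edge of slope 1/2 from X
    ([cross_fold]). *)
Lemma cross0 (X : lattice) : let T := (1%N, X - svec fr0) in let T' := (1%N, X - (3, 1)) in
  [/\ glued T (Trans 0) T' X (gmap (Trans 0) X),
      glued T (Trans 0) T' (X - svec fr0) (gmap (Trans 0) (X - svec fr0)) &
      step T (Trans 0) T'].
Proof.
move=> T T'.
have g1 : glued T (Trans 0) T' X (gmap (Trans 0) X).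
  by apply: (@glued1 _ _ _ _ true false true true) => //; lattice_eq.
have g2 : glued T (Trans 0) T' (X - svec fr0) (gmap (Trans 0) (X - svec fr0)).
  by apply: (@glued1 _ _ _ _ false false false true) => //; lattice_eq.
split=> //; split; rewrite ?valid1 //.
exists X, (X - svec fr0), (gmap (Trans 0) X), (gmap (Trans 0) (X - svec fr0)).
split=> //; apply/eqP => /(congr1 (fun u : lattice => u.1)) /=; lia.
Qed.

Lemma cross_rot (X w : lattice) v : w \in corners (1%N, v) ->
  glued (1%N, v) (Rot X) (1%N, X + X - v - (3, 1)) w (gmap (Rot X) w).
Proof.
move=> /cornersP[a [b]] /=; rewrite funnel1 // => ew.
apply: (@glued1 _ _ _ _ a b (~~ a) (~~ b)) => //; rewrite ew.
by case: a {ew}; case: b; lattice_eq.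
Qed.

Lemma cross_fold (X w : lattice) : w \in [:: X; X + svec fr0; X + svec fr12] ->
  glued (1%N, X) (Fold X) (1%N, X - svec fr0) w (gmap (Fold X) w).
Proof.
rewrite !inE => /or3P[] /eqP ->.
- by apply: (@glued1 _ _ _ _ false false true false);
    [lattice_eq | lattice_eq | rewrite /gdom !inE eqxx].
- by apply: (@glued1 _ _ _ _ true false false true);
    [lattice_eq | lattice_eq | rewrite /gdom !inE eqxx ?orbT].
- by apply: (@glued1 _ _ _ _ false true true true);
    [lattice_eq | lattice_eq | rewrite /gdom !inE eqxx ?orbT].
Qed.

Lemma step_rot (X v : lattice) : step (1%N, v) (Rot X) (1%N, X + X - v - (3, 1)).
Proof.
split; rewrite ?valid1 //.
have h1 : v \in corners (1%N, v) by apply: (@corner_mem1 _ _ false false); lattice_eq.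
have h2 : v + svec fr0 \in corners (1%N, v) by apply: (@corner_mem1 _ _ true false); lattice_eq.
exists v, (v + svec fr0), (gmap (Rot X) v), (gmap (Rot X) (v + svec fr0)).
split; try exact: cross_rot.
by apply/eqP => /(congr1 (fun u : lattice => u.1)) /=; lia.
Qed.

Lemma step_fold (X : lattice) : step (1%N, X) (Fold X) (1%N, X - svec fr0).
Proof.
split; rewrite ?valid1 //.
exists X, (X + svec fr0), (gmap (Fold X) X), (gmap (Fold X) (X + svec fr0)).
split; try by apply: cross_fold; rewrite !inE ?eqxx ?orbT.
by apply/eqP => /(congr1 (fun u : lattice => u.1)) /=; lia.
Qed.

End Level1Steps.

Section Top.
Variables (alpha : rat) (n : nat).
Local Notation valid := (valid n).

(** A canonical tetrahedron containing the edge of slope s from x. In general it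
    is the one whose bottom edge this is, and the edge does not occur above it.
    The three slopes of the first pleated surface are not bottom edges; there
    one tetrahedron of the first level is selected. *)
Definition top s x T :=
  [\/ [/\ T.2 = x, valid T & apex (funnel alpha T.1) = s],
      s = fr12 /\ T = (1%N, x), s = fr1 /\ T = (1%N, x - svec fr0) |
      s = fr0 /\ T = (1%N, x)].

Lemma apex_funnelS j : ((apex (funnel alpha j)).2 < (apex (funnel alpha j.+1)).2)%N.
Proof.
have := farey_edge_funnel alpha j; have := funnel_cases alpha j.
case: (funnel alpha j.+1) => e1 e2; case: (funnel alpha j) => [[l1 l2] [s1 s2]] /=.
by rewrite /apex /oplus => -[] [-> ->] [_ /= h1 h2 _ _] /=; lia.
Qed.

Lemma apex_funnel_lt i j : (i < j)%N -> ((apex (funnel alpha i)).2 < (apex (funnel alpha j)).2)%N.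
Proof.
elim: j => // j IH; rewrite ltnS leq_eqVlt => /orP[/eqP ->|/IH h].
  exact: apex_funnelS.
exact: ltn_trans h (apex_funnelS j).
Qed.

(** The denominators of the bottom slopes increase strictly down the stack. *)
Lemma top_unique s x T1 T2 : top s x T1 -> top s x T2 -> T1 = T2.
Proof.
have ap T : valid T -> (2 < (apex (funnel alpha T.1)).2)%N.
  by case: T => j v /andP[/= hj _]; have := apex_funnel_lt hj.
have apn T s' : valid T -> apex (funnel alpha T.1) = s' -> (s'.2 <= 2)%N -> False.
  by move=> hT <-; have := ap T hT; lia.
have inj (U1 U2 : tet) : valid U1 -> valid U2 -> U1.2 = U2.2 ->
    apex (funnel alpha U1.1) = apex (funnel alpha U2.1) -> U1 = U2.
  case: U1 U2 => [j1 v1] [j2 v2] /= _ _ ->.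
  case: (ltngtP j1 j2) => [h|h|-> //] e; have := apex_funnel_lt h; by rewrite e ltnn.
case=> [[x1 v1 a1]|[es ->]|[es ->]|[es ->]] [[x2 v2 a2]|[es2 ->]|[es2 ->]|[es2 ->]] //;
  try by move: es2; rewrite es.
- by apply: inj => //; rewrite ?x1 ?x2 ?a1 ?a2.
- by case: (apn _ _ v1 a1); rewrite es2.
- by case: (apn _ _ v1 a1); rewrite es2.
- by case: (apn _ _ v1 a1); rewrite es2.
- by case: (apn _ _ v2 a2); rewrite es.
- by case: (apn _ _ v2 a2); rewrite es.
- by case: (apn _ _ v2 a2); rewrite es.
Qed.

Lemma validS j v v' : valid (j.+2, v) -> valid (j.+1, v').
Proof. by rewrite /Defs.valid /=; clear; lia. Qed.

End Top.

(** * Link positions and frames *)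

Section Geometry.
Variable R : realType.
Local Notation C := (R[i]).
Variables (alpha : rat) (n : nat) (Q N : fareyfrac -> {poly int}) (z : C).
Hypotheses (hQ : is_calQ Q) (hN : is_calN Q N) (hz : in_H alpha n Q z).

Local Notation q s := (evalz z (Q s)).
Local Notation d s := (evalz z (dQ s)).
Local Notation V := (cusp_value Q N z).
Local Notation corners := (corners alpha).
Local Notation eq_on := (eq_on alpha).
Local Notation shaped := (shaped alpha Q z).
Local Notation valid := (valid n).
Local Notation glued := (glued alpha).
Local Notation step := (step alpha n).
Local Notation is_path := (is_path alpha n).
Local Notation tracks := (tracks alpha).
Local Notation dpath := (seq (gluing * tet)).
Local Notation CP1 := (CP1 R).
Implicit Types (A B M : 'M[C]_2) (T : tet) (f : lattice -> CP1) (x y w v P X : lattice).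

Lemma z_neq0 : z != 0.
Proof. by case: hz => /Im_pos_neq[]. Qed.

Lemma valid_local T : valid T -> farey_local Q N z (funnel alpha T.1).
Proof. by case: T => [[//|j] v] _; apply: farey_local_funnel. Qed.

Lemma valid_nondeg T : valid T -> farey_nondeg Q z (funnel alpha T.1).
Proof.
move=> hT; apply: farey_nondeg_Im; [exact: z_neq0 | exact: valid_local |].
by case: hz => _; apply.
Qed.

Definition row_sign (x : lattice) : C := (-1) ^+ odd `|x.2|%N.
(** The position of w seen from x at infinity, with y at the origin. Without
    the sign, a folding would reverse the positions seen from the vertex that
    it moves, because it reverses the sense of turning there; but it moves this
    vertex to a row of the other parity. *)
Definition link (x y w : lattice) : C :=
  row_sign x * (V (slope x w) - V (slope x y) - (turn (y - x) (w - x))%:~R).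
Definition frame (x y w : lattice) : CP1 := if w == x then None else Some (link x y w).
(** The frames at the two ends of an edge differ by t |-> k/t with this k. *)
Definition swap_coef (x y : lattice) : C := - z ^+ (slope x y).2 / q (slope x y) ^+ 2.

Lemma row_sign_sqr x : row_sign x * row_sign x = 1.
Proof. by rewrite /row_sign -signr_addb addbb. Qed.

Lemma row_sign_mul x y : row_sign x * row_sign y = (-1) ^+ (slope x y).1.
Proof.
rewrite /row_sign -signr_addb /slope [in RHS]/fst -[in RHS]signr_odd.
rewrite (_ : (y - x).2 = y.2 - x.2) // odd_abszB; congr (_ ^+ nat_of_bool _).
by rewrite addbC.
Qed.

(** Positions in the tetrahedron of the edge e seen from the corner (a, b): the
    finite vertices of delta'(e) or delta(e) according to whether the corner is
    on the bottom or on the top edge. *)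
Definition lift_value e (a b a' b' : bool) : C :=
  if a == a' then V e.2
  else if b == b' then (if a == b then V e.1 else V e.1 - 1)
  else if a == b then V (apex e) else V (ehat e) - (e.2.2 < e.1.2)%N%:R.

Lemma lift_valueE e v a b a' b' : farey_local Q N z e -> (a', b') != (a, b) ->
  lift_value e a b a' b' = V (slope (corner e v a b) (corner e v a' b')) -
    (turn_potential a b (corner e v a' b' - corner e v a b))%:~R.
Proof.
move=> he; have hp := farey_local_hat he; have hne := hat_position_neq hp; have [[fe _ _] _] := he.
rewrite slope_corner // /lift_value /turn_potential => h.
case: e v fe hne {he hp} => [[l1 l2] [s1 s2]] [v1 v2] [/= k k1 k2 k3 k4] hne.
move: h; case: a; case: b; case: a'; case: b' => //= _; rewrite ?subr0 //.
all: first [ rewrite (_ : (_ < _)%R = false); [by rewrite mulr0z subr0 | lia]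
           | rewrite (_ : (_ < _)%R = true); [by rewrite mulr1z | lia]
           | rewrite (_ : (_ < _)%R = (s2 < l2)%N); [by rewrite pmulrn | lia] ].
Qed.

Lemma link_corner e v a b a1 b1 a2 b2 : farey_local Q N z e ->
  (a1, b1) != (a, b) -> (a2, b2) != (a, b) ->
  link (corner e v a b) (corner e v a1 b1) (corner e v a2 b2) =
  row_sign (corner e v a b) * (lift_value e a b a2 b2 - lift_value e a b a1 b1).
Proof.
move=> he h1 h2; have hp := farey_local_hat he; have hne := hat_position_neq hp; have [[fe _ _] _] := he.
rewrite /link turn_corner // !(lift_valueE v he) // rmorphB /=; congr (_ * _); ring.
Qed.

Lemma q_slope_corner e v a b a1 b1 : farey_local Q N z e -> (a1, b1) != (a, b) ->
  q (slope (corner e v a b) (corner e v a1 b1)) =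
    if a == a1 then q e.2 else if b == b1 then q e.1 else
    if a == b then q (apex e) else q (ehat e).
Proof.
move=> he; have hp := farey_local_hat he; have [[fe _ _] _] := he.
rewrite (slope_corner _ _ _ _ _ fe hp).
by case: a; case: b; case: a1; case: b1.
Qed.

Section Tetrahedron.
Variable T : tet.
Hypothesis hT : valid T.
Local Notation e := (funnel alpha T.1).

Lemma lift_differences : 
  let L := e.1 in let S := e.2 in let h := ehat e in let a := apex e in
  let m := d (eminus e) in
  [/\ V S - V L = - (m * q h) / (q L * q S),
      V a - V L = - (d L * q S) / (q a * q L) &
      V a - V S = d S * q L / (q a * q S)] /\
  [/\ V h - (S.2 < L.2)%N%:R - (V L - 1) = d L / m * q S / (q L * q h),
      V S - (V h - (S.2 < L.2)%N%:R) = d S / m * q L / (q h * q S) &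
      V S - (V L - 1) = q a / (q L * q S)] /\
  d h * m ^+ 2 = d L * d S.
Proof. exact: link_formulas z_neq0 (valid_local hT) (valid_nondeg hT). Qed.

(** A case check over the ordered pairs of corners: the product of two
    differences of positions from [link_formulas] is -d(s)/Q(s)^2 for the slope
    s of the edge, and the two signs multiply to the sign of d(s). *)
Lemma link_swap_corner v a b a1 b1 a2 b2 : uniq [:: (a, b); (a1, b1); (a2, b2)] ->
  link (corner e v a1 b1) (corner e v a b) (corner e v a2 b2) *
  link (corner e v a b) (corner e v a1 b1) (corner e v a2 b2) =
  swap_coef (corner e v a b) (corner e v a1 b1) /\
  link (corner e v a b) (corner e v a1 b1) (corner e v a2 b2) != 0.
Proof.
rewrite /= !inE negb_or andbT => /andP[/andP[n1 n2] n3].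
have he := valid_local hT; have [hL hS ha hh _] := valid_nondeg hT.
rewrite !link_corner //; try by rewrite eq_sym.
set s0 := row_sign (corner e v a b); set s1 := row_sign (corner e v a1 b1).
set D1 := (lift_value e a1 b1 a2 b2 - _); set D2 := (lift_value e a b a2 b2 - _).
have sne x : row_sign x != 0 by rewrite /row_sign signr_eq0.
suff [E1 E2] : D1 * D2 = - d (slope (corner e v a b) (corner e v a1 b1)) /
    q (slope (corner e v a b) (corner e v a1 b1)) ^+ 2 /\ D2 != 0.
  split; last by rewrite mulf_neq0 ?sne.
  rewrite mulrACA E1 /s1 /s0 row_sign_mul slopeC /swap_coef.
  set s := slope _ _; rewrite evalz_dQ.
  have -> : (-1) ^+ s.1 * (- ((-1) ^+ s.1 * z ^+ s.2) / q s ^+ 2) =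
     ((-1) ^+ s.1) ^+ 2 * (- z ^+ s.2) / q s ^+ 2.
    by move: ((-1) ^+ s.1) (z ^+ s.2) (q s ^+ 2) => u w t; ring.
  by rewrite sqrr_sign mul1r.
rewrite /D1 /D2 {D1 D2 s0 s1} (slope_corner _ _ _ _ _ (valid_edge alpha hT) (valid_hat alpha hT)).
have [[g1 g2 g3] [[g4 g5 g6] g7]] := lift_differences.
have opp (x y u : C) : x - y = u -> y - x = - u by move=> <-; rewrite opprB.
have := opp _ _ _ g1; have := opp _ _ _ g2; have := opp _ _ _ g3.
have := opp _ _ _ g4; have := opp _ _ _ g5; have := opp _ _ _ g6.
move=> g6' g5' g4' g3' g2' g1'.
have hm := d_neq0 (eminus e) z_neq0.
have hdL := d_neq0 e.1 z_neq0; have hdS := d_neq0 e.2 z_neq0.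
have dh : d (ehat e) = d e.1 * d e.2 / d (eminus e) ^+ 2.
  by rewrite -g7 mulfK // expf_neq0.
have da : d (apex e) = d e.1 * d e.2 by apply: d_oplus.
move: n1 n2 n3 dh da hL hS ha hh hm hdL hdS; rewrite /lift_value.
move: g1 g2 g3 g4 g5 g6 g1' g2' g3' g4' g5' g6'; clear.
move: (V e.1) (V e.2) (V (apex e)) (V (ehat e) - (e.2.2 < e.1.2)%N%:R).
move=> vL vS va vh g1 g2 g3 g4 g5 g6 g1' g2' g3' g4' g5' g6'.
case: a; case: b; case: a1; case: b1 => // _; case: a2; case: b2 => // _ _.
all: rewrite /= ?(g1, g2, g3, g4, g5, g6, g1', g2', g3', g4', g5', g6') => dh da.
all: rewrite ?dh ?da; clear.
all: move: (q e.1) (q e.2) (q (apex e)) (q (ehat e)) (d (eminus e)) (d e.1) (d e.2).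
all: move=> L S a h m dL dS hL hS ha hh hm hdL hdS.
all: split; [field; by rewrite ?hL ?hS ?ha ?hh ?hm
  | by rewrite !(mulf_neq0, oppr_eq0, invr_eq0, hL, hS, ha, hh, hm, hdL, hdS)].
Qed.

End Tetrahedron.

Lemma link_id x y : link x y y = 0.
Proof. by rewrite /link /turn eqxx mulr0z subr0 subrr mulr0. Qed.

Section OneTet.
Variable T : tet.
Hypothesis hT : valid T.
Local Notation e := (funnel alpha T.1).

Lemma link_swap x y w : x \in corners T -> y \in corners T -> w \in corners T ->
  x != y -> w != x -> w != y -> link y x w * link x y w = swap_coef x y.
Proof.
move=> /cornersP[a [b ->]] /cornersP[a' [b' ->]] /cornersP[a2 [b2 ->]].
rewrite !(corner_eq hT) => h1 h2 h3.
apply: (proj1 (link_swap_corner hT _ _)).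
by rewrite /= !inE negb_or h1 andbT [(a, b) == (a2, b2)]eq_sym [(a', b') == (a2, b2)]eq_sym h2 h3.
Qed.

Lemma link_neq0 x y w : x \in corners T -> y \in corners T -> w \in corners T ->
  x != y -> w != x -> w != y -> link x y w != 0.
Proof.
move=> /cornersP[a [b ->]] /cornersP[a' [b' ->]] /cornersP[a2 [b2 ->]].
rewrite !(corner_eq hT) => h1 h2 h3.
apply: (proj2 (link_swap_corner hT _ _)).
by rewrite /= !inE negb_or h1 andbT [(a, b) == (a2, b2)]eq_sym [(a', b') == (a2, b2)]eq_sym h2 h3.
Qed.

Lemma swap_coef_neq0 x y : x \in corners T -> y \in corners T -> x != y -> swap_coef x y != 0.
Proof.
move=> /cornersP[a [b ->]] /cornersP[a' [b' ->]]; rewrite (corner_eq hT) eq_sym => h.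
have [hL hS ha hh _] := valid_nondeg hT.
rewrite /swap_coef (q_slope_corner _ (valid_local hT)) // mulf_neq0 //.
  by rewrite oppr_eq0 expf_neq0 // (z_neq0).
by rewrite invr_eq0 expf_neq0 //; do !case: ifP.
Qed.

(** Seen from one corner of a tetrahedron the positions are differences of
    [lift_value]. *)
Lemma link_cocycle x y w w' : x \in corners T -> y \in corners T ->
    w \in corners T -> w' \in corners T -> y != x -> w != x -> w' != x ->
  link x y w = link x y w' + link x w' w.
Proof.
move=> /cornersP[a [b ->]] /cornersP[a1 [b1 ->]] /cornersP[a2 [b2 ->]] /cornersP[a3 [b3 ->]].
rewrite !(corner_eq hT) => h1 h2 h3.
by rewrite !(link_corner _ (valid_local hT)) //; ring.
Qed.

Lemma frame_oo x y : frame x y x = None.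
Proof. by rewrite /frame eqxx. Qed.

Lemma frame_0 x y : x != y -> frame x y y = Some 0.
Proof. by rewrite /frame eq_sym => /negbTE ->; rewrite link_id. Qed.

Lemma frame_Some x y w : w != x -> frame x y w = Some (link x y w).
Proof. by rewrite /frame => /negbTE ->. Qed.

Lemma frame_turn x y w : x \in corners T -> y \in corners T -> w \in corners T ->
  y != x -> w != x ->
  eq_on T (frame x w) (fun u => mobius (transl (- link x y w)) (frame x y u)).
Proof.
move=> hx hy hw nyx nwx u hu; rewrite /frame; case: eqP => [_|/eqP nux].
  by rewrite mobius_transl_oo.
by rewrite mobius_transl (link_cocycle hx hy hu hw) //; congr Some; ring.
Qed.

Lemma frame_swap x y : x \in corners T -> y \in corners T -> x != y ->
  eq_on T (frame y x) (fun u => mobius (invol (swap_coef x y)) (frame x y u)).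
Proof.
move=> hx hy nxy u hu; case: (eqVneq u x) => [->|nux].
  by rewrite frame_oo mobius_invol_oo frame_0 // eq_sym.
case: (eqVneq u y) => [->|nuy].
  by rewrite frame_oo frame_0 // mobius_invol0.
rewrite !frame_Some // mobius_invol ?(link_neq0 hx hy) //.
by rewrite -(link_swap hx hy hu) // mulfK // (link_neq0 hx hy).
Qed.

(** ** Shapes of frames *)

Lemma shaped_eq_on f f' : eq_on T f f' -> shaped T f' -> shaped T f.
Proof.
have [hA hB hC hD] := corners_mem alpha T.
by move=> h; rewrite !shapedE !h.
Qed.

Lemma shaped_mobius M f : \det M != 0 -> shaped T f -> shaped T (fun w => mobius M (f w)).
Proof. by move=> hM; rewrite !shapedE; apply: shape4_mobius. Qed.

Lemma shaped_equiv f f' : shaped T f -> shaped T f' ->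
  exists2 M, \det M != 0 & eq_on T f' (fun w => mobius M (f w)).
Proof.
rewrite !shapedE => s s'; have [_ _ _ _ [t0 t1]] := valid_nondeg hT.
have [M hM [e1 e2 e3 e4]] := shape4_equiv t0 t1 s s'.
exists M => // w; rewrite /Defs.corners !inE.
by case/or4P => /eqP ->.
Qed.

(** All frames of a tetrahedron are isometric by [frame_turn] and [frame_swap],
    so that one edge parameter of one frame has to be computed. *)
Lemma shaped_frame x y : x \in corners T -> y \in corners T -> x != y ->
  shaped T (frame x y).
Proof.
have turn_ x' y' w : x' \in corners T -> y' \in corners T -> w \in corners T ->
    y' != x' -> w != x' -> shaped T (frame x' y') -> shaped T (frame x' w).
  move=> hx hy hw h1 h2 s; apply: shaped_eq_on (frame_turn hx hy hw h1 h2) _.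
  by apply: shaped_mobius s; rewrite det_transl oner_eq0.
have swap_ x' y' : x' \in corners T -> y' \in corners T -> x' != y' ->
    shaped T (frame x' y') -> shaped T (frame y' x').
  move=> hx hy h1 s; apply: shaped_eq_on (frame_swap hx hy h1) _.
  by apply: shaped_mobius s; rewrite det_invol oppr_eq0 (swap_coef_neq0 hx hy).
have [hA hB hC hD] := corners_mem alpha T.
have base : shaped T (frame (cA T) (cB alpha T)).
  rewrite shapedE frame_oo; have he := valid_local hT; have fe := valid_edge alpha hT; have hp := valid_hat alpha hT.
  have [hL hS ha hh _] := valid_nondeg hT.
  have [[g1 g2 g3] _] := lift_differences hT.
  have nn (s : lattice) : row_sign s != 0 by rewrite /row_sign signr_eq0.
  have hm := d_neq0 (eminus e) (z_neq0).
  have hdL := d_neq0 e.1 (z_neq0); have hdS := d_neq0 e.2 (z_neq0).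
  rewrite !frame_Some ?(cA_corner alpha) ?cB_corner ?cC_corner ?cD_corner ?(corner_eq hT) //.
  rewrite link_id !link_corner // /lift_value /= g1 g2 (calZE (z_neq0) he).
  have g4 : V (apex e) - V e.2 = d e.2 * q e.1 / (q (apex e) * q e.2) by [].
  set s := row_sign _; have hs : s != 0 by exact: nn.
  set c := s * _; set w := s * _.
  have hc : c != 0 by rewrite !mulf_neq0 ?oppr_eq0 ?invr_eq0 ?mulf_neq0.
  have hw : w != 0 by rewrite !mulf_neq0 ?oppr_eq0 ?invr_eq0 ?mulf_neq0.
  have hwc : w - c = s * (d e.2 * q e.1 / (q (apex e) * q e.2)).
    rewrite /w /c -mulrBr -g1 -g2 -g4; congr (_ * _); ring.
  have hwc0 : w - c != 0 by rewrite hwc !mulf_neq0 ?invr_eq0 ?mulf_neq0.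
  apply: shape4_intro; last first.
    rewrite /edge_param /bracket /= !mulr1 !mulr0 ?mul0r ?subr0.
    rewrite hwc /w; move: hL hS ha hdL hdS hs; clear.
    by move=> *; field; apply/and5P; split.
  split; split; rewrite bracket_eq0 //; apply/eqP => -[] // h.
  - by rewrite -h eqxx in hc.
  - by rewrite -h eqxx in hw.
  - by rewrite h subrr eqxx in hwc0.
have neAB : cA T != cB alpha T by rewrite (cA_corner alpha) cB_corner (corner_eq hT).
move=> hx hy nxy.
have frA y' : y' \in corners T -> y' != cA T -> shaped T (frame (cA T) y').
  by move=> hy' ny'; apply: turn_ base => //; rewrite eq_sym.
case: (eqVneq x (cA T)) => [ex|nx]; first by rewrite ex; apply: frA; rewrite // -ex eq_sym.
apply: (turn_ x (cA T)) => //; first by rewrite eq_sym.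
  by rewrite eq_sym.
by apply: swap_; rewrite // 1?eq_sym //; apply: frA.
Qed.

Lemma frame_of_shaped x y f : x \in corners T -> y \in corners T -> x != y ->
  shaped T f -> exists2 B, \det B != 0 & eq_on T f (fun w => mobius B (frame x y w)).
Proof. by move=> hx hy nxy hf; apply: shaped_equiv hf; apply: shaped_frame. Qed.

(** When two placements agree only along an edge, a ratio remains free. *)
Lemma frame_eq_diag x y A B : x \in corners T -> y \in corners T -> x != y ->
    \det A != 0 -> \det B != 0 ->
    mobius A (frame x y x) = mobius B (frame x y x) ->
    mobius A (frame x y y) = mobius B (frame x y y) ->
  exists a b, A = B *m mx2 a 0 0 b.
Proof.
by move=> hx hy nxy hA hB; rewrite frame_oo frame_0 //; apply: mobius_eq_diag.
Qed.

Lemma frame_eq3 x y w A B : x \in corners T -> y \in corners T -> w \in corners T ->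
    x != y -> w != x -> w != y -> \det A != 0 -> \det B != 0 ->
    mobius A (frame x y x) = mobius B (frame x y x) ->
    mobius A (frame x y y) = mobius B (frame x y y) ->
    mobius A (frame x y w) = mobius B (frame x y w) ->
  exists2 k, k != 0 & A = k *: B.
Proof.
move=> hx hy hw nxy nwx nwy hA hB.
rewrite frame_oo frame_0 // frame_Some //.
by apply: mobius_eq3; rewrite ?(link_neq0 hx hy hw).
Qed.

Lemma frame_eq x y A B : x \in corners T -> y \in corners T -> x != y ->
    \det A != 0 -> \det B != 0 ->
    eq_on T (fun w => mobius A (frame x y w)) (fun w => mobius B (frame x y w)) ->
  exists2 k, k != 0 & A = k *: B.
Proof.
move=> hx hy nxy hA hB h; have [w [hw nwx nwy]] := third_corner hT hx hy.
by apply: (frame_eq3 hx hy hw); rewrite ?(h x) ?(h y) ?(h w).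
Qed.

Lemma shaped_mobius_eq f A B : shaped T f -> \det A != 0 -> \det B != 0 ->
    eq_on T (fun w => mobius A (f w)) (fun w => mobius B (f w)) ->
  exists2 k, k != 0 & A = k *: B.
Proof.
move=> sf hA hB h; have [cAT cBT _ _] := corners_mem alpha T.
have neAB : cA T != cB alpha T by rewrite (cA_corner alpha) cB_corner (corner_eq hT).
have [F hF eF] := frame_of_shaped cAT cBT neAB sf.
have h' : eq_on T (fun w => mobius (A *m F) (frame (cA T) (cB alpha T) w))
                (fun w => mobius (B *m F) (frame (cA T) (cB alpha T) w)).
  by move=> w hw; rewrite !mobiusM // -eF // h.
have [k hk eAB] := frame_eq cAT cBT neAB (det_mul2 hA hF) (det_mul2 hB hF) h'.
exists k => //; rewrite -[LHS](mulmxK (unit2 hF)) eAB -scalemxAl mulmxK //.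
Qed.

End OneTet.

Lemma det_normalize (M : 'M[C]_2) : \det M != 0 ->
  exists A : 'M[C]_2, \det A = 1 /\ forall p, mobius A p = mobius M p.
Proof.
move=> hM; exists ((sqrtC (\det M))^-1 *: M); split.
  by rewrite detZ2 exprVn sqrtCK mulVf.
by move=> p; rewrite mobiusZ // invr_eq0 sqrtC_eq0.
Qed.

(** ** Gluings preserve frames *)

Lemma row_sign_Trans c x : row_sign (gmap (Trans c) x) = row_sign x.
Proof. by rewrite /row_sign /gmap mulr2n /=; congr (_ ^+ nat_of_bool _); lia. Qed.

Lemma row_sign_Rot c x : row_sign (gmap (Rot c) x) = row_sign x.
Proof. by rewrite /row_sign /gmap mulr2n /=; congr (_ ^+ nat_of_bool _); lia. Qed.

Lemma V_fr0 : V fr0 = 1.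
Proof. by rewrite /cusp_value (n_fr0 _ hN) (q_fr0 _ hQ) divr1. Qed.
Lemma V_fr1 : V fr1 = 1.
Proof. by rewrite /cusp_value (n_fr1 _ hN) (q_fr1 _ hQ) divr1. Qed.
Lemma V_fr12 : V fr12 = 1 - z.
Proof. by rewrite /cusp_value (n_fr12 _ hQ hN) (q_fr12 _ hQ) divr1. Qed.

(** The folding fixes P and P + (2, 1) and exchanges two edges at each of them,
    of slopes 0 and 1, where V takes the same value. At the vertex that moves
    from P + (1, 0) to P + (1, 1) both the turn and the sign change. *)
Lemma link_Fold (P x y w : lattice) : let t := [:: P; P + svec fr0; P + svec fr12] in
  x \in t -> y \in t -> w \in t -> y != x -> w != x ->
  link (gmap (Fold P) x) (gmap (Fold P) y) (gmap (Fold P) w) = link x y w.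
Proof.
have [[s01 s01' s02] [s12 s12']] := slope_Fold P.
have sg1 : row_sign (P + svec fr0) = row_sign P.
  by rewrite /row_sign /=; congr (_ ^+ nat_of_bool _); lia.
have sg1' : row_sign (P + svec fr1) = - row_sign P.
  have -> : - row_sign P = (-1) ^+ (~~ odd `|P.2|%N) by rewrite signrN.
  by rewrite /row_sign /=; congr (_ ^+ nat_of_bool _); lia.
move=> t; rewrite /t !inE.
case/or3P => /eqP ->; case/or3P => /eqP ->; case/or3P => /eqP ->.
all: rewrite ?Fold_0 ?Fold_1 ?Fold_1' ?Fold_2 ?eqxx ?link_id // /link => _ _.
all: rewrite ?(slopeC P (P + svec fr0)) ?(slopeC P (P + svec fr1)) ?(slopeC P (P + svec fr12)).
all: rewrite ?(slopeC (P + svec fr0) (P + svec fr12)) ?(slopeC (P + svec fr1) (P + svec fr12)).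
all: rewrite ?s01 ?s02 ?s12 ?s01' ?s02 ?s12' ?V_fr0 ?V_fr1 ?V_fr12 ?sg1 ?sg1'.
all: repeat first
  [ rewrite (_ : turn _ _ = 0); [|by rewrite /turn /svec /=; case: ifP; lia]
  | rewrite (_ : turn _ _ = 1); [|by rewrite /turn /svec /=; case: ifP; lia]
  | rewrite (_ : turn _ _ = -1); [|by rewrite /turn /svec /=; case: ifP; lia] ].
all: rewrite ?rmorphN ?rmorph1 ?rmorph0; move: (row_sign P) (row_sign (P + svec fr12)) => s s'; ring.
Qed.

(** Translations and rotations of Theta preserve slopes and parities, and half a
    turn exchanges the two half planes. For a folding of the triangle on the
    other side of its axis the inverse folding is used. *)
Lemma link_glue T g T' x y w : valid T -> valid T' ->
    glued T g T' x (gmap g x) -> glued T g T' y (gmap g y) -> glued T g T' w (gmap g w) ->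
    y != x -> w != x ->
  link (gmap g x) (gmap g y) (gmap g w) = link x y w.
Proof.
move=> hT hT' /gluedE[hx hx' dx _] /gluedE[hy hy' dy _] /gluedE[hw hw' dw _] nyx nwx.
case: g dx dy dw hx' hy' hw' => [c|c|P] dx dy dw hx' hy' hw'.
- by rewrite /link /slope !(gmap_diff c _ _).1 row_sign_Trans.
- have nxy : x != y by rewrite eq_sym.
  have nxw : x != w by rewrite eq_sym.
  rewrite /link /slope !(gmap_diff c _ _).2 row_sign_Rot turnN; last 2 first.
  + exact: (corner_fst_neq hT hx hy nxy).
  + exact: (corner_fst_neq hT hx hw nxw).
  have E (u : lattice) : ((`|(- u).2|%N, `|(- u).1|%N) = (`|u.2|%N, `|u.1|%N)).
    by rewrite /= !abszN.
  by rewrite !E.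
have [p [hp H]] := Fold_corners alpha P hT.
case: hp => ep; rewrite {}ep in H.
  by apply: (@link_Fold P); [apply: H|apply: H|apply: H| |].
have K u : u \in corners T -> gdom (Fold P) u ->
   gmap (Fold P) u \in [:: P; P + svec fr0; P + svec fr12].
  by move=> hu du; move: (H u hu du); rewrite !inE => /or3P[] /eqP ->;
    rewrite ?Fold_0 ?Fold_1 ?Fold_1' ?Fold_2 eqxx ?orbT.
have J := inj_eq (@gmap_inj (Fold P)).
by rewrite -(@link_Fold P) ?gmap_FoldK ?K ?J.
Qed.

Lemma swap_coef_glue T g T' x y : valid T -> valid T' ->
    glued T g T' x (gmap g x) -> glued T g T' y (gmap g y) -> x != y ->
  swap_coef (gmap g x) (gmap g y) = swap_coef x y.
Proof.
move=> hT hT' /gluedE[hx hx' dx _] /gluedE[hy hy' dy _] nxy.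
case: g dx dy hx' hy' => [c|c|P] dx dy hx' hy'.
- by rewrite /swap_coef /slope (gmap_diff c _ _).1.
- by rewrite /swap_coef /slope (gmap_diff c _ _).2 /= !abszN.
have K01 a b : slope a b = fr0 \/ slope a b = fr1 -> swap_coef a b = - z.
  by rewrite /swap_coef => -[] ->; rewrite ?(q_fr0 _ hQ) ?(q_fr1 _ hQ) expr1n divr1 expr1.
have [[s01 s01' s02] [s12 s12']] := slope_Fold P.
have [p [hp H]] := Fold_corners alpha P hT.
move: (H x hx dx) (H y hy dy) nxy; rewrite !inE.
by case: hp => -> /or3P[] /eqP -> /or3P[] /eqP ->; rewrite ?eqxx // ?Fold_0 ?Fold_1 ?Fold_1' ?Fold_2 // => _;
  rewrite !K01 //; rewrite ?(slopeC P (P + svec fr0)) ?(slopeC P (P + svec fr1))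
    ?(slopeC P (P + svec fr12)) ?(slopeC (P + svec fr0) (P + svec fr12))
    ?(slopeC (P + svec fr1) (P + svec fr12)) ?s01 ?s02 ?s01' ?s12 ?s12'; by [left | right].
Qed.

Lemma frame_glue T g T' x y w : valid T -> valid T' ->
    glued T g T' x (gmap g x) -> glued T g T' y (gmap g y) -> glued T g T' w (gmap g w) ->
    y != x -> frame (gmap g x) (gmap g y) (gmap g w) = frame x y w.
Proof.
move=> hT hT' hx hy hw nyx; rewrite /frame (inj_eq (@gmap_inj g)).
by case: eqP => // /eqP nwx; rewrite (link_glue hT hT' hx hy hw).
Qed.

(** * Transport along common edges *)

(** Laying the edge [x', y'] of T' on the edge [x, y] of T, so that a placement
    of T by f becomes the placement f' of T'. All B are allowed, so that no
    choice is hidden in the definition. *)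
Definition carry T f x y T' f' x' y' := forall B, \det B != 0 ->
  eq_on T f (fun w => mobius B (frame x y w)) ->
  eq_on T' f' (fun w => mobius B (frame x' y' w)).

Definition adjacent T f g T' f' := forall x y, x != y ->
  glued T g T' x (gmap g x) -> glued T g T' y (gmap g y) ->
  carry T f x y T' f' (gmap g x) (gmap g y).

Lemma carry_swap T f x y T' f' x' y' : valid T -> valid T' ->
    x \in corners T -> y \in corners T -> x != y ->
    x' \in corners T' -> y' \in corners T' -> x' != y' -> swap_coef x' y' = swap_coef x y ->
  carry T f x y T' f' x' y' -> carry T f y x T' f' y' x'.
Proof.
move=> hT hT' hx hy nxy hx' hy' nxy' ek H B hB e.
have hI : \det (invol (swap_coef x y)) != 0.
  by rewrite det_invol oppr_eq0 (swap_coef_neq0 hT).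
have {}e : eq_on T f (fun w => mobius (B *m invol (swap_coef x y)) (frame x y w)).
  by move=> w hw; rewrite e // (frame_swap hT hx hy nxy) // mobiusM.
move=> w hw; rewrite (H _ _ e) ?det_mul2 // mobiusM // -ek.
by rewrite (frame_swap hT' hx' hy' nxy').
Qed.

Lemma carry_turn T f x y w T' f' x' y' w' : valid T -> valid T' ->
    x \in corners T -> y \in corners T -> w \in corners T -> y != x -> w != x ->
    x' \in corners T' -> y' \in corners T' -> w' \in corners T' -> y' != x' -> w' != x' ->
    link x' y' w' = link x y w ->
  carry T f x y T' f' x' y' -> carry T f x w T' f' x' w'.
Proof.
move=> hT hT' hx hy hw nyx nwx hx' hy' hw' nyx' nwx' ep H B hB e.
have hI : \det (transl (- link x y w)) != 0 by rewrite det_transl oner_eq0.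
have {}e : eq_on T f (fun u => mobius (B *m transl (- link x y w)) (frame x y u)).
  by move=> u hu; rewrite e // (frame_turn hT hx hy hw nyx) // mobiusM.
move=> u hu; rewrite (H _ _ e) ?det_mul2 // mobiusM // -ep.
by rewrite (frame_turn hT' hx' hy' hw' nyx').
Qed.

(** The common edges of T and T' are linked by the coherence rules for frames,
    whose coefficients are invariant under the gluing; so transport through one
    of them is transport through all of them. *)
Lemma carry_glued T f g T' f' x y : valid T -> valid T' -> x != y ->
    glued T g T' x (gmap g x) -> glued T g T' y (gmap g y) ->
    carry T f x y T' f' (gmap g x) (gmap g y) ->
  adjacent T f g T' f'.
Proof.
move=> hT hT' nxy gx gy H.
have J := inj_eq (@gmap_inj g).
have turn_ u v w : u != v -> w != u -> glued T g T' u (gmap g u) ->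
    glued T g T' v (gmap g v) -> glued T g T' w (gmap g w) ->
    carry T f u v T' f' (gmap g u) (gmap g v) ->
    carry T f u w T' f' (gmap g u) (gmap g w).
  move=> nuv nwu gu gv gw; have nvu : v != u by rewrite eq_sym.
  have [cu cu' _ _] := gluedE gu; have [cv cv' _ _] := gluedE gv.
  have [cw cw' _ _] := gluedE gw.
  apply: carry_turn => //; rewrite ?J //.
  by apply: (link_glue hT hT' gu gv gw).
have swap_ u v : u != v -> glued T g T' u (gmap g u) -> glued T g T' v (gmap g v) ->
    carry T f u v T' f' (gmap g u) (gmap g v) ->
    carry T f v u T' f' (gmap g v) (gmap g u).
  move=> nuv gu gv.
  have [cu cu' _ _] := gluedE gu; have [cv cv' _ _] := gluedE gv.
  apply: carry_swap => //; rewrite ?J //.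
  exact: (swap_coef_glue hT hT' gu gv nuv).
move=> u v nuv gu gv.
case: (eqVneq u x) => [eu|nux].
  by move: nuv gu; rewrite {}eu => nxv gu; apply: (turn_ x y) => //; rewrite eq_sym.
have {}H : carry T f u x T' f' (gmap g u) (gmap g x).
  apply: swap_ => //; first by rewrite eq_sym.
  exact: (turn_ x y).
by apply: (turn_ u x) => //; rewrite eq_sym.
Qed.

Lemma adjacent_exists T f g T' : shaped T f -> step T g T' ->
  exists f', adjacent T f g T' f'.
Proof.
move=> sf hs; have [hT hT' _] := hs; have [x [y [nxy gx gy]]] := step_pair hs.
have [cx cx' _ _] := gluedE gx; have [cy cy' _ _] := gluedE gy.
have [B hB e] := frame_of_shaped hT cx cy nxy sf.
exists (fun w => mobius B (frame (gmap g x) (gmap g y) w)).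
apply: (carry_glued hT hT' nxy gx gy) => B' hB' e' w hw.
have [|k hk ->] := frame_eq hT cx cy nxy hB hB'.
  by move=> u hu; rewrite -e // e'.
by rewrite mobiusZ.
Qed.

Lemma adjacent_shaped T f g T' f' : shaped T f -> step T g T' -> adjacent T f g T' f' ->
  shaped T' f'.
Proof.
move=> sf hs H; have [hT hT' _] := hs; have [x [y [nxy gx gy]]] := step_pair hs.
have [cx cx' _ _] := gluedE gx; have [cy cy' _ _] := gluedE gy.
have [B hB e] := frame_of_shaped hT cx cy nxy sf.
apply: shaped_eq_on (H _ _ nxy gx gy B hB e) _; apply: shaped_mobius => //.
by apply: (shaped_frame hT'); rewrite // (inj_eq (@gmap_inj g)).
Qed.

Lemma adjacent_glue T f g T' f' w w' : shaped T f -> step T g T' -> adjacent T f g T' f' ->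
  glued T g T' w w' -> f' w' = f w.
Proof.
move=> sf hs H gw; have [cw cw' _ ew] := gluedE gw; rewrite {}ew in gw *.
have [hT hT' _] := hs; have [y nyw gy] := step_pair_at hs gw.
have nwy : w != y by rewrite eq_sym.
have [cy cy' _ _] := gluedE gy.
have [B hB e] := frame_of_shaped hT cw cy nwy sf.
by rewrite (H _ _ nwy gw gy B hB e) // e // !frame_oo.
Qed.

Lemma adjacent_mobius A T f1 f2 g T' f1' f2' : \det A != 0 ->
    eq_on T f2 (fun w => mobius A (f1 w)) -> eq_on T' f2' (fun w => mobius A (f1' w)) ->
  adjacent T f1 g T' f1' -> adjacent T f2 g T' f2'.
Proof.
move=> hA e e' H x y nxy gx gy B hB eB w hw.
have hA' := det_inv2 hA.
rewrite e' // (H x y nxy gx gy (invmx A *m B)) ?det_mul2 //.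
  by rewrite mobiusM // mobiusVK.
by move=> u hu; rewrite mobiusM // -eB // e // mobiusK.
Qed.

Lemma adjacent_unique T f g T' f1 f2 : shaped T f -> step T g T' ->
  adjacent T f g T' f1 -> adjacent T f g T' f2 -> eq_on T' f1 f2.
Proof.
move=> sf hs H1 H2 w hw; have [hT hT' _] := hs; have [x [y [nxy gx gy]]] := step_pair hs.
have [cx cx' _ _] := gluedE gx; have [cy cy' _ _] := gluedE gy.
have [B hB e] := frame_of_shaped hT cx cy nxy sf.
by rewrite (H1 _ _ nxy gx gy B hB e) // (H2 _ _ nxy gx gy B hB e).
Qed.

Lemma adjacent_sym T f g T' f' : shaped T f -> step T g T' ->
  adjacent T f g T' f' -> adjacent T' f' (ginv g) T f.
Proof.
move=> sf hs H; have [hT hT' _] := hs; have [x [y [nxy gx gy]]] := step_pair hs.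
have [cx cx' _ _] := gluedE gx; have [cy cy' _ _] := gluedE gy.
have [B hB e] := frame_of_shaped hT cx cy nxy sf.
have e' := H _ _ nxy gx gy B hB e.
have nxy' : gmap g x != gmap g y by rewrite (inj_eq (@gmap_inj g)).
have [ix iy] : glued T' (ginv g) T (gmap g x) (gmap (ginv g) (gmap g x)) /\
               glued T' (ginv g) T (gmap g y) (gmap (ginv g) (gmap g y)).
  by rewrite !gmapK !glued_sym.
apply: (carry_glued hT' hT nxy' ix iy) => B' hB' eB'; rewrite !gmapK.
have [|k hk ->] := frame_eq hT' cx' cy' nxy' hB' hB.
  by move=> u hu; rewrite -eB' // e'.
by move=> w hw; rewrite e // mobiusZ.
Qed.

(** ** Families that follow the transport *)

Section BasePoint.
Variable T0 : tet.
Hypothesis hT0 : valid T0.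

(** This local condition turns out to characterise the developing maps. *)
Definition rigid (D : dpath -> lattice -> CP1) :=
  shaped T0 (D [::]) /\
  forall p T g T', is_path T0 p T -> step T g T' ->
    adjacent T (D p) g T' (D (rcons p (g, T'))).

Section RigidFamily.
Variable D : dpath -> lattice -> CP1.
Hypothesis hD : rigid D.

Lemma rigid_shaped p T : is_path T0 p T -> shaped T (D p).
Proof.
elim/last_ind: p T => [|p [g T1] IH] T; first by move=> /= <-; case: hD.
move=> /is_path_rcons[T2 h [hs <-]]; have [_ H] := hD.
exact: adjacent_shaped (IH _ h) hs (H _ _ _ _ h hs).
Qed.

Lemma rigid_equiv A p p' T r T' : \det A != 0 -> is_path T0 p T -> is_path T0 p' T ->
    is_path T r T' -> eq_on T (D p') (fun w => mobius A (D p w)) ->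
  eq_on T' (D (p' ++ r)) (fun w => mobius A (D (p ++ r) w)).
Proof.
move=> hA hp hp' hr e; have [_ H] := hD.
elim/last_ind: r T' hr => [|r [g T1] IH] T'; first by move=> /= <-; rewrite !cats0.
move=> /is_path_rcons[T2 h [hs <-]]; rewrite -!rcons_cat.
have h1 : is_path T0 (p ++ r) T2 by apply/is_path_cat; exists T.
have h2 : is_path T0 (p' ++ r) T2 by apply/is_path_cat; exists T.
apply: (adjacent_unique (rigid_shaped h2) hs (H _ _ _ _ h2 hs)).
exact: adjacent_mobius (IH _ h) _ (H _ _ _ _ h1 hs).
Qed.

Lemma rigid_carry p T r T' x y x' y' : is_path T0 p T -> is_path T r T' ->
    tracks T x r x' -> tracks T y r y' -> x != y ->
  carry T (D p) x y T' (D (p ++ r)) x' y'.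
Proof.
have [_ H] := hD.
elim: r p T x y => [|[g T1] r IH] p T x y hp /=.
  by move=> <- <- <- _; rewrite cats0 => B.
case=> hs hr [gx hx] [gy hy] nxy B hB e.
rewrite -cat_rcons; apply: (IH _ T1 (gmap g x) (gmap g y)) => //.
- by apply/is_path_rcons; exists T.
- by rewrite (inj_eq (@gmap_inj g)).
exact: H e.
Qed.

(** Transport along a path that stays at an edge depends only on the ends of the
    path. *)
Lemma rigid_edge_loop p T q : is_path T0 p T -> edge_loop alpha n T q ->
  eq_on T (D (p ++ q)) (D p).
Proof.
move=> hp [hq [x [y [hx hy nxy tx ty]]]] w hw.
have hT := is_path_valid hp hT0.
have [B hB e] := frame_of_shaped hT hx hy nxy (rigid_shaped hp).
by rewrite (rigid_carry hp hq tx ty nxy hB e) // e.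
Qed.

Lemma rigid_homotopic p q : homotopic alpha n T0 p q -> forall T,
  (is_path T0 p T <-> is_path T0 q T) /\ (is_path T0 p T -> eq_on T (D p) (D q)).
Proof.
elim=> {p q} [p|p q _ IH|p q r _ IH1 _ IH2|p q r T T' hp hq hr] T1.
- by split.
- have [h1 h2] := IH T1; split; first by split=> /h1.
  by move=> /h1 h w hw; rewrite h2.
- have [h1 h2] := IH1 T1; have [h3 h4] := IH2 T1.
  split; first by rewrite h1 h3.
  by move=> h w hw; rewrite h2 // h4 //; apply/h1.
have [hq1 _] := hq.
have hpr : is_path T0 (p ++ r) T' by apply/is_path_cat; exists T.
have hpq : is_path T0 (p ++ q) T by apply/is_path_cat; exists T.
have hpqr : is_path T0 (p ++ q ++ r) T'.
  by rewrite catA; apply/is_path_cat; exists T.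
split; first by split=> h; [rewrite (is_path_end h hpr)|rewrite (is_path_end h hpqr)].
move=> h; rewrite (is_path_end h hpr) catA => w hw.
rewrite (rigid_equiv (A := 1%:M) (p := p) (T := T) _ hp hpq hr _ hw).
- by rewrite mobius1.
- by rewrite det1 oner_eq0.
by move=> u hu; rewrite (rigid_edge_loop hp hq) // mobius1.
Qed.

(** Around an ideal vertex the frames change by translations only; the moves are
    parabolic. *)
Lemma rigid_vertex p T q T' x x' y B : is_path T0 p T -> is_path T q T' ->
    x \in corners T -> y \in corners T -> y != x -> tracks T x q x' -> \det B != 0 ->
    eq_on T (D p) (fun w => mobius B (frame x y w)) ->
  forall y', y' \in corners T' -> y' != x' ->
  exists t, eq_on T' (D (p ++ q)) (fun w => mobius (B *m transl t) (frame x' y' w)).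
Proof.
have [_ H] := hD.
have turn_ T1 f u v v' B1 : valid T1 -> u \in corners T1 -> v \in corners T1 -> v' \in corners T1 ->
    v != u -> v' != u -> \det B1 != 0 -> eq_on T1 f (fun w => mobius B1 (frame u v w)) ->
    exists t, eq_on T1 f (fun w => mobius (B1 *m transl t) (frame u v' w)).
  move=> hT1 hu hv hv' nv nv' hB e; exists (- link u v' v) => w hw.
  have hI t : \det (transl t : 'M[C]_2) != 0 by rewrite det_transl oner_eq0.
  rewrite e // mobiusM // -(frame_turn hT1 hu hv' hv) //.
elim: q p T x y B => [|[g T1] q IH] p T x y B hp /=.
  move=> <- hx hy nyx <- hB e y' hy' ny'; rewrite cats0.
  by apply: turn_ e => //; apply: is_path_valid hp hT0.
case=> hs hq hx hy nyx [gx tx] hB e y' hy' ny'.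
have [hT hT1 _] := hs; have [v nvx gv] := step_pair_at hs gx.
have nxv : x != v by rewrite eq_sym.
have [cx cx' _ _] := gluedE gx; have [cv cv' _ _] := gluedE gv.
have [t et] := turn_ _ _ _ _ _ _ hT hx hy cv nyx nvx hB e.
have hI s : \det (transl s : 'M[C]_2) != 0 by rewrite det_transl oner_eq0.
have e1 := H _ _ _ _ hp hs x v nxv gx gv _ (det_mul2 hB (hI t)) et.
have hp1 : is_path T0 (rcons p (g, T1)) T1 by apply/is_path_rcons; exists T.
have nv' : gmap g v != gmap g x by rewrite (inj_eq (@gmap_inj g)).
have [s es] := IH _ _ _ _ _ hp1 hq cx' cv' nv' tx (det_mul2 hB (hI t)) e1 _ hy' ny'.
exists (t + s); rewrite -cat_rcons => w hw; rewrite es //.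
by rewrite -mulmxA transl_mul.
Qed.

End RigidFamily.

(** ** Existence *)

(** The transported placement, chosen among functions that agree on the corners
    of T'. *)
Definition transport T f g T' : lattice -> CP1 :=
  if pselect (exists f', adjacent T f g T' f') is left h then projT1 (cid h) else f.

Lemma adjacent_transport T f g T' : shaped T f -> step T g T' -> adjacent T f g T' (transport T f g T').
Proof.
move=> sf hs; rewrite /transport; case: pselect => [h|]; first exact: (projT2 (cid h)).
by case; apply: adjacent_exists.
Qed.

Fixpoint devel T f (p : dpath) : lattice -> CP1 :=
  if p is (g, T1) :: p1 then devel T1 (transport T f g T1) p1 else f.

Lemma devel_rcons T f p g T1 T' : is_path T p T' ->
  devel T f (rcons p (g, T1)) = transport T' (devel T f p) g T1.
Proof.
elim: p T f => [|[g2 T2] p IH] T f /=; first by move=> ->.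
by case=> _ h; rewrite (IH _ _ h).
Qed.

Lemma devel_shaped f p T : shaped T0 f -> is_path T0 p T -> shaped T (devel T0 f p).
Proof.
move=> sf; elim/last_ind: p T => [|p [g T1] IH] T; first by move=> /= <-.
move=> /is_path_rcons[T2 h [hs <-]]; rewrite (devel_rcons _ _ _ h).
exact: adjacent_shaped (IH _ h) hs (adjacent_transport (IH _ h) hs).
Qed.

Lemma devel_rigid f : shaped T0 f -> rigid (devel T0 f).
Proof.
move=> sf; split=> // p T g T' hp hs; rewrite (devel_rcons _ _ _ hp).
by apply: adjacent_transport => //; apply: devel_shaped.
Qed.

(** Homotopies are generated by edge loops, a loop moves the whole family by the
    isometry that moves its first member ([rigid_equiv]), and a loop in the link
    of a vertex acts by a translation ([rigid_vertex]). *)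
Lemma rigid_developing D : rigid D ->
    label_preserving alpha Q N z (funnel alpha 1) T0 (D [::]) ->
  developing alpha n Q N z T0 D.
Proof.
move=> hD hb; have [_ H] := hD; split=> //.
- by move=> p T; apply: rigid_shaped.
- move=> p T g T' hp hs w w'; apply: (adjacent_glue (rigid_shaped hD hp) hs).
  exact: H.
- by move=> p q T hp hpq; apply: (rigid_homotopic hD hpq T).2.
- move=> l hl.
  have [M hM e] := shaped_equiv hT0 (rigid_shaped hD (p := [::]) erefl) (rigid_shaped hD hl).
  have [A [hA eA]] := det_normalize hM.
  exists A; split=> // p T hp; split=> //.
  apply: (rigid_equiv hD (p := [::])) hp _ => //; first by rewrite hA oner_eq0.
  by move=> w hw; rewrite eA e.
- move=> p T q A hp [hq [x hx tx]] [hA e].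
  have hT := is_path_valid hp hT0.
  have [y [hy nyx _]] := third_corner hT hx hx.
  have nxy : x != y by rewrite eq_sym.
  have [B hB eB] := frame_of_shaped hT hx hy nxy (rigid_shaped hD hp).
  have [t et] := rigid_vertex hD hp hq hx hy nyx tx hB eB hy nyx.
  have hI : \det (transl t : 'M[C]_2) != 0 by rewrite det_transl oner_eq0.
  have hA0 : \det A != 0 by rewrite hA oner_eq0.
  have [|k hk eAB] := frame_eq hT hx hy nxy (det_mul2 hA0 hB) (det_mul2 hB hI).
    by move=> w hw; rewrite mobiusM // -eB // -e // et.
  have {}eAB : A = k *: (B *m transl t *m invmx B).
    by rewrite -[LHS](mulmxK (unit2 hB)) eAB -scalemxAl.
  have := hA; rewrite eAB detZ2 !det_mulmx det_transl mulr1 -det_mulmx mulmxV ?unit2 //.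
  rewrite det1 mulr1 => hk2.
  rewrite mxtraceZ mxtrace_mulC mulmxA mulVmx ?unit2 // mul1mx tr2 !mx2E.
  rewrite exprMn hk2 mul1r; ring.
Qed.

End BasePoint.

(** ** Cusp frames *)

Definition cusp_mx x y : 'M[C]_2 := mx2 (row_sign x) (V (slope x y)) 0 1.
(** Here the finite corners are at values of V shifted by integers, as in the
    tetrahedra delta(e) and delta'(e). *)
Definition cusp_frame x y w := mobius (cusp_mx x y) (frame x y w).

Lemma row_sign_neq0 x : row_sign x != 0.
Proof. by rewrite /row_sign signr_eq0. Qed.

Lemma det_cusp_mx x y : \det (cusp_mx x y) != 0.
Proof. by rewrite det_mx2 mulr1 mulr0 subr0 row_sign_neq0. Qed.

Lemma cusp_frame_oo x y : cusp_frame x y x = None.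
Proof. by rewrite /cusp_frame frame_oo mobius_upper_oo. Qed.

Lemma cusp_frame_Some x y w : w != x -> cusp_frame x y w = Some (row_sign x * link x y w + V (slope x y)).
Proof. by move=> h; rewrite /cusp_frame frame_Some // mobius_upper ?oner_eq0 // divr1. Qed.

Lemma cusp_frame_corner e v a b a1 b1 a2 b2 : farey_local Q N z e ->
    (a1, b1) != (a, b) -> (a2, b2) != (a, b) ->
    corner e v a2 b2 != corner e v a b ->
  cusp_frame (corner e v a b) (corner e v a1 b1) (corner e v a2 b2) =
  Some (lift_value e a b a2 b2 - lift_value e a b a1 b1 + V (slope (corner e v a b) (corner e v a1 b1))).
Proof.
move=> he h1 h2 h3; rewrite cusp_frame_Some // link_corner // mulrA row_sign_sqr mul1r //.
Qed.

Lemma shaped_cusp_frame T x y : valid T -> x \in corners T -> y \in corners T -> x != y ->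
  shaped T (cusp_frame x y).
Proof.
move=> hT hx hy nxy; apply: (shaped_mobius (det_cusp_mx x y)).
exact: (shaped_frame hT).
Qed.

Section Delta.
Variable T : tet.
Hypothesis hT : valid T.
Local Notation e := (funnel alpha T.1).

Lemma calV_cusp_value s : evalz z (Q s) != 0 -> calV Q N z s = Some (V s).
Proof. by rewrite /calV /of_hom => /negbTE ->. Qed.

Lemma delta_LE : delta_L Q N z e = Some (V e.1 - 1).
Proof.
have [hL _ _ _ _] := valid_nondeg hT.
by rewrite /delta_L calV_cusp_value //= addrC.
Qed.

Lemma delta_RE : delta_R Q N z e = Some (V e.2).
Proof.
have [_ hS _ _ _] := valid_nondeg hT.
by rewrite /delta_R calV_cusp_value.
Qed.

Lemma delta_hatE : delta_hat Q N z e = Some (V (ehat e) - (e.2.2 < e.1.2)%N%:R).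
Proof.
have [_ _ _ hh _] := valid_nondeg hT.
have hne := hat_position_neq (valid_hat alpha hT).
rewrite /delta_hat calV_cusp_value //= addrC; congr (Some (_ + _)).
rewrite /enu /eminus; case: ltnP => h; first by rewrite eqxx ltnNge (ltnW h) /= oppr0.
have -> : (e.2 == e.1) = false by apply: contraNF hne => /eqP ->.
have -> // : (e.2.2 < e.1.2)%N = true by rewrite ltn_neqAle eq_sym hne h.
Qed.

(** Both ends of the top edge see delta(e) ([cusp_frame_CA]): the rotation of
    order two that exchanges them preserves all labels. *)
Lemma cusp_frame_BD :
  [/\ cusp_frame (cB alpha T) (cD alpha T) (cA T) = delta_L Q N z e,
      cusp_frame (cB alpha T) (cD alpha T) (cB alpha T) = None,
      cusp_frame (cB alpha T) (cD alpha T) (cC alpha T) = delta_hat Q N z e &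
      cusp_frame (cB alpha T) (cD alpha T) (cD alpha T) = delta_R Q N z e].
Proof.
have he := valid_local hT; have fe := valid_edge alpha hT; have hp := valid_hat alpha hT.
rewrite delta_LE delta_RE delta_hatE (cA_corner alpha) cB_corner cC_corner cD_corner.
rewrite cusp_frame_oo !cusp_frame_corner // ?(corner_eq hT) // (slope_corner _ _ _ _ _ fe hp) /lift_value /=.
by split=> //; congr Some; ring.
Qed.

Lemma cusp_frame_CA :
  [/\ cusp_frame (cC alpha T) (cA T) (cD alpha T) = delta_L Q N z e,
      cusp_frame (cC alpha T) (cA T) (cC alpha T) = None,
      cusp_frame (cC alpha T) (cA T) (cB alpha T) = delta_hat Q N z e &
      cusp_frame (cC alpha T) (cA T) (cA T) = delta_R Q N z e].
Proof.
have he := valid_local hT; have fe := valid_edge alpha hT; have hp := valid_hat alpha hT.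
rewrite delta_LE delta_RE delta_hatE (cA_corner alpha) cB_corner cC_corner cD_corner.
rewrite cusp_frame_oo !cusp_frame_corner // ?(corner_eq hT) // (slope_corner _ _ _ _ _ fe hp) /lift_value /=.
by split=> //; congr Some; ring.
Qed.

Lemma label_preserving_cusp_frame :
  label_preserving alpha Q N z e T (cusp_frame (cB alpha T) (cD alpha T)).
Proof.
have he := valid_local hT; have fe := valid_edge alpha hT; have hp := valid_hat alpha hT.
have [eA eB eC eD] := cusp_frame_BD.
move=> x y /cornersP[a [b ex]] /cornersP[a' [b' ey]].
have E a1 b1 : cusp_frame (cB alpha T) (cD alpha T) (corner e T.2 a1 b1) =
    if a1 then (if b1 then delta_R Q N z e else None)
    else (if b1 then delta_hat Q N z e else delta_L Q N z e).
  by case: a1; case: b1;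
    rewrite -?(cA_corner alpha T) -?(cB_corner alpha T) -?(cC_corner alpha T) -?(cD_corner alpha T).
rewrite ex ey !E (corner_eq hT) (slope_corner _ _ _ _ _ fe hp) {E eA eB eC eD}.
case: a {ex}; case: b; case: a' {ey}; case: b' => //= _; rewrite /delta_edges !inE.
all: solve [by left; rewrite eqxx ?orbT | by right; rewrite eqxx ?orbT].
Qed.

End Delta.

Section Base.
Variable v : lattice.
Hypotheses (ha : alpha < 1 / 2%:R) (hn : (0 < n)%N).
Local Notation T := (1%N, v).

(** The labels 1/3 and 1 occur on one edge each, so their ends are kept or
    exchanged; the edges labeled 0 show that both pairs are exchanged together.
    The vertices of delta(e_1) are distinct since z != 0, 1. *)
Lemma label_preserving_cases f :
    label_preserving alpha Q N z (funnel alpha 1) T f ->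
  eq_on T f (cusp_frame (cB alpha T) (cD alpha T)) \/ eq_on T f (cusp_frame (cC alpha T) (cA T)).
Proof.
have hT := valid1 hn v; have e1 := funnel1 ha.
have [dL [dR dh]] : delta_L Q N z (funnel alpha 1) = _ /\ delta_R Q N z (funnel alpha 1) = _ /\
    delta_hat Q N z (funnel alpha 1) = _ := conj (delta_LE hT) (conj (delta_RE hT) (delta_hatE hT)).
move: dL dR dh; rewrite e1 /= => dL dR dh.
have [eA eB eC eD] := cusp_frame_BD hT; have [fD fC fB fA] := cusp_frame_CA hT.
have hL : delta_L Q N z (fr0, fr12) = Some 0.
  by rewrite dL V_fr0 // subrr.
have hR : delta_R Q N z (fr0, fr12) = Some (1 - z) by rewrite dR V_fr12.
have hh : delta_hat Q N z (fr0, fr12) = Some 1.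
  by rewrite dh V_fr1 // subr0.
have [z0 z1] : z != 0 /\ z != 1 by case: hz => /Im_pos_neq.
have [cA_ cB_ cC_ cD_] := corners_mem alpha T.
have he := valid_local hT; have fe := valid_edge alpha hT; have hp := valid_hat alpha hT.
move=> H.
have P a b a' b' : (a, b) != (a', b') ->
  let x := corner (funnel alpha 1) v a b in let y := corner (funnel alpha 1) v a' b' in
  (f x, f y, slope x y) \in delta_edges Q N z (fr0, fr12) \/
  (f y, f x, slope x y) \in delta_edges Q N z (fr0, fr12).
  move=> h x y; apply: H; last by rewrite /x /y (corner_eq hT).
    by apply/cornersP; exists a, b.
  by apply/cornersP; exists a', b'.
have PBC := P true false false true isT.
have PAD := P false false true true isT.
have PAB := P false false true false isT.
have PCD := P false true true true isT.
move: PBC PAD PAB PCD; rewrite /= !(slope_corner _ _ _ _ _ fe hp) //= e1 /=.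
have LA := cA_corner alpha T; have LB := cB_corner alpha T.
have LC := cC_corner alpha T; have LD := cD_corner alpha T.
rewrite /= e1 in LA LB LC LD; rewrite -LA -LB -LC -LD.
rewrite /delta_edges hL hR hh !inE !xpair_eqE /= ?andbF ?andbT ?orbF.
have o1 : (Some 1 == Some (1 - z) :> CP1) = false.
  by apply/negP => /eqP[] /eqP; rewrite -subr_eq0 opprB addrC subrK (negbTE z0).
have o2 : (Some 0 == Some (1 - z) :> CP1) = false.
  by apply/negP => /eqP[] /esym/eqP; rewrite subr_eq0 eq_sym (negbTE z1).
have o3 : (Some 1 == Some 0 :> CP1) = false by apply/negP => /eqP[] /eqP; rewrite oner_eq0.
case=> /andP[/eqP eB1 /eqP eC1].
  rewrite eB1 eC1 o1 o3 /= !andbF ?andbT ?orbF => PAD PAB _; right.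
  have {PAB}vA : f v = Some (1 - z) by case: PAB => //=; rewrite ?eqxx /= ?orbF => /eqP.
  have vD : f (cD alpha T) = Some 0.
    by case: PAD => /andP[/eqP h1 /eqP h2] //; move: vA; rewrite h1 => /eqP; rewrite o2.
  move=> w; rewrite /Defs.corners !inE => /or4P[] /eqP ->.
  - by rewrite vA fA /= e1 hR.
  - by rewrite eB1 fB /= e1 hh.
  - by rewrite eC1 fC.
  - by rewrite vD fD /= e1 hL.
rewrite eB1 eC1 /= !andbF ?andbT ?orbF => PAD PAB _; left.
have {PAB}vA : f v = Some 0 by case: PAB => //=; rewrite ?eqxx /= ?orbF => /eqP.
have vD : f (cD alpha T) = Some (1 - z).
  by case: PAD => /andP[/eqP h1 /eqP h2] //; move: vA; rewrite h2 => /esym/eqP; rewrite o2.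
move=> w; rewrite /Defs.corners !inE => /or4P[] /eqP ->.
- by rewrite vA eA /= e1 hL.
- by rewrite eC1 eB.
- by rewrite eB1 eC /= e1 hh.
- by rewrite vD eD /= e1 hR.
Qed.

End Base.

(** * Developing maps follow the transport *)

Section Rigidity.
Variables (T0 : tet) (D : dpath -> lattice -> CP1).
Hypotheses (hT0 : valid T0) (hD : developing alpha n Q N z T0 D).
Hypotheses (ha : alpha < 1 / 2%:R) (hn : (0 < n)%N).

Lemma dev_shaped p T : is_path T0 p T -> shaped T (D p).
Proof. by move=> hp; apply: (dev_shape hD). Qed.

(** Three common vertices determine the placement of the next tetrahedron. *)
Lemma face_adjacent p T g T' x y w : is_path T0 p T -> step T g T' ->
    glued T g T' x (gmap g x) -> glued T g T' y (gmap g y) -> glued T g T' w (gmap g w) ->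
    x != y -> w != x -> w != y ->
  adjacent T (D p) g T' (D (rcons p (g, T'))).
Proof.
move=> hp hs gx gy gw nxy nwx nwy; have [hT hT' _] := hs.
have [cx cx' _ _] := gluedE gx; have [cy cy' _ _] := gluedE gy; have [cw cw' _ _] := gluedE gw.
have hp' : is_path T0 (rcons p (g, T')) T' by apply/is_path_rcons; exists T.
have J := inj_eq (@gmap_inj g).
have nxy' : gmap g x != gmap g y by rewrite J.
have [B' hB' e'] := frame_of_shaped hT' cx' cy' nxy' (dev_shaped hp').
apply: (carry_glued hT hT' nxy gx gy) => B hB e.
have nyx : y != x by rewrite eq_sym.
have K u : u \in corners T -> glued T g T' u (gmap g u) ->
    mobius B' (frame (gmap g x) (gmap g y) (gmap g u)) =
    mobius B (frame (gmap g x) (gmap g y) (gmap g u)).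
  move=> hu gu; rewrite -e' ?(dev_glue hD hp hs gu); last by case: (gluedE gu).
  by rewrite e // (frame_glue hT hT' gx gy gu).
have [||k hk eB] := frame_eq3 hT' cx' cy' cw' nxy' _ _ hB' hB (K x cx gx) (K y cy gy) (K w cw gw).
- by rewrite J.
- by rewrite J.
by move=> u hu; rewrite e' // eB mobiusZ.
Qed.

(** Two paths that carry the edge in the same way differ by loops in the star of
    an edge, along which a developing map returns to itself. *)
Lemma dev_path_indep T c1 c2 T' x y x' y' p : is_path T0 p T ->
    x \in corners T -> y \in corners T -> x != y ->
    is_path T c1 T' -> tracks T x c1 x' -> tracks T y c1 y' ->
    is_path T c2 T' -> tracks T x c2 x' -> tracks T y c2 y' ->
  eq_on T' (D (p ++ c1)) (D (p ++ c2)).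
Proof.
move=> hp hx hy nxy h1 x1 y1 h2 x2 y2.
have loop1 : edge_loop alpha n T (c1 ++ revp T c1).
  split; first by apply/is_path_cat; exists T' => //; apply: is_path_rev.
  exists x, y; split=> //.
    exact: tracks_cat h1 x1 (tracks_rev h1 x1).
  exact: tracks_cat h1 y1 (tracks_rev h1 y1).
have loop2 : edge_loop alpha n T' (revp T c1 ++ c2).
  split; first by apply/is_path_cat; exists T => //; apply: is_path_rev.
  exists x', y'; split.
  - exact: tracks_corner h1 hx x1.
  - exact: tracks_corner h1 hy y1.
  - exact: tracks_inj x1 y1 nxy.
  - exact: tracks_cat (is_path_rev h1) (tracks_rev h1 x1) x2.
  exact: tracks_cat (is_path_rev h1) (tracks_rev h1 y1) y2.
have hp1 : is_path T0 (p ++ c1) T' by apply/is_path_cat; exists T.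
have hp2 : is_path T0 (p ++ c2) T' by apply/is_path_cat; exists T.
have E1 := dev_homotopy hD hp2 (htp_edge hp loop1 h2).
have hh := @htp_edge alpha n T0 (p ++ c1) (revp T c1 ++ c2) [::] T' T' hp1 loop2 erefl.
rewrite !cats0 in hh; have E2 := dev_homotopy hD hp1 hh.
by move=> w hw; rewrite E1 // E2 // -!catA.
Qed.

(** The edge [x, y] of T reaches [x', y'] in T' by a path along which D follows
    the transport. By [dev_path_indep] every other path that carries the edge
    in this way then gives the same result. *)
Definition linked T x y T' x' y' := exists c,
  [/\ is_path T c T', tracks T x c x', tracks T y c y' &
   forall p, is_path T0 p T -> carry T (D p) x y T' (D (p ++ c)) x' y'].

Lemma linked_refl T x y : linked T x y T x y.
Proof. by exists [::]; split=> // p hp B hB; rewrite cats0. Qed.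

Lemma linked_trans T x y T1 x1 y1 T2 x2 y2 : linked T x y T1 x1 y1 ->
  linked T1 x1 y1 T2 x2 y2 -> linked T x y T2 x2 y2.
Proof.
move=> [c [h1 h2 h3 h4]] [c' [k1 k2 k3 k4]]; exists (c ++ c'); split.
- by apply/is_path_cat; exists T1.
- exact: tracks_cat h1 h2 k2.
- exact: tracks_cat h1 h3 k3.
move=> p hp B hB e; rewrite catA; apply: k4 => //; last exact: h4.
by apply/is_path_cat; exists T.
Qed.

Lemma linked_sym T x y T' x' y' : valid T -> x \in corners T -> y \in corners T -> x != y ->
  linked T x y T' x' y' -> linked T' x' y' T x y.
Proof.
move=> hT hx hy nxy [c [h1 h2 h3 h4]]; exists (revp T c); split.
- exact: is_path_rev.
- exact: tracks_rev h1 h2.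
- exact: tracks_rev h1 h3.
move=> p hp B hB e.
have hT' := is_path_valid h1 hT.
have hx' := tracks_corner h1 hx h2; have hy' := tracks_corner h1 hy h3.
have nxy' := tracks_inj h2 h3 nxy.
have hp' : is_path T0 (p ++ revp T c) T.
  by apply/is_path_cat; exists T' => //; apply: is_path_rev.
have [B' hB' e'] := frame_of_shaped hT hx hy nxy (dev_shaped hp').
have e2 := h4 _ hp' B' hB' e'.
have e3 : eq_on T' (D ((p ++ revp T c) ++ c)) (D p).
  have := @dev_path_indep T' (revp T c ++ c) [::] T' x' y' x' y' p hp hx' hy' nxy'.
  rewrite catA cats0; apply=> //.
  - by apply/is_path_cat; exists T => //; apply: is_path_rev.
  - exact: tracks_cat (is_path_rev h1) (tracks_rev h1 h2) h2.
  - exact: tracks_cat (is_path_rev h1) (tracks_rev h1 h3) h3.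
have [|k hk eB] := frame_eq hT' hx' hy' nxy' hB hB'.
  by move=> w hw; rewrite -e // -e2 // e3.
by move=> w hw; rewrite eB mobiusZ // e'.
Qed.

Lemma swap_coef_tracks T x y c T' x' y' : x != y -> is_path T c T' -> tracks T x c x' ->
  tracks T y c y' -> swap_coef x' y' = swap_coef x y.
Proof.
elim: c T x y => [|[g T1] c IH] T x y nxy /=; first by move=> _ <- <-.
case=> hs h [gx hx] [gy hy]; have [hT hT1 _] := hs.
rewrite (IH _ _ _ _ h hx hy) ?(inj_eq (@gmap_inj g)) //.
exact: (swap_coef_glue hT hT1 gx gy nxy).
Qed.

Lemma linked_swap T x y T' x' y' : valid T -> x \in corners T -> y \in corners T -> x != y ->
  linked T x y T' x' y' -> linked T y x T' y' x'.
Proof.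
move=> hT hx hy nxy [c [h1 h2 h3 h4]]; exists c; split=> // p hp.
have hT' := is_path_valid h1 hT.
apply: (carry_swap hT hT') => //; last exact: h4.
- exact: tracks_corner h1 hx h2.
- exact: tracks_corner h1 hy h3.
- exact: tracks_inj h2 h3 nxy.
exact: swap_coef_tracks h1 h2 h3.
Qed.

Lemma linked_face T g T' x y w : valid T -> valid T' ->
    glued T g T' x (gmap g x) -> glued T g T' y (gmap g y) -> glued T g T' w (gmap g w) ->
    x != y -> w != x -> w != y ->
  linked T x y T' (gmap g x) (gmap g y).
Proof.
move=> hT hT' gx gy gw nxy nwx nwy; exists [:: (g, T')].
have hs : step T g T' by split=> //; exists x, y, (gmap g x), (gmap g y).
split=> //= p hp; rewrite cats1.
exact: (face_adjacent hp hs gx gy gw nxy nwx nwy nxy gx gy).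
Qed.

Lemma linked_stack T T' x y w : valid T -> valid T' ->
    x \in corners T -> y \in corners T -> w \in corners T ->
    x \in corners T' -> y \in corners T' -> w \in corners T' ->
    x != y -> w != x -> w != y ->
  linked T x y T' x y.
Proof.
move=> hT hT' hx hy hw hx' hy' hw' nxy nwx nwy.
have := @linked_face T (Trans 0) T' x y w hT hT'; rewrite !gmap_Trans0; apply=> //.
- by have := glued_Trans0 hx hx'; rewrite gmap_Trans0.
- by have := glued_Trans0 hy hy'; rewrite gmap_Trans0.
by have := glued_Trans0 hw hw'; rewrite gmap_Trans0.
Qed.

(** The path of one step and the path that witnesses linkedness carry the edge
    in the same way. *)
Lemma linked_rigid : (forall T g T' x y, step T g T' -> x != y ->
    glued T g T' x (gmap g x) -> glued T g T' y (gmap g y) ->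
    linked T x y T' (gmap g x) (gmap g y)) -> rigid T0 D.
Proof.
move=> H; split; first exact: dev_shaped.
move=> p T g T' hp hs x y nxy gx gy B hB e.
have [c [h1 h2 h3 h4]] := H _ _ _ _ _ hs nxy gx gy.
have [cx _ _ _] := gluedE gx; have [cy _ _ _] := gluedE gy.
have E := @dev_path_indep T [:: (g, T')] c T' x y (gmap g x) (gmap g y) p hp cx cy nxy.
by move=> w hw; rewrite -cats1 (E (conj hs erefl) (conj gx erefl) (conj gy erefl) h1 h2 h3 w hw) (h4 p hp B hB e w hw).
Qed.

(** The two tetrahedra lie on the two sides of the edge of slope 0 from
    X - (1, 0) to X, and crossing it leaves a ratio undetermined. The loop
    around X that crosses the edge and returns by the rotation about X and a
    folding multiplies positions by this ratio, up to a translation; being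
    parabolic, it forces the ratio to be 1. *)
Lemma linked_slope0 X : linked (1%N, X - svec fr0) X (X - svec fr0)
                             (1%N, X - (3, 1)) X (X - svec fr0).
Proof.
set T := (1%N, X - svec fr0); set T' := (1%N, X - (3, 1)); set T1 := (1%N, X).
set x := X - svec fr0.
have hT : valid T by apply: valid1. 
have hT' : valid T' by apply: valid1.
have hT1 : valid T1 by apply: valid1.
have [gX gx hs] := cross0 ha hn X; rewrite -/T -/T' -/x in gX gx hs.
have hs2 : step T' (Rot X) T1.
  by have := step_rot ha hn X (X - (3, 1)); rewrite rot_target.
have hs3 : step T1 (Fold X) T by apply: (step_fold ha hn).
have [cX cX' _ _] := gluedE gX; have [cx cx' _ _] := gluedE gx.
rewrite gmap_Trans0 in cX'; rewrite gmap_Trans0 in cx'.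
have nXx : X != x by rewrite /x; lattice_neq.
have nxX : x != X by rewrite eq_sym.
exists [:: (Trans 0, T')]; split.
- by split.
- by split=> //; apply: gmap_Trans0.
- by split=> //; apply: gmap_Trans0.
move=> p hp B hB e.
set p1 := p ++ _; have hp1 : is_path T0 p1 T' by apply/is_path_cat; exists T.
set p2 := rcons p1 (Rot X, T1).
have hp2 : is_path T0 p2 T1 by apply/is_path_rcons; exists T'.
set p3 := rcons p2 (Fold X, T).
have hp3 : is_path T0 p3 T by apply/is_path_rcons; exists T1.
have [B2 hB2 e2] := frame_of_shaped hT' cX' cx' nXx (dev_shaped hp1).
have K w : w \in corners T' -> glued T (Trans 0) T' w (gmap (Trans 0) w) ->
    mobius B2 (frame X x w) = mobius B (frame X x w).
  move=> hw gw; rewrite -e2 // /p1 cats1 -[w in LHS]gmap_Trans0.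
  by rewrite (dev_glue hD hp hs gw) e //; case: (gluedE gw).
(* B and B2 are known to agree at X and x only: a and b are the free ratio. *)
have [a [b eab]] := frame_eq_diag cX' cx' nXx hB2 hB (K X cX' gX) (K x cx' gx).
(* The rotation and the folding glue along faces, so nothing is lost there. *)
have rot w : w \in corners T' -> glued T' (Rot X) T1 w (gmap (Rot X) w).
  by move=> hw; have := cross_rot ha X hw; rewrite rot_target.
have [w [hw nwX nwx]] := third_corner hT' cX' cx'.
have e3 := face_adjacent hp1 hs2 (rot X cX') (rot x cx') (rot w hw) nXx nwX nwx
  nXx (rot X cX') (rot x cx') hB2 e2.
have rX : gmap (Rot X) X = X by lattice_eq.
have rx : gmap (Rot X) x = X + svec fr0 by rewrite /x; lattice_eq.
rewrite -/p2 rX rx in e3.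
have c1 a' b' y : y = corner (fr0, fr12) X a' b' -> y \in corners T1 by apply: corner_mem1.
have c0 a' b' y : y = corner (fr0, fr12) (X - svec fr0) a' b' -> y \in corners T by apply: corner_mem1.
have k0 : X \in corners T1 by apply: (@c1 false false); lattice_eq.
have k1 : X + svec fr0 \in corners T1 by apply: (@c1 true false); lattice_eq.
have k2 : X + svec fr12 \in corners T1 by apply: (@c1 false true); lattice_eq.
have n1 : X + svec fr0 != X by lattice_neq.
have n2 : X + svec fr12 != X by lattice_neq.
have n12 : X + svec fr0 != X + svec fr12 by lattice_neq.
have hI t : \det (transl t : 'M[C]_2) != 0 by rewrite det_transl oner_eq0.
pose t1 := - link X (X + svec fr12) (X + svec fr0).
have e4 : eq_on T1 (D p2) (fun u => mobius (B2 *m transl t1) (frame X (X + svec fr12) u)).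
  by move=> u hu; rewrite e3 // (frame_turn hT1 k0 k2 k1) // mobiusM.
have n2' : X != X + svec fr12 by rewrite eq_sym.
have fold u : u \in [:: X; X + svec fr0; X + svec fr12] ->
    glued T1 (Fold X) T u (gmap (Fold X) u) by apply: (cross_fold ha).
have f0 : glued T1 (Fold X) T X (gmap (Fold X) X) by apply: fold; rewrite !inE eqxx.
have f1 : glued T1 (Fold X) T (X + svec fr0) (gmap (Fold X) (X + svec fr0)).
  by apply: fold; rewrite !inE eqxx ?orbT.
have f2 : glued T1 (Fold X) T (X + svec fr12) (gmap (Fold X) (X + svec fr12)).
  by apply: fold; rewrite !inE eqxx ?orbT.
have e5 := face_adjacent hp2 hs3 f0 f2 f1 n2' n1 n12 n2' f0 f2 (det_mul2 hB2 (hI t1)) e4.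
rewrite -/p3 Fold_0 Fold_2 in e5.
have k3 : X + svec fr12 \in corners T by apply: (@c0 true true); lattice_eq.
pose t2 := - link X x (X + svec fr12).
have e6 : eq_on T (D p3) (fun u => mobius (B2 *m transl (t1 + t2)) (frame X x u)).
  move=> u hu; rewrite e5 // (frame_turn hT cX cx k3) //.
  by rewrite -mobiusM // -mulmxA transl_mul.
have [M hM eM] := shaped_equiv hT (dev_shaped hp) (dev_shaped hp3).
have [A [hA eA]] := det_normalize hM.
have {}eM : eq_on T (D p3) (fun u => mobius A (D p u)) by move=> u hu; rewrite eA eM.
have q_loop : cusp_loop alpha n T [:: (Trans 0, T'); (Rot X, T1); (Fold X, T)].
  split; first by [].
  exists X => //; split; first exact: gX.
  rewrite gmap_Trans0; split; first by have := rot X cX'.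
  by rewrite rX; split; [exact: f0 | exact: Fold_0].
have ep3 : p3 = p ++ [:: (Trans 0, T'); (Rot X, T1); (Fold X, T)].
  by rewrite /p3 /p2 /p1 -!cats1 -!catA.
have trA : (\tr A) ^+ 2 = 4%:R.
  by apply: (dev_parabolic hD hp q_loop); split=> //; rewrite -ep3.
have hA0 : \det A != 0 by rewrite hA oner_eq0.
have [|k hk eAB] := frame_eq hT cX cx nXx (det_mul2 hA0 hB) (det_mul2 hB2 (hI (t1 + t2))).
  by move=> u hu; rewrite mobiusM // -e // -eM // e6.
pose M' := k *: (mx2 a 0 0 b *m transl (t1 + t2)).
have {}eAB : A = B *m M' *m invmx B.
  rewrite -[LHS](mulmxK (unit2 hB)) eAB eab /M' -scalemxAr; congr (_ *m _).
  by rewrite mulmxA.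
have dM : \det M' = 1.
  by have := hA; rewrite eAB !det_mulmx mulrAC -det_mulmx mulmxV ?unit2 // det1 mul1r.
have tM : (\tr M') ^+ 2 = 4%:R.
  by move: trA; rewrite eAB mxtrace_mulC mulmxA mulVmx ?unit2 // mul1mx.
(* A matrix of determinant 1 has (trace)^2 = 4 only if the diagonal entries of
   its triangular form are equal. *)
have hab : a = b.
  move: dM tM; rewrite /M' mul_mx2 scale_mx2 det_mx2 tr2 !mx2E.
  rewrite !(mulr0, mul0r, mulr1, mul1r, addr0, add0r, subr0) => d1 d2.
  apply/eqP; rewrite -subr_eq0 -(mulrI_eq0 _ (mulfI hk)) -sqrf_eq0.
  have -> : (k * (a - b)) ^+ 2 = (k * a + k * b) ^+ 2 - 4%:R * (k * a * (k * b)) by ring.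
  by rewrite d2 d1 mulr1 subrr.
have ha0 : a != 0.
  by move: hB2; rewrite eab -hab det_mulmx det_mx2 !mulf_eq0 mulr0 subr0 mulf_eq0 orbb
    negb_or => /andP[].
move=> u hu; rewrite e2 // eab -hab.
have -> : mx2 a 0 0 a = a *: 1%:M by rewrite scalar_mx2 scale_mx2 !mulr1 !mulr0.
by rewrite -scalemxAr mulmx1 mobiusZ.
Qed.

(** The folding across the edge of slope 1/2 identifies a face of one tetrahedron
    with a face of the other. *)
Lemma linked_slope12 X : linked (1%N, X) X (X + svec fr12) (1%N, X - svec fr0) X (X + svec fr12).
Proof.
have fold u : u \in [:: X; X + svec fr0; X + svec fr12] ->
    glued (1%N, X) (Fold X) (1%N, X - svec fr0) u (gmap (Fold X) u).
  exact: (cross_fold ha).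
have f0 := fold X; have f1 := fold (X + svec fr0); have f2 := fold (X + svec fr12).
rewrite !inE !eqxx ?orbT /= in f0 f1 f2.
have n2 : X + svec fr0 != X by lattice_neq.
have n1 : X != X + svec fr12 by lattice_neq.
have n12 : X + svec fr0 != X + svec fr12 by lattice_neq.
have v1 := valid1 hn X; have v2 := valid1 hn (X - svec fr0).
have := linked_face v1 v2 (f0 isT) (f2 isT) (f1 isT) n1 n2 n12.
by rewrite Fold_0 Fold_2.
Qed.

(** Positive slopes are those of directions to the right, so x is the left end of
    the edge. *)
Definition reaches_top s x T := exists2 T', top alpha n s x T' & linked T x (x + svec s) T' x (x + svec s).

(** The third vertex w makes T and T' share a face. *)
Lemma reaches_top_step T T' s x w : valid T -> valid T' ->
    x \in corners T -> x + svec s \in corners T -> w \in corners T ->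
    x \in corners T' -> x + svec s \in corners T' -> w \in corners T' ->
    x != x + svec s -> w != x -> w != x + svec s ->
  reaches_top s x T' -> reaches_top s x T.
Proof.
move=> hT hT' h1 h2 h3 h4 h5 h6 n1 n2 n3 [T1 t1 c1]; exists T1 => //.
apply: linked_trans c1; exact: (linked_stack hT hT' h1 h2 h3).
Qed.

(** Two tetrahedra of the first level contain a given edge of slope 0 or 1/2; they
    are linked by [linked_slope0] and [linked_slope12]. *)
Lemma climb1 v x s : x \in corners (1%N, v) -> x + svec s \in corners (1%N, v) ->
  (0 < s.2)%N -> reaches_top s x (1%N, v).
Proof.
move=> hx hy hs; have hv := valid1 hn v.
have := positive_edges hv hx hy hs; rewrite /= funnel1 //.
case=> [[es ex]|[es ex]|[es ex]|H].
- exists (1%N, x); first by constructor 4.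
  case: ex => ex.
    have -> : v = x by rewrite ex; lattice_eq.
    exact: linked_refl.
  have := linked_slope0 (x + svec fr0).
  have -> : x + svec fr0 - svec fr0 = x by lattice_eq.
  have -> : x + svec fr0 - (3, 1) = v by rewrite ex; lattice_eq.
  rewrite es => h.
  have v1 := valid1 hn x.
  have m1 : x + svec fr0 \in corners (1%N, x) by apply: (corner_mem1 ha (a := true) (b := false)); lattice_eq.
  have m2 : x \in corners (1%N, x) by apply: (corner_mem1 ha (a := false) (b := false)); lattice_eq.
  have ne : x + svec fr0 != x by lattice_neq.
  have ne' : x != x + svec fr0 by rewrite eq_sym.
  have h2 := linked_swap v1 m1 m2 ne h.
  exact: (linked_sym v1 m2 m1 ne' h2).
- exists (1%N, x); first by constructor 2.
  case: ex => ex.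
    have -> : v = x by rewrite ex; lattice_eq.
    exact: linked_refl.
  have := linked_slope12 x.
  have -> : x - svec fr0 = v by rewrite ex; lattice_eq.
  rewrite es => h.
  have v1 := valid1 hn x.
  have m1 : x + svec fr12 \in corners (1%N, x) by apply: (corner_mem1 ha (a := false) (b := true)); lattice_eq.
  have m2 : x \in corners (1%N, x) by apply: (corner_mem1 ha (a := false) (b := false)); lattice_eq.
  have ne' : x != x + svec fr12 by lattice_neq.
  exact: (linked_sym v1 m2 m1 ne' h).
- exists (1%N, v); last exact: linked_refl.
  constructor 1; split=> //=; first by rewrite ex; lattice_eq.
  by rewrite funnel1.
exists (1%N, v); last exact: linked_refl.
constructor 3; case: H => [[es [_ ex]]|[_ []//]].
by split=> //; congr pair; rewrite ex; lattice_eq.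
Qed.

Lemma corner_mem_eq T x a b e : funnel alpha T.1 = e -> x = corner e T.2 a b -> x \in corners T.
Proof. by move=> he hx; apply: (@corner_mem alpha T x a b); rewrite he. Qed.

(** The tetrahedron with base point v0 one level above shares the face
    x, x + svec s, w with the given one; the booleans are the coordinates of w in
    the lower tetrahedron and of the three vertices in the upper one. *)
Lemma climb_step j v v0 x s w e e' a b a1 b1 a2 b2 a3 b3 :
    (forall v x s, x \in corners (j.+1, v) -> x + svec s \in corners (j.+1, v) ->
       (0 < s.2)%N -> reaches_top s x (j.+1, v)) ->
    valid (j.+2, v) -> x \in corners (j.+2, v) -> x + svec s \in corners (j.+2, v) ->
    (0 < s.2)%N -> funnel alpha j.+1 = e -> funnel alpha j.+2 = e' ->
    w = corner e' v a b -> x = corner e v0 a1 b1 -> x + svec s = corner e v0 a2 b2 ->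
    w = corner e v0 a3 b3 -> (a1, b1) != (a3, b3) -> (a2, b2) != (a3, b3) ->
  reaches_top s x (j.+2, v).
Proof.
move=> IH hv hx hy hs he he' ew' ex ey ew n1 n2.
have hv0 : valid (j.+1, v0) by exact: validS _ hv.
have mx : x \in corners (j.+1, v0) by exact: (@corner_mem_eq (j.+1, v0) x a1 b1 e he ex).
have my : x + svec s \in corners (j.+1, v0) by exact: (@corner_mem_eq (j.+1, v0) _ a2 b2 e he ey).
have mw : w \in corners (j.+1, v0) by exact: (@corner_mem_eq (j.+1, v0) w a3 b3 e he ew).
have mw' : w \in corners (j.+2, v) by exact: (@corner_mem_eq (j.+2, v) w a b e' he' ew').
have ceq := @corner_eq alpha n _ hv0 v0; rewrite /= he in ceq.
apply: (reaches_top_step hv hv0 hx hy mw' mx my mw); last exact: IH.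
- by apply/eqP => /(congr1 (fun u : lattice => u.1)) /=; move: hs; clear; lia.
- by rewrite ew ex ceq eq_sym.
- by rewrite ew ey ceq eq_sym.
Qed.

(** A face of a tetrahedron of level j + 2 that contains only one end of the
    bottom edge is a face of a tetrahedron of level j + 1. Every edge lies in
    such a face, except for the bottom edge, which is topmost itself. *)
Lemma climb j v x s : valid (j.+1, v) -> x \in corners (j.+1, v) ->
  x + svec s \in corners (j.+1, v) -> (0 < s.2)%N -> reaches_top s x (j.+1, v).
Proof.
elim: j v x s => [|j IH] v x s; first by move=> _; apply: climb1.
move=> hv hx hy hs.
have {}IH v0 x0 s0 : x0 \in corners (j.+1, v0) -> x0 + svec s0 \in corners (j.+1, v0) ->
    (0 < s0.2)%N -> reaches_top s0 x0 (j.+1, v0).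
  by apply: IH; exact: validS _ hv.
have H := positive_edges hv hx hy hs.
have [l1 [l2 [s1 [s2 E0]]]] : exists l1 l2 s1 s2, funnel alpha j.+1 = ((l1, l2), (s1, s2)).
  by case: (funnel alpha j.+1) => [[l1 l2] [s1 s2]]; exists l1, l2, s1, s2.
have hv1 : valid (j.+1, v) by exact: validS _ hv.
have he' := valid_local hv; have he := valid_edge alpha hv1.
have hat : ehat (funnel alpha j.+2) = (if (funnel alpha j.+2).1.2 < (funnel alpha j.+2).2.2
    then ((funnel alpha j.+2).2.1 - (funnel alpha j.+2).1.1, (funnel alpha j.+2).2.2 - (funnel alpha j.+2).1.2)
    else ((funnel alpha j.+2).1.1 - (funnel alpha j.+2).2.1, (funnel alpha j.+2).1.2 - (funnel alpha j.+2).2.2))%N.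
  by rewrite /ehat /eplus /eminus; case: ifP.
move: H; rewrite /= hat {hat he'}.
move: (funnel_cases alpha j.+1) he; rewrite /= E0 => FC [_ /= l20 s20 _ _].
rewrite /apex /oplus /= in FC.
pose step_ := fun v0 w e' => @climb_step j v v0 x s w ((l1, l2), (s1, s2)) e'.
have lt1 : (l2 < l2 + s2)%N = true by move: s20; clear; lia.
have lt2 : (l2 + s2 < s2)%N = false by clear; lia.
case: FC => E1; rewrite E1 /= ?lt1 ?lt2 => H.
- case: H => [[es [ex|ex]]|[es [ex|ex]]|[es ex]|[[es [_ ex]]|[_ [bad _]]]]; last by move: bad; clear; lia.
  + apply: (@step_ x (x + svec (l1 + s1, l2 + s2)%N) _ false true false false true false true true IH hv hx hy hs E0 E1) => //; rewrite ex ?es; lattice_eq.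
  + apply: (@step_ (x - svec (s1, s2)) (x - svec (s1, s2)) _ true false false true true true false false IH hv hx hy hs E0 E1) => //; rewrite ex ?es; lattice_eq.
  + apply: (@step_ x (x + svec (l1, l2)) _ true false false false true true true false IH hv hx hy hs E0 E1) => //; rewrite ex ?es; lattice_eq.
  + apply: (@step_ x (x + svec (s1, s2)) _ false true false false true true false true IH hv hx hy hs E0 E1) => //; rewrite ex ?es; lattice_eq.
  + exists (j.+2, v); last exact: linked_refl.
    by constructor 1; split=> //=; [rewrite ex; lattice_eq | rewrite E1 es].
  + apply: (@step_ x (x + svec (l1 + s1, l2 + s2)%N) _ true true false false false true true true IH hv hx hy hs E0 E1) => //; rewrite ex ?es; lattice_eq.
- case: H => [[es [ex|ex]]|[es [ex|ex]]|[es ex]|[[_ [bad _]]|[es [_ ex]]]]; last 2 first.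
  + by [].
  + apply: (@step_ x (x + svec (l1 + s1, l2 + s2)%N) _ true true false false true false true true IH hv hx hy hs E0 E1) => //; rewrite ex ?es; lattice_eq.
  + apply: (@step_ x (x + svec (s1, s2)) _ false true false false true true false true IH hv hx hy hs E0 E1) => //; rewrite ex ?es; lattice_eq.
  + apply: (@step_ x (x + svec (l1, l2)) _ true false false false true true true false IH hv hx hy hs E0 E1) => //; rewrite ex ?es; lattice_eq.
  + apply: (@step_ x (x + svec (l1 + s1, l2 + s2)%N) _ true false false false false true true true IH hv hx hy hs E0 E1) => //; rewrite ex ?es; lattice_eq.
  + apply: (@step_ (x - svec (l1, l2)) (x - svec (l1, l2)) _ false true true false true true false false IH hv hx hy hs E0 E1) => //; rewrite ex ?es; lattice_eq.
  + exists (j.+2, v); last exact: linked_refl.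
    by constructor 1; split=> //=; [rewrite ex; lattice_eq | rewrite E1 es].
Qed.

(** Both tetrahedra are linked to the same topmost tetrahedron at the edge. *)
Lemma linked_edge T T' x y : valid T -> valid T' -> x \in corners T -> y \in corners T ->
  x \in corners T' -> y \in corners T' -> x != y -> linked T x y T' x y.
Proof.
move=> hT hT'.
wlog gt0 : x y / 0 < (y - x).1.
  move=> H hx hy hx' hy' nxy.
  have := corner_fst_neq hT hx hy nxy.
  case: (ltrgtP (y - x).1 0) => // h _; last exact: H.
  have nyx : y != x by rewrite eq_sym.
  apply: (linked_swap hT hy hx nyx); apply: H => //.
  by move: h; rewrite /=; clear; lia.
move=> hx hy hx' hy' nxy.
have [ey s0] := corner_positive hT hx hy gt0.
have [T1 t1 c1] : reaches_top (slope x y) x T.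
  by case: T hT hx hy {ey} (ey) => [[|j] v] hT hx hy ey; [|apply: climb; rewrite -?ey].
have [T2 t2 c2] : reaches_top (slope x y) x T'.
  by case: T' hT' hx' hy' {c1} => [[|j] v] hT' hx' hy'; [|apply: climb; rewrite -?ey].
have e12 := top_unique t2 t1; rewrite {}e12 in c2.
rewrite -ey in c1 c2.
apply: linked_trans c1 _; exact: (linked_sym hT' hx' hy' nxy c2).
Qed.

(** Both tetrahedra are first joined to the two tetrahedra of the first level
    whose faces are folded onto each other. *)
Lemma linked_fold P T T' x y : valid T -> valid T' -> x != y ->
    x \in [:: P; P + svec fr0; P + svec fr12] -> y \in [:: P; P + svec fr0; P + svec fr12] ->
    x \in corners T -> y \in corners T ->
    gmap (Fold P) x \in corners T' -> gmap (Fold P) y \in corners T' ->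
  linked T x y T' (gmap (Fold P) x) (gmap (Fold P) y).
Proof.
move=> hT hT' nxy lx ly hx hy hx' hy'.
have v1 := valid1 hn P; have v2 := valid1 hn (P - svec fr0).
have gx := cross_fold ha lx; have gy := cross_fold ha ly.
have [cx cx' _ _] := gluedE gx; have [cy cy' _ _] := gluedE gy.
have n01 : P != P + svec fr0 by lattice_neq.
have n02 : P != P + svec fr12 by lattice_neq.
have n12 : P + svec fr0 != P + svec fr12 by lattice_neq.
have [w [lw nwx nwy]] : exists w, [/\ w \in [:: P; P + svec fr0; P + svec fr12], w != x & w != y].
  move: lx ly nxy; clear -n01 n02 n12; rewrite !inE.
  case/or3P => /eqP ->; case/or3P => /eqP -> //; rewrite ?eqxx // => _;
   solve [ exists P; rewrite !inE eqxx ?orbT; split=> //; rewrite // eq_sym //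
         | exists (P + svec fr0); rewrite !inE eqxx ?orbT; split=> //; rewrite // eq_sym //
         | exists (P + svec fr12); rewrite !inE eqxx ?orbT; split=> //; rewrite // eq_sym // ].
have gw := cross_fold ha lw.
apply: linked_trans (linked_edge hT v1 hx hy cx cy nxy) _.
apply: linked_trans (linked_face v1 v2 gx gy gw nxy nwx nwy) _.
by apply: linked_edge; rewrite // (inj_eq (@gmap_inj (Fold P))).
Qed.

(** The image of T' under the inverse of an element of Theta is a tetrahedron of
    the stack that shares an edge with T, and is glued to T' along faces. *)
Lemma linked_step T g T' x y : step T g T' -> x != y ->
    glued T g T' x (gmap g x) -> glued T g T' y (gmap g y) ->
  linked T x y T' (gmap g x) (gmap g y).
Proof.
case=> hT hT' _ nxy gx gy.
have [cx cx' dx _] := gluedE gx; have [cy cy' dy _] := gluedE gy.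
have J := inj_eq (@gmap_inj g).
suff H : (forall P, g <> Fold P) -> exists T1, valid T1 /\
    forall u, (u \in corners T1) = (gmap g u \in corners T').
  have Hnf : (forall P, g <> Fold P) -> linked T x y T' (gmap g x) (gmap g y).
    move=> nf; have [T1 [v1 E]] := H nf.
    have x1 : x \in corners T1 by rewrite E.
    have y1 : y \in corners T1 by rewrite E.
    have [w [hw nwx nwy]] := third_corner v1 x1 y1.
    have G u : u \in corners T1 -> glued T1 g T' u (gmap g u).
      move=> hu; apply/and4P; split; rewrite -?E //.
      by case: (g) nf => // P /(_ P).
    apply: linked_trans (linked_edge hT v1 cx cy x1 y1 nxy) _.
    exact: (linked_face v1 hT' (G x x1) (G y y1) (G w hw) nxy nwx nwy).
  case: g gx gy cx' cy' dx dy J H Hnf => [c|c|P] gx gy cx' cy' dx dy J H Hnf;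
    [by apply: Hnf | by apply: Hnf | clear H Hnf].
  have [p [hp K]] := Fold_corners alpha P hT.
  have lx := K x cx dx; have ly := K y cy dy.
  case: hp => ep; rewrite {}ep {K} in lx ly.
    exact: (@linked_fold P).
  have F u : u \in [:: P; P + svec fr1; P + svec fr12] ->
      gmap (Fold P) u \in [:: P; P + svec fr0; P + svec fr12].
    rewrite !inE => /or3P[] /eqP ->; rewrite ?Fold_0 ?Fold_1' ?Fold_2 eqxx ?orbT //.
  have nxy' : gmap (Fold P) x != gmap (Fold P) y by rewrite J.
  have := @linked_fold P T' T (gmap (Fold P) x) (gmap (Fold P) y) hT' hT nxy' (F x lx) (F y ly) cx' cy'.
  rewrite !gmap_FoldK => /(_ cx cy).
  exact: (linked_sym hT' cx' cy' nxy').
case: g {gx gy cx' cy' dx dy J} => [c|c|P] nf; last by case: (nf P).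
- exists (T'.1, T'.2 - (c + c)); split; first by move: hT'.
  move=> u; apply/cornersP/cornersP => -[a [b e]]; exists a, b;
    move: (congr1 (fun w : lattice => w.1) e) (congr1 (fun w : lattice => w.2) e);
    rewrite /gmap ?mulr2n /= => e1 e2; apply: latticeP; rewrite /=; move: e1 e2; clear; lia.
exists (T'.1, c + c - corner (funnel alpha T'.1) T'.2 true true); split; first by move: hT'.
move=> u; apply/cornersP/cornersP => -[a [b e]]; exists (~~ a), (~~ b);
  move: (congr1 (fun w : lattice => w.1) e) (congr1 (fun w : lattice => w.2) e);
  rewrite /gmap ?mulr2n /= => e1 e2; apply: latticeP; rewrite /=; move: e1 e2;
  case: a {e}; case: b; clear => /= e1 e2; lia.
Qed.

Lemma developing_rigid : rigid T0 D.
Proof. apply: (linked_rigid) => T g T' x y; exact: linked_step. Qed.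

End Rigidity.

(** * The holonomy group *)

Section Holonomy.
Hypotheses (ha : alpha < 1 / 2%:R) (hn : (0 < n)%N).
Local Notation PGamma := (PGamma z).
Local Notation parity_mx := (parity_mx z).

Let z0 : z != 0 := z_neq0.

(** The rotation of order two that reverses the edge from infinity to V(s); it
    takes the cusp frame at one end of an edge to the one at the other end
    ([cusp_frame_swap]). *)
Definition flip s : 'M[C]_2 := mx2 (V s) (- V s ^+ 2 - d s / q s ^+ 2) 1 (- V s).

Lemma det_flip s : \det (flip s) = d s / q s ^+ 2.
Proof. by rewrite det_mx2; ring. Qed.

Lemma mobius_flip s (w : C) : w != 0 ->
  mobius (flip s) (Some (w + V s)) = Some (V s - d s / q s ^+ 2 / w).
Proof.
move=> hw; have e : 1 * (w + V s) + - V s = w by rewrite mul1r addrK.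
rewrite /flip mobius_Some e //; congr Some; set k := d s / _; clearbody k.
by field.
Qed.

Lemma mobius_flip_oo s : mobius (flip s) None = Some (V s).
Proof. by rewrite /mobius /of_hom /flip !mx2E /= !mulr0 !mulr1 !addr0 oner_eq0 divr1. Qed.

Lemma mobius_flip_V s : mobius (flip s) (Some (V s)) = None.
Proof. by rewrite /mobius /of_hom /flip !mx2E /= mulr1 mul1r addrN eqxx. Qed.

Section OneTet.
Variable T : tet.
Hypothesis hT : valid T.
Local Notation e := (funnel alpha T.1).

Lemma det_flip_neq0 x y : x \in corners T -> y \in corners T -> x != y ->
  \det (flip (slope x y)) != 0.
Proof.
move=> hx hy nxy; have := swap_coef_neq0 hT hx hy nxy.
rewrite det_flip /swap_coef mulf_eq0 negb_or => /andP[_ h].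
by rewrite mulf_neq0 // d_neq0.
Qed.

Lemma cusp_frame_swap x y : x \in corners T -> y \in corners T -> x != y ->
  eq_on T (cusp_frame y x) (fun w => mobius (flip (slope x y)) (cusp_frame x y w)).
Proof.
move=> hx hy nxy w hw; have nyx : y != x by rewrite eq_sym.
case: (eqVneq w x) => [->|nwx].
  by rewrite cusp_frame_oo mobius_flip_oo cusp_frame_Some // link_id mulr0 add0r slopeC.
case: (eqVneq w y) => [->|nwy].
  by rewrite cusp_frame_oo cusp_frame_Some // link_id mulr0 add0r mobius_flip_V.
have h1 := link_neq0 hT hx hy hw nxy nwx nwy.
have h2 : row_sign x * link x y w != 0 by rewrite mulf_neq0 ?row_sign_neq0.
rewrite !cusp_frame_Some // mobius_flip // (slopeC x y) addrC; congr (Some (_ + _)).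
have := link_swap hT hx hy hw nxy nwx nwy.
rewrite /swap_coef evalz_dQ -row_sign_mul => E.
have -> : link y x w = - z ^+ (slope x y).2 / q (slope x y) ^+ 2 / link x y w by rewrite -E mulfK.
have := row_sign_neq0 x; move: h1.
move: (row_sign x) (row_sign y) (link x y w) (z ^+ _) (q _ ^+ 2)^-1 => s t u k l hu hs.
by field; rewrite hu hs.
Qed.

Lemma cusp_frame_turn x y w : x \in corners T -> y \in corners T -> w \in corners T ->
    y != x -> w != x ->
  eq_on T (cusp_frame x w) (fun u => mobius (transl (turn (y - x) (w - x))%:~R) (cusp_frame x y u)).
Proof.
move=> hx hy hw nyx nwx u hu; case: (eqVneq u x) => [->|nux].
  by rewrite !cusp_frame_oo mobius_transl_oo.
rewrite !cusp_frame_Some // mobius_transl; congr Some.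
have := link_cocycle hT hx hy hu hw nyx nux nwx; move=> ->.
rewrite mulrDr {2}/link [row_sign x * (row_sign x * _)]mulrA row_sign_sqr mul1r.
by ring.
Qed.

(** The position of a tetrahedron is compared with the cusp frame at its corner
    x. No symmetry is involved at the base point x0; at x the one given by
    the translation by x - x0 enters. *)
Definition Gamma_placed_at f x0 x y := exists2 A, PGamma A &
  eq_on T f (fun w => mobius (A *m parity_mx (x - x0)) (cusp_frame x y w)).

(** The flip moves the base point along an edge of slope s, so it carries the
    symmetry of the lattice vector of slope s. *)
Definition flip_in_coset s := exists2 A, PGamma A & flip s = A *m parity_mx (svec s).

(** Integral translations are in Gamma, and the Klein four-group normalises it. *)
Lemma Gamma_placed_turn f x0 x y w : x \in corners T -> y \in corners T -> w \in corners T ->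
  y != x -> w != x -> Gamma_placed_at f x0 x y -> Gamma_placed_at f x0 x w.
Proof.
move=> hx hy hw nyx nwx [A pA eA].
have [_ nP] := normalizes_parity z0 (x - x0).
have [A' pA' eA'] := nP _ (PGamma_transl z (turn (w - x) (y - x))).
exists (A *m A'); first exact: PGamma_mul.
move=> u hu; rewrite eA // (cusp_frame_turn hx hw hy) // -mobiusM ?det_transl ?oner_neq0 //.
by rewrite -mulmxA eA' mulmxA.
Qed.

(** The symmetries along an edge compose as lattice vectors do. *)
Lemma Gamma_placed_swap f x0 x y : x \in corners T -> y \in corners T -> x != y ->
  flip_in_coset (slope x y) -> Gamma_placed_at f x0 x y -> Gamma_placed_at f x0 y x.
Proof.
move=> hx hy nxy [A1 pA1 eA1] [A pA eA]; have nyx : y != x by rewrite eq_sym.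
have [_ nP] := normalizes_parity z0 (x - x0).
have [A' pA' eA'] := nP _ pA1.
have [c hc ec] := parity_mx_mul z0 (x - x0) (svec (slope x y)).
have ep : parity_mx (x - x0 + svec (slope x y)) = parity_mx (y - x0).
  by apply: parity_mx_eq; rewrite /slope /svec /=; move: (x.1) (x.2) (y.1) (y.2) (x0.1) (x0.2);
    clear => *; lia.
exists (A *m A'); first exact: PGamma_mul.
have hf := det_flip_neq0 hx hy nxy.
move=> u hu; rewrite eA // (cusp_frame_swap hy hx) // slopeC -mobiusM // eA1.
have -> : A *m parity_mx (x - x0) *m (A1 *m parity_mx (svec (slope x y))) =
  c *: (A *m A' *m parity_mx (y - x0)).
  by rewrite mulmxA -[A *m _ *m A1]mulmxA eA' !mulmxA -mulmxA ec ep -scalemxAr.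
by rewrite mobiusZ.
Qed.

(** Any two corners are joined by sides of the parallelogram, so the flips of the
    two side slopes suffice. *)
Lemma Gamma_placed_all f x0 x y : flip_in_coset e.1 -> flip_in_coset e.2 ->
    x \in corners T -> y \in corners T -> x != y -> Gamma_placed_at f x0 x y ->
  forall x' y', x' \in corners T -> y' \in corners T -> x' != y' -> Gamma_placed_at f x0 x' y'.
Proof.
move=> iL iS hx hy nxy g.
have he := valid_local hT; have fe := valid_edge alpha hT; have hp := valid_hat alpha hT.
pose c a b := corner e T.2 a b.
have mc a b : c a b \in corners T by apply/cornersP; exists a, b.
have ceq := @corner_eq alpha n _ hT T.2.
pose G u := forall w, w \in corners T -> u != w -> Gamma_placed_at f x0 u w.
have Gx : G x.
  by move=> w hw nxw; apply: Gamma_placed_turn g => //; rewrite eq_sym.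
have flipL a b : G (c a b) -> G (c (~~ a) b).
  move=> H w hw nw.
  have ne : c a b != c (~~ a) b by rewrite ceq; case: (a).
  have s : slope (c a b) (c (~~ a) b) = e.1.
    by rewrite (slope_corner _ _ _ _ _ fe hp) eqxx; case: (a).
  apply: (Gamma_placed_turn (y := c a b)); rewrite ?mc // 1?eq_sym //.
  by apply: Gamma_placed_swap; rewrite ?mc ?s //; apply: H; rewrite ?mc.
have flipS a b : G (c a b) -> G (c a (~~ b)).
  move=> H w hw nw.
  have ne : c a b != c a (~~ b) by rewrite ceq; case: (b); case: (a).
  have s : slope (c a b) (c a (~~ b)) = e.2.
    by rewrite (slope_corner _ _ _ _ _ fe hp) eqxx; case: (b).
  apply: (Gamma_placed_turn (y := c a b)); rewrite ?mc // 1?eq_sym //.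
  by apply: Gamma_placed_swap; rewrite ?mc ?s //; apply: H; rewrite ?mc.
have Gall a b : G (c a b).
  move: Gx; case/cornersP: hx => a' [b' ->] /= Gx.
  have [-> | ->] : a = a' \/ a = ~~ a' by case: (a) (a') => [] []; [left|right|right|left].
    have [-> // | ->] : b = b' \/ b = ~~ b' by case: (b) (b') => [] []; [left|right|right|left].
    exact: flipS.
  have [-> | ->] : b = b' \/ b = ~~ b' by case: (b) (b') => [] []; [left|right|right|left].
    exact: flipL.
  by apply: flipL; apply: flipS.
move=> x' y' /cornersP[a [b ->]] hy' n'; exact: Gall.
Qed.

(** Seen from x, the far end y of the diagonal is also reached along two sides.
    The comparison of the two ways expresses the flip of the diagonal through
    those of the sides. *)
Lemma flip_in_coset_apex : flip_in_coset e.1 -> flip_in_coset e.2 -> flip_in_coset (apex e).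
Proof.
move=> iL iS.
have he := valid_local hT; have fe := valid_edge alpha hT; have hp := valid_hat alpha hT.
pose c a b := corner e T.2 a b.
have mc a b : c a b \in corners T by apply/cornersP; exists a, b.
have ceq := @corner_eq alpha n _ hT T.2.
pose x := c false false; pose y := c true true.
have nxy : x != y by rewrite ceq.
have nyx : y != x by rewrite eq_sym.
have s : slope x y = apex e by rewrite (slope_corner _ _ _ _ _ fe hp).
have g0 : Gamma_placed_at (cusp_frame x y) x x y.
  exists 1%:M; first exact: PGamma_1.
  by move=> w hw; rewrite subrr [parity_mx 0]/(1%:M) mulmx1 mobius1.
have [A pA eA] := Gamma_placed_all iL iS (mc _ _) (mc _ _) nxy g0 (mc true true) (mc false false) nyx.
have hA := PGamma_det pA; have hP := det_parity_mx z0 (y - x).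
have hf : \det (flip (slope y x)) != 0 by apply: det_flip_neq0; rewrite ?mc.
have sp : shaped T (cusp_frame y x) by apply: (shaped_cusp_frame hT); rewrite ?mc.
have [|k hk ek] := shaped_mobius_eq hT sp hf (det_mul2 hA hP).
  by move=> w hw; rewrite -eA // (cusp_frame_swap (mc true true) (mc false false) nyx).
exists (k *: A); first by apply/PGamma_scale.
rewrite -s -(slopeC x y) ek -scalemxAl; congr (_ *: (_ *m _)); apply: parity_mx_eq.
  by rewrite (slopeC x y) /slope /svec /=; move: (y.1) (x.1); clear => a b; lia.
by rewrite (slopeC x y) /slope /svec /=; move: (y.2) (x.2); clear => a b; lia.
Qed.

End OneTet.

Lemma flip_in_coset_fr0 : flip_in_coset fr0.
Proof.
exists 1%:M; first exact: PGamma_1.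
rewrite mul1mx /flip /parity_mx /= (V_fr0) d_fr0 (q_fr0 _ hQ) /klein10 !expr1n divr1.
by congr mx2; ring.
Qed.

Lemma flip_in_coset_fr12 : flip_in_coset fr12.
Proof.
exists (z *: (mx2 1 1 0 1 *m (mx2 1 0 (- z^-1) 1 *m mx2 1 (-1) 0 1))).
  apply/PGamma_scale => //; apply: PGamma_mul (PGamma_T' z) _.
  exact: PGamma_mul (PGamma_U z) (PGamma_T z).
rewrite /flip /parity_mx /= (V_fr12) evalz_dQ (q_fr12 _ hQ) /klein01 /=.
by rewrite !mul_mx2 scale_mx2 mul_mx2; congr mx2; field.
Qed.

(** Each edge of the funnel keeps one endpoint and replaces the other one by the
    mediant, the slope of a diagonal. *)
Lemma flip_in_coset_funnel j : (0 < j <= n)%N ->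
  flip_in_coset (funnel alpha j).1 /\ flip_in_coset (funnel alpha j).2.
Proof.
elim: j => // -[|j] IH hj.
  by rewrite funnel1 //; split; [apply: flip_in_coset_fr0 | apply: flip_in_coset_fr12].
have hv : valid (j.+1, (0, 0) : lattice) by move: hj; rewrite /Defs.valid /=; clear; lia.
have [iL iS] := IH hv; have ia := flip_in_coset_apex hv iL iS.
by have := funnel_cases alpha j.+1; move=> /= [] ->.
Qed.

Definition Gamma_placed T f x0 := forall x y, x \in corners T -> y \in corners T -> x != y ->
  Gamma_placed_at T f x0 x y.

Lemma Gamma_placed_intro T f x0 x y : valid T -> x \in corners T -> y \in corners T -> x != y ->
  Gamma_placed_at T f x0 x y -> Gamma_placed T f x0.
Proof.
move=> hT hx hy nxy g x' y' hx' hy' n'; have [iL iS] := flip_in_coset_funnel hT.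
exact: (Gamma_placed_all hT iL iS hx hy nxy g hx' hy' n').
Qed.

(** A gluing by Theta preserves parities and slopes. A folding is seen from one of
    the two vertices that it fixes. *)
Lemma Gamma_placed_adjacent T f g T' f' x0 : step T g T' -> adjacent T f g T' f' -> Gamma_placed T f x0 -> Gamma_placed T' f' x0.
Proof.
move=> hs H G; have [hT hT' _] := hs; have [x [y [nxy gx gy]]] := step_pair hs.
have K x1 y1 : x1 != y1 -> glued T g T' x1 (gmap g x1) -> glued T g T' y1 (gmap g y1) ->
    row_sign (gmap g x1) = row_sign x1 ->
    V (slope (gmap g x1) (gmap g y1)) = V (slope x1 y1) ->
    (odd `|((gmap g x1 - x0).1)%R|%N = odd `|((x1 - x0).1)%R|%N) ->
    (odd `|((gmap g x1 - x0).2)%R|%N = odd `|((x1 - x0).2)%R|%N) -> Gamma_placed T' f' x0.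
  move=> n1 g1 g2 es eV p1 p2.
  have [c1 c1' _ _] := gluedE g1; have [c2 c2' _ _] := gluedE g2.
  have n1' : gmap g x1 != gmap g y1 by rewrite (inj_eq (@gmap_inj g)).
  apply: (Gamma_placed_intro hT' c1' c2' n1').
  have [A pA eA] := G _ _ c1 c2 n1.
  have hu := det_cusp_mx x1 y1; have hA := PGamma_det pA.
  have hP := det_parity_mx z0 (x1 - x0).
  exists A => //; rewrite (parity_mx_eq _ p1 p2) => w hw.
  rewrite (H _ _ n1 g1 g2 (A *m parity_mx (x1 - x0) *m cusp_mx x1 y1)) //.
  - by rewrite [RHS]/(mobius _ (mobius _ _)) /cusp_frame mobiusM // /cusp_mx es eV.
  - by do 2!apply: det_mul2 => //.
  by move=> u hu'; rewrite eA // [in LHS]/cusp_frame -mobiusM.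
have [cx cx' dx _] := gluedE gx; have [cy cy' dy _] := gluedE gy.
case: g {H hs} K gx gy cx' cy' dx dy => [c|c|P] K gx gy cx' cy' dx dy.
- apply: (K x y) => //.
  + by rewrite row_sign_Trans.
  + by rewrite /slope (gmap_diff c x y).1.
  + by rewrite /gmap mulr2n /=; clear; lia.
  by rewrite /gmap mulr2n /=; clear; lia.
- apply: (K x y) => //.
  + by rewrite row_sign_Rot.
  + by rewrite /slope (gmap_diff c x y).2 /= !abszN.
  + by rewrite /gmap mulr2n /=; clear; lia.
  by rewrite /gmap mulr2n /=; clear; lia.
have [p [hp F]] := Fold_corners alpha P hT.
have {}F u : u \in corners T -> gdom (Fold P) u -> (u = P \/ u = P + svec fr12) \/ u = p.
  move=> hu du; move: (F u hu du); rewrite !inE => /or3P[] /eqP ->.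
  - by left; left.
  - by right.
  by left; right.
have fixed u : u = P \/ u = P + svec fr12 -> gmap (Fold P) u = u.
  by case=> ->; [apply: Fold_0 | apply: Fold_2].
have slopes u v : u = P \/ u = P + svec fr12 -> (v = P \/ v = P + svec fr12) \/ v = p ->
    V (slope u (gmap (Fold P) v)) = V (slope u v).
  have [[s01 s01' s02] [s12 s12']] := slope_Fold P.
  have V01 : V fr0 = V fr1 by rewrite (V_fr0) (V_fr1).
  move=> hu [/fixed -> //|->]; case: hp => ->; case: hu => ->.
  - by rewrite Fold_1 s01 s01' V01.
  - by rewrite Fold_1 (slopeC (P + svec fr0) (P + svec fr12)) (slopeC (P + svec fr1) (P + svec fr12)) s12 s12' V01.
  - by rewrite Fold_1' s01 s01' V01.
  by rewrite Fold_1' (slopeC (P + svec fr0) (P + svec fr12)) (slopeC (P + svec fr1) (P + svec fr12)) s12 s12' V01.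
case: (F x cx dx) => [hx|ex].
  have ex := fixed x hx.
  apply: (K x y) => //; rewrite ?ex //.
  by apply: slopes => //; apply: F.
have hy : y = P \/ y = P + svec fr12.
  by case: (F y cy dy) => // ey; move: nxy; rewrite ex ey eqxx.
have ey := fixed y hy.
apply: (K y x) => //; rewrite ?ey //; first by rewrite eq_sym.
by apply: slopes => //; apply: F.
Qed.

Section HolonomyGroup.
Variables (T0 : tet) (D : dpath -> lattice -> CP1).
Hypotheses (hT0 : valid T0) (hD : rigid T0 D).
Local Notation parT := (mx2 1 (-1) 0 1 : 'M[C]_2).
Local Notation parU := (mx2 1 0 (- z^-1) 1 : 'M[C]_2).
Local Notation parU' := (mx2 1 0 (z^-1) 1 : 'M[C]_2).

Lemma rigid_Gamma_placed x0 : Gamma_placed T0 (D [::]) x0 -> forall p T, is_path T0 p T -> Gamma_placed T (D p) x0.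
Proof.
move=> g0; elim/last_ind => [|p [g T1] IH] T; first by move=> /= <-.
move=> /is_path_rcons[T2 h [hs <-]]; have [_ H] := hD.
exact: (Gamma_placed_adjacent hs (H _ _ _ _ h hs) (IH _ h)).
Qed.

(** Going back along the reverse path undoes the transport. *)
Lemma rigid_rev p T c T' : is_path T0 p T -> is_path T c T' ->
  eq_on T (D (p ++ c ++ revp T c)) (D p).
Proof.
have [_ H] := hD.
elim: c p T => [|[g T1] c IH] p T hp /=; first by rewrite cats0.
case=> hs hc; have hp1 : is_path T0 (rcons p (g, T1)) T1 by apply/is_path_rcons; exists T.
have e1 := IH _ _ hp1 hc.
rewrite -cat_rcons -rcons_cat -rcons_cat.
have hpc : is_path T0 (rcons p (g, T1) ++ c ++ revp T1 c) T1.
  apply/is_path_cat; exists T1 => //; apply/is_path_cat; exists T' => //.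
  exact: is_path_rev.
have hs' := step_sym hs.
apply: (adjacent_unique (rigid_shaped hD hpc) hs' (H _ _ _ _ hpc hs')).
have sp := rigid_shaped hD hp.
have := adjacent_sym sp hs (H _ _ _ _ hp hs).
apply: (adjacent_mobius (A := 1%:M)); first by rewrite det1 oner_neq0.
  by move=> w hw; rewrite mobius1 e1.
by move=> w hw; rewrite mobius1.
Qed.

Lemma holonomy_group_intro l A : \det A = 1 -> is_path T0 l T0 ->
  eq_on T0 (D l) (fun w => mobius A (D [::] w)) -> holonomy_group alpha n T0 D A.
Proof.
move=> hA hl e; exists l => //; split=> // p T hp; split=> //.
have hA0 : \det A != 0 by rewrite hA oner_neq0.
exact: (rigid_equiv hD hA0 (p := [::]) (p' := l) erefl hl hp e).
Qed.

Lemma holonomy_group_elim A : holonomy_group alpha n T0 D A -> \det A = 1 /\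
  exists2 l, is_path T0 l T0 & eq_on T0 (D l) (fun w => mobius A (D [::] w)).
Proof.
case=> l hl [hA H]; split=> //; exists l => //.
by have [_] := H [::] T0 erefl; rewrite cats0.
Qed.

Lemma holonomy_group_1 : holonomy_group alpha n T0 D 1%:M.
Proof.
apply: (@holonomy_group_intro [::]); rewrite ?det1 //.
by move=> w hw; rewrite mobius1.
Qed.

Lemma holonomy_group_mul A B : holonomy_group alpha n T0 D A ->
  holonomy_group alpha n T0 D B -> holonomy_group alpha n T0 D (A *m B).
Proof.
move=> /holonomy_group_elim[hA [l hl e]] /holonomy_group_elim[hB [l' hl' e']].
apply: (@holonomy_group_intro (l ++ l')).
- by rewrite det_mulmx hA hB mulr1.
- by apply/is_path_cat; exists T0.
have hA0 : \det A != 0 by rewrite hA oner_neq0.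
have E := rigid_equiv hD hA0 (p := [::]) (p' := l) erefl hl hl' e.
by move=> w hw; rewrite E // e' // mobiusM // hB oner_neq0.
Qed.

Lemma holonomy_group_inv A : holonomy_group alpha n T0 D A ->
  holonomy_group alpha n T0 D (invmx A).
Proof.
move=> /holonomy_group_elim[hA [l hl e]].
apply: (@holonomy_group_intro (revp T0 l)); first by rewrite det_inv hA invr1.
  exact: is_path_rev.
have hA0 : \det A != 0 by rewrite hA oner_neq0.
have E := rigid_equiv hD hA0 (p := [::]) (p' := l) erefl hl (is_path_rev hl) e.
have E2 := @rigid_rev [::] T0 l T0 erefl hl.
by move=> w hw; rewrite -E2 // [in RHS]E // mobiusK.
Qed.

Lemma holonomy_group_N A : holonomy_group alpha n T0 D A ->
  holonomy_group alpha n T0 D (- A).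
Proof.
move=> /holonomy_group_elim[hA [l hl e]]; apply: (@holonomy_group_intro l) => //.
  by rewrite -scaleN1r detZ2 sqrrN expr1n mul1r.
by move=> w hw; rewrite e // mobiusN.
Qed.

(** A loop based at the end of r is brought back to T0 along r. *)
Lemma holonomy_group_conj r T q A : \det A = 1 -> is_path T0 r T -> is_path T q T ->
  eq_on T (D (r ++ q)) (fun w => mobius A (D r w)) -> holonomy_group alpha n T0 D A.
Proof.
move=> hA hr hq e; have hA0 : \det A != 0 by rewrite hA oner_neq0.
have hrq : is_path T0 (r ++ q) T by apply/is_path_cat; exists T.
have hrev := is_path_rev hr.
apply: (@holonomy_group_intro ((r ++ q) ++ revp T0 r)) => //.
  by apply/is_path_cat; exists T.
have E := rigid_equiv hD hA0 hr hrq hrev e.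
have E2 := @rigid_rev [::] T0 r T erefl hr.
by move=> w hw; rewrite E // -[in RHS]E2.
Qed.

(** ** The holonomy group is contained in Gamma *)
Lemma holonomy_group_sub x0 y : x0 \in corners T0 -> y \in corners T0 -> x0 != y ->
    eq_on T0 (D [::]) (cusp_frame x0 y) ->
  forall A, holonomy_group alpha n T0 D A -> Gamma z A.
Proof.
move=> hx hy nxy e0 A /holonomy_group_elim[hA [l hl e]].
have P0 : parity_mx (x0 - x0) = 1%:M by rewrite subrr.
have g0 : Gamma_placed T0 (D [::]) x0.
  apply: (Gamma_placed_intro hT0 hx hy nxy).
  exists 1%:M; first exact: PGamma_1.
  by move=> w hw; rewrite P0 mulmx1 mobius1 e0.
have [A' pA' eA'] := rigid_Gamma_placed g0 hl hx hy nxy.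
rewrite P0 mulmx1 in eA'.
have hA0 : \det A != 0 by rewrite hA oner_neq0.
have sp := shaped_cusp_frame hT0 hx hy nxy.
have [|k hk ek] := shaped_mobius_eq hT0 sp hA0 (PGamma_det pA').
  by move=> w hw; rewrite -eA' // -e0 // -e.
by apply: Gamma_of_PGamma => //; rewrite ek; apply/PGamma_scale.
Qed.

(** ** Turning around a vertex at the top of the stack *)
Lemma adjacent_cusp_frame T f g T' f' x y M : adjacent T f g T' f' -> x != y -> \det M != 0 ->
    glued T g T' x (gmap g x) -> glued T g T' y (gmap g y) ->
    row_sign (gmap g x) = row_sign x -> V (slope (gmap g x) (gmap g y)) = V (slope x y) ->
    eq_on T f (fun w => mobius M (cusp_frame x y w)) ->
  eq_on T' f' (fun w => mobius M (cusp_frame (gmap g x) (gmap g y) w)).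
Proof.
move=> H nxy hM gx gy es eV e w hw; have hu := det_cusp_mx x y.
rewrite (H _ _ nxy gx gy (M *m cusp_mx x y)) ?det_mul2 //.
  by rewrite /cusp_frame mobiusM // /cusp_mx es eV.
by move=> u hu'; rewrite e // [in LHS]/cusp_frame -mobiusM.
Qed.

Lemma mem_side X : [/\ X \in corners (1%N, X - svec fr0), X - svec fr0 \in corners (1%N, X - svec fr0) &
   X + svec fr12 \in corners (1%N, X - svec fr0)].
Proof.
split.
- by apply: (corner_mem1 ha (a := true) (b := false)); lattice_eq.
- by apply: (corner_mem1 ha (a := false) (b := false)); lattice_eq.
by apply: (corner_mem1 ha (a := true) (b := true)); lattice_eq.
Qed.

Lemma mem_base X : [/\ X \in corners (1%N, X), X + svec fr0 \in corners (1%N, X) &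
   X + svec fr12 \in corners (1%N, X)].
Proof.
split.
- by apply: (corner_mem1 ha (a := false) (b := false)); lattice_eq.
- by apply: (corner_mem1 ha (a := true) (b := false)); lattice_eq.
by apply: (corner_mem1 ha (a := false) (b := true)); lattice_eq.
Qed.

(** Crossing the edge of slope 0 to the left of X and rotating about X goes half
    way around X, which translates the link by -1 with respect to the edge of
    slope 1/2. *)
Lemma half_turn p X M : is_path T0 p (1%N, X - svec fr0) -> \det M != 0 ->
    eq_on (1%N, X - svec fr0) (D p) (fun w => mobius M (cusp_frame X (X + svec fr12) w)) ->
  exists2 q, is_path (1%N, X - svec fr0) q (1%N, X) &
    eq_on (1%N, X) (D (p ++ q)) (fun w => mobius (M *m parT) (cusp_frame X (X + svec fr12) w)).
Proof.
set T := (1%N, X - svec fr0); set T' := (1%N, X - (3, 1)); set T1 := (1%N, X).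
set x := X - svec fr0 => hp hM e; have [_ H] := hD.
have [gX gx hs] := cross0 ha hn X; rewrite -/T -/T' -/x in gX gx hs.
have hs2 : step T' (Rot X) T1.
  by have := step_rot ha hn X (X - (3, 1)); rewrite rot_target.
have [m1 m2 m3] := mem_side X; have [k1 k2 k3] := mem_base X.
rewrite -/T -/x in m1 m2 m3; rewrite -/T1 in k1 k2 k3.
have hT : valid T by apply: valid1.
have hT1 : valid T1 by apply: valid1.
have nXx : X != x by rewrite /x; lattice_neq.
have nxX : x != X by rewrite eq_sym.
have n1 : X + svec fr0 != X by lattice_neq.
have n2 : X + svec fr12 != X by lattice_neq.
have hp1 : is_path T0 (rcons p (Trans 0, T')) T' by apply/is_path_rcons; exists T.
exists [:: (Trans 0, T'); (Rot X, T1)]; first by [].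
rewrite -cat_rcons cats1.
have t1 : turn (x - X) (X + svec fr12 - X) = -1.
  have -> : x - X = (-1, 0) by rewrite /x; lattice_eq.
  by have -> : X + svec fr12 - X = (2, 1) by lattice_eq.
have e1 : eq_on T (D p) (fun w => mobius (M *m parT) (cusp_frame X x w)).
  move=> w hw; rewrite e // (cusp_frame_turn hT m1 m2 m3 nxX n2) // t1.
  by rewrite -mobiusM // det_transl oner_neq0.
have hMT : \det (M *m parT) != 0 by rewrite det_mul2 // det_mx2 mulr0 subr0 mulr1 oner_neq0.
have e2 := adjacent_cusp_frame (H _ _ _ _ hp hs) nXx hMT gX gx.
rewrite !gmap_Trans0 in e2; have {}e2 := e2 erefl erefl e1.
have [_ cX' _ _] := gluedE gX; have [_ cx' _ _] := gluedE gx.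
rewrite gmap_Trans0 in cX'; rewrite gmap_Trans0 in cx'.
have rot w : w \in corners T' -> glued T' (Rot X) T1 w (gmap (Rot X) w).
  by move=> hw; have := cross_rot ha X hw; rewrite rot_target.
have sR : V (slope (gmap (Rot X) X) (gmap (Rot X) x)) = V (slope X x).
  by rewrite /slope (gmap_diff X X x).2 /= !abszN.
have e3 := adjacent_cusp_frame (H _ _ _ _ hp1 hs2) nXx hMT (rot X cX') (rot x cx') (row_sign_Rot _ _) sR e2.
have rX : gmap (Rot X) X = X by lattice_eq.
have rx : gmap (Rot X) x = X + svec fr0 by rewrite /x; lattice_eq.
rewrite rX rx in e3.
move=> w hw; rewrite e3 // (cusp_frame_turn hT1 k1 k2 k3 n1 n2) //.
have -> : turn (X + svec fr0 - X) (X + svec fr12 - X) = 0.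
  have -> : X + svec fr0 - X = (1, 0) by lattice_eq.
  by have -> : X + svec fr12 - X = (2, 1) by lattice_eq.
by have := mobius1 (cusp_frame X (X + svec fr0) w); rewrite scalar_mx2 => ->.
Qed.

(** The folding fixes the edge of slope 1/2 from X, so the frame at this edge is
    kept. *)
Lemma fold_turn p X M : is_path T0 p (1%N, X) -> \det M != 0 ->
    eq_on (1%N, X) (D p) (fun w => mobius M (cusp_frame X (X + svec fr12) w)) ->
  eq_on (1%N, X - svec fr0) (D (rcons p (Fold X, (1%N, X - svec fr0))))
    (fun w => mobius M (cusp_frame X (X + svec fr12) w)).
Proof.
move=> hp hM e; have [_ H] := hD; have hs := step_fold ha hn X.
have f0 : glued (1%N, X) (Fold X) (1%N, X - svec fr0) X (gmap (Fold X) X).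
  by apply: (cross_fold ha); rewrite !inE eqxx.
have f2 : glued (1%N, X) (Fold X) (1%N, X - svec fr0) (X + svec fr12) (gmap (Fold X) (X + svec fr12)).
  by apply: (cross_fold ha); rewrite !inE eqxx ?orbT.
have n2 : X != X + svec fr12 by lattice_neq.
have := adjacent_cusp_frame (H _ _ _ _ hp hs) n2 hM f0 f2.
by rewrite Fold_0 Fold_2; apply.
Qed.

(** In standard position the vertex X = v + (1, 0) is at infinity, and the half
    turn and the folding form a loop around it. *)
Lemma generator_T r v : is_path T0 r (1%N, v) ->
    eq_on (1%N, v) (D r) (cusp_frame (v + svec fr0) (v + svec fr0 + svec fr12)) ->
  holonomy_group alpha n T0 D parT.
Proof.
move=> hr e; pose X := v + svec fr0.
have ev : v = X - svec fr0 by rewrite /X; lattice_eq.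
have d1 : \det (1%:M : 'M[C]_2) != 0 by rewrite det1 oner_neq0.
have dT : \det parT = 1 by rewrite det_mx2; ring.
have hr' : is_path T0 r (1%N, X - svec fr0) by rewrite -ev.
have e' : eq_on (1%N, X - svec fr0) (D r) (fun w => mobius 1%:M (cusp_frame X (X + svec fr12) w)).
  by rewrite -ev => w hw; rewrite mobius1 e.
have [q hq eq] := half_turn hr' d1 e'.
have hrq : is_path T0 (r ++ q) (1%N, X) by apply/is_path_cat; exists (1%N, X - svec fr0).
have dM : \det (1%:M *m parT) != 0 by rewrite mul1mx dT oner_neq0.
have e2 := fold_turn hrq dM eq.
apply: (holonomy_group_conj dT hr' (q := rcons q (Fold X, (1%N, X - svec fr0)))).
  apply/is_path_rcons; exists (1%N, X) => //; split=> //; exact: (step_fold ha hn).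
by move=> w hw; rewrite -rcons_cat e2 // e' // mobius1 mul1mx.
Qed.

(** The same loop around v, entered at the folding. In standard position v is at
    V(0) - 1 = 0, so K, which moves the frame at v to this position, conjugates
    the translation to a parabolic that fixes 0. *)
Lemma generator_U r v : is_path T0 r (1%N, v) ->
    eq_on (1%N, v) (D r) (cusp_frame (v + svec fr0) (v + svec fr0 + svec fr12)) ->
  holonomy_group alpha n T0 D parU'.
Proof.
move=> hr e; have hT : valid (1%N, v) by apply: valid1.
have [m1 m2 m3] := mem_base v.
have m4 : v + svec fr0 + svec fr12 \in corners (1%N, v).
  by apply: (corner_mem1 ha (a := true) (b := true)); lattice_eq.
have n1 : v + svec fr0 != v by lattice_neq.
have n1' : v != v + svec fr0 by rewrite eq_sym.
have n2 : v + svec fr12 != v by lattice_neq.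
have n3 : v + svec fr0 + svec fr12 != v + svec fr0 by lattice_neq.
pose K : 'M[C]_2 := parT *m flip fr0.
have s0 : slope v (v + svec fr0) = fr0 by have [[]] := slope_Fold v.
have df : \det (flip fr0) != 0.
  by rewrite -s0; apply: (det_flip_neq0 hT); rewrite // eq_sym.
have dT : \det parT = 1 by rewrite det_mx2; ring.
have dK : \det K != 0 by rewrite det_mul2 // dT oner_neq0.
have E : eq_on (1%N, v) (D r) (fun w => mobius K (cusp_frame v (v + svec fr12) w)).
  move=> w hw; rewrite e // (cusp_frame_turn hT m2 m1 m4 n1' n3) //.
  have -> : turn (v - (v + svec fr0)) (v + svec fr0 + svec fr12 - (v + svec fr0)) = -1.
    have -> : v - (v + svec fr0) = (-1, 0) by lattice_eq.
    by have -> : v + svec fr0 + svec fr12 - (v + svec fr0) = (2, 1) by lattice_eq.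
  rewrite (cusp_frame_swap hT m1 m2 n1') // s0 -mobiusM //.
  congr (mobius _ _); rewrite (cusp_frame_turn hT m1 m3 m2 n2 n1) //.
  have -> : turn (v + svec fr12 - v) (v + svec fr0 - v) = 0.
    have -> : v + svec fr0 - v = (1, 0) by lattice_eq.
    by have -> : v + svec fr12 - v = (2, 1) by lattice_eq.
  by have := mobius1 (cusp_frame v (v + svec fr12) w); rewrite scalar_mx2.
have E1 := fold_turn hr dK E.
set r1 := rcons r _ in E1.
have hr1 : is_path T0 r1 (1%N, v - svec fr0).
  by apply/is_path_rcons; exists (1%N, v) => //; split=> //; apply: (step_fold ha hn).
have [q hq eq] := half_turn hr1 dK E1.
have dU : \det parU' = 1 by rewrite det_mx2; ring.
have eK : K *m parT = parU' *m K.
  rewrite /K /flip (V_fr0) d_fr0 (q_fr0 _ hQ) !mul_mx2; rewrite !expr1n !divr1.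
  by congr mx2; field; rewrite ?z0.
apply: (holonomy_group_conj dU hr (q := (Fold v, (1%N, v - svec fr0)) :: q)).
  by split=> //; apply: (step_fold ha hn).
move=> w hw; rewrite -cat_rcons -/r1 eq // eK E // mobiusM //.
Qed.

Lemma Gamma_sub_holonomy_group r v : is_path T0 r (1%N, v) ->
    eq_on (1%N, v) (D r) (cusp_frame (v + svec fr0) (v + svec fr0 + svec fr12)) ->
  forall A, Gamma z A -> holonomy_group alpha n T0 D A.
Proof.
move=> hr e.
have S A : SL_generated (fun A => A = parT \/ A = parU) A -> holonomy_group alpha n T0 D A.
  elim=> {A} [A [->|->]||A B _ hA _ hB|A _ hA].
  - exact: generator_T hr e.
  - have -> : parU = invmx parU'.
      by apply/esym/invmx_left; rewrite scalar_mx2 mul_mx2; congr mx2; ring.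
    by apply: holonomy_group_inv; apply: generator_U hr e.
  - exact: holonomy_group_1.
  - exact: holonomy_group_mul.
  exact: holonomy_group_inv.
move=> A [/S //|/S/holonomy_group_N]; by rewrite opprK.
Qed.

End HolonomyGroup.

End Holonomy.

End Geometry.

Theorem corollary5p29 (R : realType) (alpha : rat) (n : nat)
    (Q N : fareyfrac -> {poly int}) (z : R[i]) (v : lattice)
    (halpha0 : 0 < alpha) (halpha1 : alpha < 1 / 2%:R)
    (halpha2 : alpha <> 1 / 3%:R)
    (hn : funnel_stops alpha n)
    (hQ : is_calQ Q) (hN : is_calN Q N)
    (hz : in_H alpha n Q z) :
  (exists D, developing alpha n Q N z (1%N, v) D) /\
  (forall D, developing alpha n Q N z (1%N, v) D ->
     forall A : 'M[R[i]]_2,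
       holonomy_group alpha n (1%N, v) D A <-> Gamma z A).
Proof.
have n0 : (0 < n)%N.
  by case: n hn {hz} => // -[+ _]; rewrite funnel1 //= /fval /= => /esym.
have hT := valid1 n0 v; have [cA_ cB_ cC_ cD_] := corners_mem alpha (1%N, v).
have ceq := @corner_eq alpha n _ hT v.
have nBD : cB alpha (1%N, v) != cD alpha (1%N, v) by rewrite cB_corner cD_corner ceq.
have nCA : cC alpha (1%N, v) != cA (1%N, v) by rewrite cC_corner (cA_corner alpha) ceq.
split.
  pose f := cusp_frame Q N z (cB alpha (1%N, v)) (cD alpha (1%N, v)).
  have sf : shaped alpha Q z (1%N, v) f by apply: (shaped_cusp_frame hQ hN hz hT).
  exists (devel alpha Q N z (1%N, v) f).
  apply: (rigid_developing hQ hN hz hT (devel_rigid hQ hN hz sf)).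
  exact: (label_preserving_cusp_frame hQ hN hz hT).
move=> D hD A; have tD := developing_rigid hQ hN hz hD halpha1 n0.
have eB : cB alpha (1%N, v) = v + svec fr0 by rewrite /cB /= funnel1.
have eD : cD alpha (1%N, v) = v + svec fr0 + svec fr12 by rewrite /cD /= funnel1.
have eC : cC alpha (1%N, v) = v + svec fr12 by rewrite /cC /= funnel1.
have [b1|b2] := label_preserving_cases hQ hN hz halpha1 n0 (dev_base hD).
  split; first exact: (holonomy_group_sub hQ hN hz halpha1 hT tD cB_ cD_ nBD b1).
  rewrite eB eD in b1.
  exact: (Gamma_sub_holonomy_group hQ hN hz halpha1 n0 tD (r := [::]) erefl b1).
split; first exact: (holonomy_group_sub hQ hN hz halpha1 hT tD cC_ cA_ nCA b2).
(* The other label-preserving position becomes standard after a rotation. *)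
pose X := v + svec fr12; pose v' := X + X - v - (3, 1).
have hs : step alpha n (1%N, v) (Rot X) (1%N, v') by apply: (step_rot halpha1 n0).
have [_ H] := tD; have a1 := H [::] _ _ _ erefl hs.
rewrite eC -/X /cA /= in b2 nCA cC_ cA_.
have d1 : \det (1%:M : 'M[R[i]]_2) != 0 by rewrite det1 oner_neq0.
have rot w : w \in corners alpha (1%N, v) ->
  glued alpha (1%N, v) (Rot X) (1%N, v') w (gmap (Rot X) w) by apply: (cross_rot halpha1).
have sR : cusp_value Q N z (slope (gmap (Rot X) X) (gmap (Rot X) v)) = cusp_value Q N z (slope X v).
  by rewrite /slope (gmap_diff X X v).2 /= !abszN.
have b2' : eq_on alpha (1%N, v) (D [::]) (fun w => mobius 1%:M (cusp_frame Q N z X v w)).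
  by move=> w hw; rewrite mobius1 b2.
have e1 := adjacent_cusp_frame a1 nCA d1 (rot X cC_) (rot v cA_) (row_sign_Rot R _ _) sR b2'.
have rX : gmap (Rot X) X = v' + svec fr0.
  by rewrite /v' /X; apply: latticeP; rewrite /gmap ?mulr2n /=; clear; lia.
have rv : gmap (Rot X) v = v' + svec fr0 + svec fr12.
  by rewrite /v' /X; apply: latticeP; rewrite /gmap ?mulr2n /=; clear; lia.
have {}e1 : eq_on alpha (1%N, v') (D (rcons [::] (Rot X, (1%N, v'))))
    (cusp_frame Q N z (v' + svec fr0) (v' + svec fr0 + svec fr12)).
  by move=> w hw; rewrite e1 // mobius1 rX rv.
exact: (Gamma_sub_holonomy_group hQ hN hz halpha1 n0 tD
  (r := rcons [::] (Rot X, (1%N, v'))) (conj hs erefl) e1).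
Qed.
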